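(* Let $A$ and $B$ be irreducible square matrices with entries in $\{0,1\}$, of size greater than $1$ and not permutation matrices. Suppose that the one-sided topological Markov shifts $(X_A,\sigma_A)$ and $(X_B,\sigma_B)$ are continuously orbit equivalent via a homeomorphism $h:X_A\rightarrow X_B$. Then there exists an isomorphism $\Phi:\mathcal{O}_A\rightarrow\mathcal{O}_B$ satisfying the following conditions: (i) $\Phi(\mathcal{D}_A)=\mathcal{D}_B$; (ii) $\Phi\circ\rho^{A,f}_t=\rho^{B,\Psi_{h^{-1}}(f)}_t\circ\Phi$ for all $f\in C(X_A,\mathbb{Z})$ and $t\in\mathbb{R}/\mathbb{Z}$; (iii) $\Psi_{h^{-1}}:C(X_A,\mathbb{Z})\rightarrow C(X_B,\mathbb{Z})$ induces an isomorphism from $H^A$ to $H^B$ as ordered abelian groups.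
   Context: For an $N\times N$ matrix $A$ with entries in $\{0,1\}$, irreducible, $N>1$, not a permutation matrix: $X_A=\{(x_n)_{n\in\mathbb{N}}\in\{1,\dots,N\}^{\mathbb{N}}\mid A(x_n,x_{n+1})=1 \text{ for all } n\}$ with the relative product topology, and $\sigma_A((x_n)_n)=(x_{n+1})_n$. $\mathcal{O}_A$ (Cuntz--Krieger algebra) is the universal unital $C^*$-algebra generated by partial isometries $S_1,\dots,S_N$ with $\sum_{j}S_jS_j^*=1$ and $S_i^*S_i=\sum_{j}A(i,j)S_jS_j^*$. $\mathcal{D}_A\subset\mathcal{O}_A$ is the $C^*$-subalgebra generated by the projections $S_{i_1}\cdots S_{i_n}S_{i_n}^*\cdots S_{i_1}^*$; it is identified with $C(X_A)$ by letting this projection correspond to the characteristic function of the cylinder set $\{x\in X_A\mid x_1=i_1,\dots,x_n=i_n\}$. For $f\in C(X_A,\mathbb{Z})$ (continuous integer-valued functions) and $t\in\mathbb{R}/\mathbb{Z}$, $U_t(f)=\exp(2\pi\sqrt{-1}\,tf)\in\mathcal{D}_A$, and $\rho^{A,f}_t$ is the automorphism of $\mathcal{O}_A$ with $\rho^{A,f}_t(S_i)=U_t(f)S_i$ for all $i$. The same notation is used for $B$. $\mathbb{Z}_+$ denotes the nonnegative integers. $(X_A,\sigma_A)$ and $(X_B,\sigma_B)$ are continuously orbit equivalent via a homeomorphism $h:X_A\to X_B$ if there are continuous functions $k_1,l_1:X_A\to\mathbb{Z}_+$ and $k_2,l_2:X_B\to\mathbb{Z}_+$ with $\sigma_B^{k_1(x)}(h(\sigma_A(x)))=\sigma_B^{l_1(x)}(h(x))$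 for $x\in X_A$ and $\sigma_A^{k_2(y)}(h^{-1}(\sigma_B(y)))=\sigma_A^{l_2(y)}(h^{-1}(y))$ for $y\in X_B$. In this case $\Psi_{h^{-1}}:C(X_A,\mathbb{Z})\to C(X_B,\mathbb{Z})$ is $$\Psi_{h^{-1}}(f)(y)=\sum_{i=0}^{l_2(y)-1}f(\sigma_A^i(h^{-1}(y)))-\sum_{j=0}^{k_2(y)-1}f(\sigma_A^j(h^{-1}(\sigma_B(y))));$$ it does not depend on the choice of continuous functions $k_2,l_2:X_B\to\mathbb{Z}_+$ satisfying $\sigma_A^{k_2(y)}(h^{-1}(\sigma_B(y)))=\sigma_A^{l_2(y)}(h^{-1}(y))$ for $y\in X_B$. $H^A$ is the quotient of $C(X_A,\mathbb{Z})$ by $\{\xi-\xi\circ\sigma_A\mid\xi\in C(X_A,\mathbb{Z})\}$, ordered by the positive cone $H^A_+$ consisting of the classes of nonnegative functions. *)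

(* Defs.v *)
From HB Require Import structures.
From mathcomp Require Import all_boot all_order all_algebra ring_quotient.
From mathcomp Require Import all_classical all_reals all_analysis.
From mathcomp Require Import complex.

Set Implicit Arguments.
Unset Strict Implicit.
Unset Printing Implicit Defensive.

Import Order.TTheory GRing.Theory Num.Theory numFieldNormedType.Exports.

Local Open Scope classical_set_scope.
Local Open Scope ring_scope.
Local Open Scope complex_scope.
Local Open Scope quotient_scope.

Definition zero_one_mx (N : nat) (A : 'M[nat]_N) : Prop :=
  forall i j, A i j = 0%N \/ A i j = 1%N.

Definition irreducible_mx (N : nat) (A : 'M[nat]_N) : Prop :=
  forall i j, exists n : nat, (0 < n)%N /\ (0 < (A ^+ n) i j)%N.

(* The symbols 1, ..., N are the elements of 'I_N, and sequences are indexed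
   from 0; the topology is that of the subtype of the product. *)
Definition shift_space_set (N : nat) (A : 'M[nat]_N) :
    set (prod_topology (fun _ : nat => discrete_topology 'I_N)) :=
  [set x | forall n : nat, A (x n) (x n.+1) = 1%N].

Definition shift_space (N : nat) (A : 'M[nat]_N) : topologicalType :=
  set_type (shift_space_set A).

Definition mseq (N : nat) (A : 'M[nat]_N) (x : shift_space A) : nat -> 'I_N :=
  set_val x.

Lemma mseqP (N : nat) (A : 'M[nat]_N) (x : shift_space A) (n : nat) :
  A (mseq x n) (mseq x n.+1) = 1%N.
Proof. by have /set_mem := svalP x; apply. Qed.

Lemma shift_subproof (N : nat) (A : 'M[nat]_N) (x : shift_space A) :
  (fun n : nat => mseq x n.+1) \in shift_space_set A.
Proof. by apply/mem_set => n; exact: mseqP. Qed.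

Definition shift_map (N : nat) (A : 'M[nat]_N) (x : shift_space A) :
    shift_space A :=
  exist (fun y => y \in shift_space_set A) _ (shift_subproof x).

Definition cylinder (N : nat) (A : 'M[nat]_N) (mu : seq 'I_N) :
    set (shift_space A) :=
  [set x | mkseq (mseq x) (size mu) = mu].

Arguments cylinder {N} A mu.

Definition contZ_pred (X : topologicalType) : {pred X -> int} :=
  fun f => `[< continuous (f : X -> discrete_topology int) >].

Lemma continuous_discreteP (X : topologicalType) (T : choiceType)
    (f : X -> discrete_topology T) :
  continuous f <-> forall x, \forall y \near x, f y = f x.
Proof.
split=> [cf x|cf x]; last by apply/discrete_cvg; exact: cf.
exact: (cf x [set f x] (discrete_set1 (f x))).
Qed.

Lemma contZ_predP (X : topologicalType) (f : X -> int) :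
  f \in @contZ_pred X <-> forall x, \forall y \near x, f y = f x.
Proof.
by rewrite -(@continuous_discreteP _ int f); split=> [/asboolP|/asboolP].
Qed.

Lemma contZ_zmod_closed (X : topologicalType) : zmod_closed (@contZ_pred X).
Proof.
split=> [|f g /contZ_predP cf /contZ_predP cg]; apply/contZ_predP => x.
  exact: nearW.
by near=> y; rewrite !fctE; congr (_ - _); near: y; [exact: cf|exact: cg].
Unshelve. all: by end_near. Qed.

HB.instance Definition _ (X : topologicalType) :=
  GRing.isZmodClosed.Build (X -> int) (@contZ_pred X) (@contZ_zmod_closed X).

Record contZ (X : topologicalType) := ContZ {
  contZ_val :> X -> int ;
  contZ_valP : contZ_val \in @contZ_pred X
}.

HB.instance Definition _ (X : topologicalType) :=
  [isSub of contZ X for @contZ_val X].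
HB.instance Definition _ (X : topologicalType) := [Choice of contZ X by <:].
HB.instance Definition _ (X : topologicalType) :=
  [SubChoice_isSubZmodule of contZ X by <:].

Section OrderedCohomology.
Variables (N : nat) (A : 'M[nat]_N).

Definition coboundary : {pred contZ (shift_space A)} :=
  fun f => `[< exists xi : contZ (shift_space A),
                 forall x, f x = xi x - xi (shift_map x) >].

Lemma coboundary_zmod_closed : zmod_closed coboundary.
Proof.
split=> [|f g /asboolP[xi fE] /asboolP[eta gE]]; apply/asboolP.
  by exists 0 => x; rewrite /= subrr.
exists (xi - eta) => x.
by rewrite /= !fctE fE gE !opprD addrACA.
Qed.

HB.instance Definition _ :=
  GRing.isZmodClosed.Build (contZ (shift_space A)) coboundary
    coboundary_zmod_closed.

Definition Hgroup : zmodType := Quotient.quot coboundary.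

Definition Hclass (f : contZ (shift_space A)) : Hgroup :=
  \pi_(Quotient.quot coboundary) f.

Definition Hpos : set Hgroup :=
  [set Hclass f | f in [set f : contZ (shift_space A) | forall x, 0 <= f x]].

End OrderedCohomology.

Arguments Hgroup {N} A.
Arguments Hpos {N} A.

Definition induces_ordered_iso (N M : nat) (A : 'M[nat]_N) (B : 'M[nat]_M)
    (psi : contZ (shift_space A) -> contZ (shift_space B)) : Prop :=
  exists theta : {additive Hgroup A -> Hgroup B},
    [/\ bijective theta,
        forall f, theta (Hclass f) = Hclass (psi f) &
        theta @` Hpos A = Hpos B].

Lemma mseq_continuous (N : nat) (A : 'M[nat]_N) (n : nat) :
  continuous ((fun x => mseq x n) : shift_space A -> discrete_topology 'I_N).
Proof.
move=> x; have cv : {for x, continuous (@set_val _ (shift_space_set A))}.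
  exact: initial_continuous.
exact: (continuous_comp cv (@proj_continuous _ _ n _)).
Qed.

Lemma shift_continuous (N : nat) (A : 'M[nat]_N) : continuous (@shift_map N A).
Proof.
apply: continuous_comp_initial => x.
have FF := fmap_filter (set_val \o @shift_map N A) (@nbhs_filter _ x).
apply/(@cvg_sup _ _ _ _ _ FF) => n; move: x {FF}.
apply: (@continuous_comp_initial _ _ _ (fun y => y n)) => x.
exact: (@mseq_continuous _ _ n.+1 x).
Qed.

Record homeomorphism (X Y : topologicalType) := Homeomorphism {
  homeo :> X -> Y ;
  homeo_inv : Y -> X ;
  homeoK : cancel homeo homeo_inv ;
  homeo_invK : cancel homeo_inv homeo ;
  homeo_continuous : continuous homeo ;
  homeo_inv_continuous : continuous homeo_inv
}.

Section OrbitEquivalence.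
Variables (N M : nat) (A : 'M[nat]_N) (B : 'M[nat]_M).

Record orbit_cocycles (h : shift_space A -> shift_space B)
    (k l : shift_space A -> nat) : Prop := OrbitCocycles {
  orbit_cocycles_k : continuous k ;
  orbit_cocycles_l : continuous l ;
  orbit_cocyclesE : forall x,
    iter (k x) (@shift_map M B) (h (shift_map x)) =
    iter (l x) (@shift_map M B) (h x)
}.

End OrbitEquivalence.

Definition coe_via (N M : nat) (A : 'M[nat]_N) (B : 'M[nat]_M)
    (h : homeomorphism (shift_space A) (shift_space B)) : Prop :=
  (exists k1 l1, orbit_cocycles h k1 l1) /\
  (exists k2 l2, orbit_cocycles (homeo_inv h) k2 l2).

Section Psi.
Variables (N M : nat) (A : 'M[nat]_N) (B : 'M[nat]_M).
Variable h : homeomorphism (shift_space A) (shift_space B).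
Variables k2 l2 : shift_space B -> nat.
Hypothesis kl : orbit_cocycles (homeo_inv h) k2 l2.

Definition Psi_fun (f : shift_space A -> int) (y : shift_space B) : int :=
  \sum_(i < l2 y) f (iter i (@shift_map N A) (homeo_inv h y)) -
  \sum_(j < k2 y) f (iter j (@shift_map N A) (homeo_inv h (shift_map y))).

Lemma Psi_fun_contZ (f : contZ (shift_space A)) :
  Psi_fun f \in @contZ_pred (shift_space B).
Proof.
have contZ_comp (u : shift_space B -> shift_space A) : continuous u ->
    f \o u \in @contZ_pred (shift_space B).
  move=> cu; apply/contZ_predP => y.
  have /contZ_predP/(_ (u y)) fu := contZ_valP f.
  exact: (cu y _ fu).
have iterC i : continuous (iter i (@shift_map N A)).
  elim: i => [|i IH] x; first exact: cvg_id.
  exact: (continuous_comp (IH x) (@shift_continuous N A _)).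
have sumC (u : shift_space B -> shift_space A) n : continuous u ->
    (fun y => \sum_(i < n) f (iter i (@shift_map N A) (u y)))
      \in @contZ_pred (shift_space B).
  move=> cu.
  have -> : (fun y => \sum_(i < n) f (iter i (@shift_map N A) (u y))) =
      \sum_(i < n) (f \o (iter i (@shift_map N A) \o u)).
    by apply/funext => y; rewrite fct_sumE.
  apply: rpred_sum => i _; apply: contZ_comp => y.
  exact: (continuous_comp (cu y) (iterC i _)).
have cg := @homeo_inv_continuous _ _ h.
have cgs : continuous (fun y => homeo_inv h (shift_map y)).
  by move=> y; apply: (continuous_comp (@shift_continuous M B y)); exact: cg.
have natC (m : shift_space B -> nat) (y : shift_space B) :
    continuous m -> \forall z \near y, m z = m y.
  by move=> cm; apply: (cm y [set m y]); exact: discrete_set1.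
apply/contZ_predP => y; near=> z; rewrite /Psi_fun.
have -> : l2 z = l2 y by near: z; apply: natC; exact: orbit_cocycles_l kl.
have -> : k2 z = k2 y by near: z; apply: natC; exact: orbit_cocycles_k kl.
congr (_ - _); near: z.
  by have /contZ_predP := sumC _ (l2 y) cg; apply.
by have /contZ_predP := sumC _ (k2 y) cgs; apply.
Unshelve. all: by end_near. Qed.

Definition Psi (f : contZ (shift_space A)) : contZ (shift_space B) :=
  ContZ (Psi_fun_contZ f).

End Psi.

HB.mixin Record Algebra_isCStar (R : realType) E of GRing.Algebra R[i] E := {
  star : E -> E ;
  cnorm : E -> R ;
  starD : forall x y, star (x + y) = star x + star y ;
  starZ : forall (a : R[i]) x, star (a *: x) = conjc a *: star x ;
  starM : forall x y, star (x * y) = star y * star x ;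
  starK : forall x, star (star x) = x ;
  cnorm0_eq0 : forall x, cnorm x = 0 -> x = 0 ;
  cnormD : forall x y, cnorm (x + y) <= cnorm x + cnorm y ;
  cnormZ : forall (a : R[i]) x,
    cnorm (a *: x) = ComplexField.Normc.normc a * cnorm x ;
  cnormM : forall x y, cnorm (x * y) <= cnorm x * cnorm y ;
  cnorm_starM : forall x, cnorm (star x * x) = cnorm x ^+ 2 ;
  cnorm_complete : forall u : nat -> E,
    (forall e : R, 0 < e -> exists n0 : nat, forall m n : nat,
       (n0 <= m)%N -> (n0 <= n)%N -> cnorm (u m - u n) < e) ->
    exists x, (fun n => cnorm (u n - x)) @ \oo --> (0 : R)
}.

#[short(type="cstarType")]
HB.structure Definition CStar (R : realType) :=
  {E of Algebra_isCStar R E & GRing.Algebra R[i] E}.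

Record star_hom (R : realType) (E F : cstarType R) (phi : E -> F) : Prop :=
    StarHom {
  star_homD : forall x y, phi (x + y) = phi x + phi y ;
  star_homZ : forall (a : R[i]) x, phi (a *: x) = a *: phi x ;
  star_homM : forall x y, phi (x * y) = phi x * phi y ;
  star_hom1 : phi 1 = 1 ;
  star_hom_star : forall x, phi (star x) = star (phi x)
}.

Definition star_iso (R : realType) (E F : cstarType R) (phi : E -> F) : Prop :=
  star_hom phi /\ bijective phi.

Record cstar_subalgebra (R : realType) (E : cstarType R) (D : set E) : Prop :=
    CStarSubalgebra {
  cstar_sub0 : D 0 ;
  cstar_subD : forall x y, D x -> D y -> D (x + y) ;
  cstar_subZ : forall (a : R[i]) x, D x -> D (a *: x) ;
  cstar_subM : forall x y, D x -> D y -> D (x * y) ;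
  cstar_sub_star : forall x, D x -> D (star x) ;
  cstar_sub_closed : forall (u : nat -> E) (x : E), (forall n, D (u n)) ->
    (fun n => cnorm (u n - x)) @ \oo --> (0 : R) -> D x
}.

Definition cstar_generated (R : realType) (E : cstarType R) (G : set E) :
    set E :=
  smallest (@cstar_subalgebra R E) G.

Section CuntzKrieger.
Variables (R : realType) (N : nat) (A : 'M[nat]_N).

Definition partial_isometry (E : cstarType R) (x : E) : Prop :=
  x * star x * x = x.

Record CK_family (E : cstarType R) (S : 'I_N -> E) : Prop := CKFamily {
  CK_partial_isometry : forall i, partial_isometry (S i) ;
  CK_sum1 : \sum_j S j * star (S j) = 1 ;
  CK_relation : forall i,
    star (S i) * S i = \sum_j (S j * star (S j)) *+ A i j
}.

(* (O, S) is determined by this up to a unique isomorphism. *)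
Record CK_algebra (O : cstarType R) (S : 'I_N -> O) : Prop := CKAlgebra {
  CK_algebra_family : CK_family S ;
  CK_algebra_generated : cstar_generated (range S) = setT ;
  CK_algebra_universal : forall (E : cstarType R) (T : 'I_N -> E),
    CK_family T ->
    exists phi : O -> E, star_hom phi /\ forall i, phi (S i) = T i
}.

Section Diagonal.
Variables (O : cstarType R) (S : 'I_N -> O).

Definition CK_word (mu : seq 'I_N) : O := \prod_(i <- mu) S i.

Definition CK_proj (mu : seq 'I_N) : O := CK_word mu * star (CK_word mu).

Definition CK_diag : set O := cstar_generated (range CK_proj).

(* Only the values of iota on continuous functions are meaningful; R[i]^o
   is R[i] with its usual topology. *)
Record diag_identification (iota : (shift_space A -> R[i]^o) -> O) : Prop :=
    DiagIdentification {
  diag_idD : forall f g : shift_space A -> R[i]^o,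
    continuous f -> continuous g ->
    iota (fun x => f x + g x) = iota f + iota g ;
  diag_idZ : forall (a : R[i]) (f : shift_space A -> R[i]^o),
    continuous f ->
    iota (fun x => a * f x) = a *: iota f ;
  diag_idM : forall f g : shift_space A -> R[i]^o,
    continuous f -> continuous g ->
    iota (fun x => f x * g x) = iota f * iota g ;
  diag_id_star : forall f : shift_space A -> R[i]^o,
    continuous f ->
    iota (fun x => conjc (f x)) = star (iota f) ;
  diag_id_inj : forall f g : shift_space A -> R[i]^o,
    continuous f -> continuous g ->
    iota f = iota g -> f = g ;
  diag_id_image :
    iota @` [set f : shift_space A -> R[i]^o | continuous f] = CK_diag ;
  diag_id_cylinder : forall mu, iota (\1_(cylinder A mu)) = CK_proj mu
}.

(* The identification C(X_A) = D_A; such a map exists and is unique on C(X_A)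
   when (O, S) is the Cuntz-Krieger algebra of an irreducible A. *)
Definition diag_id : (shift_space A -> R[i]^o) -> O :=
  xget (fun=> 0) [set iota | diag_identification iota].

(* exp (sqrt (-1) theta) *)
Definition expi (theta : R) : R[i] := cos theta +i* sin theta.

Definition gauge_unitary (t : R) (f : shift_space A -> int) : O :=
  diag_id (fun x => expi (2 * pi * t * (f x)%:~R)).

(* Elements of R/Z are given by representatives t : R. The automorphism
   exists and, as the S i generate O, is unique. *)
Definition gauge_action (f : shift_space A -> int) (t : R) : O -> O :=
  xget (idfun : O -> O)
    [set rho : O -> O | star_iso rho /\
                        forall i, rho (S i) = gauge_unitary t f * S i].

End Diagonal.
End CuntzKrieger.

(* Main.v *)
Require Import Defs.
From HB Require Import structures.
From mathcomp Require Import all_boot all_order all_algebra ring_quotient.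
From mathcomp Require Import all_classical all_reals all_analysis.
From mathcomp Require Import perm complex.
From mathcomp Require Import ring lra.
From mathcomp Require Import zify.

(** The generator [S i] of the Cuntz-Krieger algebra of [A] acts like the
    partial map [x |-> i x] of the shift space.  Conjugated by the orbit
    equivalence [h] it becomes a partial map of the shift space of [B], and the
    cocycle equation of [h] says that this map replaces, locally, a prefix of
    some length [k] by a prefix of some length [l].  A single prefix exchange
    is implemented by [S_mu] times the adjoint of [S_nu], and by compactness a
    map that is locally of this kind is implemented by a finite sum of such
    elements ([implements_exists]).  Products and adjoints of elements implement
    compositions and inverses of maps.  The implementing element is unique
    ([implements_inj]): as [B] is irreducible and not a permutation matrix, the
    points that are not eventually periodic are dense ([aperiodic_dense]), and
    near such a point the map determines the lag [l - k].

    So relations between implementing elements are relations between partial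
    maps.  In particular the elements [T i] that implement the conjugated maps
    form a Cuntz-Krieger family for [A] ([transported_CK_family]), and the
    universal property gives a homomorphism [Phi].  It sends an element that
    implements [G] to one that implements the conjugate of [G]
    ([implements_transport]); hence the homomorphism built in the same way from
    the inverse of [h] is its inverse ([transported_inverse]).  Cylinder
    projections go to indicators of clopen sets, which is the statement on the
    diagonal subalgebras.

    For the gauge actions, the action of [f] multiplies a word that is a prefix
    of [x] by the phase of a Birkhoff sum of [f] along [x] ([gauge_word]).  The
    two sides of the intertwining relation, evaluated at [S i], therefore differ
    by a phase, which is trivial because the transfer along [h] inverts the
    transfer along the inverse of [h] ([PsiK]).  That identity holds at aperiodic
    points, where the cocycle of a function depends only on the two tail
    equivalent points and not on the exponents, and extends by density.

    The transfer maps coboundaries to coboundaries, so by [PsiK] it induces an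
    isomorphism of the cohomology groups.  For the order, a function whose sums
    over all periodic orbits are nonnegative is cohomologous to a nonnegative
    one: on a graph without negative cycles the lengths of shortest paths form a
    potential ([potential_exists]).  The transfer of a nonnegative function has
    nonnegative periodic sums, for it turns a period of [y] into an equation
    [sigma^a x = sigma^b x] with [b <= a]: the inverse branch of the shift at a
    periodic point is attracting, a topological property that [h] preserves
    ([no_contraction]).

    Three facts about C*-algebras enter.  Projections that sum to 1 are pairwise
    orthogonal, since 1 is an extreme point of the unit ball
    ([partition_orthogonal]); star homomorphisms are contractive
    ([star_hom_contractive]); and the norm of an element of the diagonal is
    bounded by its norms on small cylinders ([CK_diag_norm_le]), whence the
    identification of the diagonal with continuous functions ([diag_idP]). *)

Set Implicit Arguments.
Unset Strict Implicit.
Unset Printing Implicit Defensive.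
Import Order.TTheory GRing.Theory Num.Theory numFieldNormedType.Exports.

Local Open Scope classical_set_scope.
Local Open Scope ring_scope.

(** * Points, prefixes and cylinders of a one-sided shift *)

Section Shift.
Variables (N : nat) (A : 'M[nat]_N).
Notation X := (shift_space A).
Notation sigma := (@shift_map N A).

Lemma mseq_inj (x y : X) : mseq x =1 mseq y -> x = y.
Proof. by move=> xy; apply: val_inj; apply/funext. Qed.

Lemma mseq_iter k (x : X) i : mseq (iter k sigma x) i = mseq x (k + i).
Proof.
elim: k i => [|k IH] i //.
by rewrite -[LHS]/(mseq (iter k sigma x) i.+1) IH addSnnS.
Qed.

Definition agree n (x y : X) := forall i, (i < n)%N -> mseq x i = mseq y i.

Lemma agree_refl n x : agree n x x. Proof. by []. Qed.

Lemma agree_sym n x y : agree n x y -> agree n y x.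
Proof. by move=> xy i /xy. Qed.

Lemma agree_trans n x y z : agree n x y -> agree n y z -> agree n x z.
Proof. by move=> xy yz i ni; rewrite xy ?yz. Qed.

Lemma agree_le m n x y : (m <= n)%N -> agree n x y -> agree m x y.
Proof. by move=> mn xy i im; apply: xy; apply: leq_trans mn. Qed.

Lemma agreeD m n x y :
  agree (m + n) x y <-> agree m x y /\ agree n (iter m sigma x) (iter m sigma y).
Proof.
split=> [xy|[xy xy'] i im].
  split=> i im; first by apply: xy; lia.
  by rewrite !mseq_iter; apply: xy; lia.
case: (ltnP i m) => [/xy//|mi].
have := xy' (i - m)%N; rewrite !mseq_iter subnKC//; apply; lia.
Qed.

Lemma agree_iter_inj m x y :
  agree m x y -> iter m sigma x = iter m sigma y -> x = y.
Proof.
move=> xy xy'; apply: mseq_inj => i.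
have : agree (m + i.+1) x y by apply/agreeD; split=> //; rewrite xy'.
by apply; rewrite addnS ltnS leq_addl.
Qed.

Lemma point_exists (s : nat -> 'I_N) : (forall n, A (s n) (s n.+1) = 1%N) ->
  exists x : X, mseq x =1 s.
Proof. by move=> sA; exists (exist _ s (mem_set sA)). Qed.

Lemma splice_exists n (x y : X) :
  (n = 0)%N \/ A (mseq x n.-1) (mseq y 0) = 1%N ->
  exists z : X, agree n z x /\ iter n sigma z = y.
Proof.
move=> xy; pose s i := if (i < n)%N then mseq x i else mseq y (i - n)%N.
have [i|z zs] := @point_exists s.
  rewrite /s; case: (ltnP i.+1 n) => [ni|ni]; first by rewrite (ltnW ni) mseqP.
  case: (ltnP i n) => [ni'|ni']; last by rewrite subSn// mseqP.
  have ni2 : n = i.+1 by lia.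
  by rewrite ni2 subnn; move: xy; rewrite ni2 => -[].
exists z; split=> [i ni|]; first by rewrite zs /s ni.
apply: mseq_inj => i; rewrite mseq_iter zs /s.
by rewrite ltnNge leq_addr/= addKn.
Qed.

Lemma splice_eq n (x y : X) : mseq x n = mseq y 0 ->
  exists z : X, agree n z x /\ iter n sigma z = y.
Proof.
move=> xy; apply: splice_exists; case: n xy => [|n] xy; [by left|right].
by rewrite -xy/= mseqP.
Qed.

Lemma prepend_exists i (x : X) : A i (mseq x 0) = 1%N ->
  exists z : X, mseq z 0 = i /\ sigma z = x.
Proof.
move=> ix; have [[//|n]|z zs] := @point_exists (fun n => if n is n'.+1 then mseq x n' else i).
  exact: mseqP.
exists z; split; first by rewrite zs.
by apply: mseq_inj => n; rewrite -[LHS]/(mseq z n.+1) zs.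
Qed.

Lemma limit_exists (x : nat -> X) (L : nat -> nat) :
  (forall n, L n < L n.+1)%N -> (forall n, agree (L n) (x n) (x n.+1)) ->
  exists z : X, forall n, agree (L n) (x n) z.
Proof.
move=> Lmono xx.
have Ln n : (n <= L n)%N by elim: n => // n IH; apply: leq_ltn_trans IH _.
have Lle m n : (m <= n)%N -> (L m <= L n)%N.
  move=> /subnK <-; elim: (n - m)%N => // k IH.
  by rewrite addSn; apply: leq_trans IH (ltnW (Lmono _)).
have xle m n : (m <= n)%N -> agree (L m) (x m) (x n).
  move=> /subnK <-; elim: (n - m)%N => // k IH.
  rewrite addSn; apply: agree_trans IH _; apply: agree_le (xx _).
  by apply: Lle; lia.
have [i|z zx] := @point_exists (fun i => mseq (x i.+1) i).
  have /(_ i) -> := @xle i.+1 i.+2 (leqnSn _); last by apply: Ln.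
  exact: mseqP.
exists z => n i iL; rewrite zx.
case: (leqP n i.+1) => [ni|ni]; first exact: xle ni _ _.
by apply/esym/(xle i.+1 n (ltnW ni)); exact: Ln.
Qed.

(** The filter generated by the cylinders at [x] converges to [x], because
    its image in the full product converges in every coordinate. *)
Lemma agree_limit_nbhs (x : X) (P : set X) :
  nbhs x P -> exists n, forall y, agree n x y -> P y.
Proof.
pose F := filter_from [set: nat] (fun n => [set y | agree n x y]).
have FF : Filter F.
  apply: filter_from_filter; first by exists 0%N.
  move=> m n _ _; exists (maxn m n) => //= y xy.
  by split; apply: agree_le xy; rewrite ?leq_maxl ?leq_maxr.
suff : F --> x by move=> /[apply] -[n _ nP]; exists n.
have FG : Filter (fmap (@set_val _ (shift_space_set A)) F) by exact: fmap_filter.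
have : (@set_val _ (shift_space_set A)) @ F --> set_val x.
  apply/(@cvg_sup _ _ _ _ _ FG) => n.
  move=> B [_ [[C _ <-] /= Cx]] CB.
  rewrite /fmap/= /nbhs/=; exists n.+1 => // y xy /=.
  apply: CB => /=; rewrite -[set_val y n]/(mseq y n) -xy//; exact: Cx.
move=> cvF B [_ [[C Co <-] /= Cx]] CB.
have : nbhs (set_val x) C by exact: open_nbhs_nbhs.
by move=> /cvF [n _ nC]; exists n => // y /nC Cy; apply: CB.
Qed.

Lemma agree_nbhs (x : X) n : nbhs x [set y | agree n x y].
Proof.
elim: n => [|n IH]; first by apply: filterS filterT.
have cn : nbhs x [set y | mseq y n = mseq x n].
  exact: (@mseq_continuous _ A n x [set mseq x n] (discrete_set1 _)).
near=> y => /= i; rewrite ltnS leq_eqVlt => /predU1P[->|].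
  by apply/esym; near: y.
by move: i; rewrite -/(agree n x y); near: y.
Unshelve. all: by end_near. Qed.

(** Cylinders form a neighbourhood basis, so that all of the topology below
    can be expressed by agreement of prefixes. *)
Lemma nbhs_agree (x : X) (P : set X) :
  nbhs x P <-> exists n, forall y, agree n x y -> P y.
Proof.
split; first exact: agree_limit_nbhs.
by move=> [n nP]; apply: filterS (agree_nbhs x n).
Qed.

(** Compactness of the shift space, in the form of the fan theorem: what some
    prefix of every point decides is decided by prefixes of bounded length.
    If no length sufficed, the finitely branching tree of prefixes below which
    no length suffices would have an infinite branch. *)
Lemma fan (Q : X -> nat -> Prop) :
    (forall x n, Q x n -> Q x n.+1) ->
    (forall x y n, agree n x y -> Q x n -> Q y n) ->
  (forall x, exists n, Q x n) -> exists L, forall x, Q x L.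
Proof.
move=> Qmono Qloc Qex; apply: contrapT => noL.
have Qle x m n : (m <= n)%N -> Q x m -> Q x n.
  by move=> /subnK <-; elim: (n - m)%N => // k IH /IH; exact: Qmono.
pose bad (p : X * nat) := forall L, exists2 y, agree p.2 p.1 y & ~ Q y L.
have step (p : {p | bad p}) : exists q : {p | bad p},
    (sval q).2 = (sval p).2.+1 /\ agree (sval p).2 (sval p).1 (sval q).1.
  case: p => -[x n] /= bx; apply: contrapT => nostep.
  have bound (j : 'I_N) : exists L, forall y, agree n x y -> mseq y n = j -> Q y L.
    apply: contrapT => noLj.
    have [y [xy yj]] : exists y, agree n x y /\ mseq y n = j.
      apply: contrapT => noy; apply: noLj; exists 0%N => y xy yj.
      by exfalso; apply: noy; exists y.
    have by_ : bad (y, n.+1).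
      move=> L; apply: contrapT => noz; apply: noLj; exists L => z xz zj.
      apply: contrapT => nQ; apply: noz; exists z => //= i.
      rewrite ltnS leq_eqVlt => /predU1P[->|ni]; first by rewrite yj zj.
      by rewrite -xy// xz.
    by apply: nostep; exists (exist _ _ by_).
  pose Lj j := sval (cid (bound j)).
  have [y /= xy] := bx (\max_j Lj j)%N; apply.
  apply: (@Qle _ (Lj (mseq y n))); first exact: leq_bigmax.
  exact: (svalP (cid (bound _))).
have [x0 _] : exists x : X, True.
  by apply: contrapT => nox; apply: noL; exists 0%N => x; exfalso; apply: nox; exists x.
have bad0 : bad (x0, 0%N).
  move=> L; apply: contrapT => noy; apply: noL; exists L => y.
  by apply: contrapT => nQ; apply: noy; exists y.
pose next p := sval (cid (step p)).
pose p n := iter n next (exist _ _ bad0).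
have pS n : (sval (p n.+1)).2 = (sval (p n)).2.+1 /\
    agree (sval (p n)).2 (sval (p n)).1 (sval (p n.+1)).1.
  exact: (svalP (cid (step (p n)))).
have pn n : (sval (p n)).2 = n by elim: n => // n IH; rewrite (pS n).1 IH.
have [z zp] := @limit_exists (fun n => (sval (p n)).1) id
  (fun n => leqnn _) (fun n => ltac:(have := (pS n).2; rewrite pn; exact)).
have [n Qzn] := Qex z.
have [y /=] := svalP (p n) n; rewrite pn => py; apply.
apply: Qloc Qzn; apply: agree_trans (agree_sym (zp n)) py.
Qed.

End Shift.

(** * Density of the aperiodic points *)

Definition aperiodic (N : nat) (A : 'M[nat]_N) (x : shift_space A) :=
  forall a b, iter a (@shift_map N A) x = iter b (@shift_map N A) x -> a = b.

Section Irreducible.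
Variables (N : nat) (A : 'M[nat]_N).
Hypotheses (A01 : zero_one_mx A) (A_irr : irreducible_mx A).
Notation X := (shift_space A).
Notation sigma := (@shift_map N A).

Lemma entry_gt0 i j : (0 < A i j)%N -> A i j = 1%N.
Proof. by case: (A01 i j) => ->. Qed.

Lemma mulmx_gt0 (B C : 'M[nat]_N) i j : (0 < (B *m C) i j)%N ->
  exists k, (0 < B i k)%N /\ (0 < C k j)%N.
Proof.
rewrite mxE => BC; apply: contrapT => nok.
move: BC; rewrite big1// => k _.
case: (posnP (B i k)) => [->|Bik]; first by rewrite mul0r.
case: (posnP (C k j)) => [->|Ckj]; first by rewrite mulr0.
by exfalso; apply: nok; exists k.
Qed.

Lemma path_exists n i (y : X) : (0 < (A ^+ n) i (mseq y 0))%N ->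
  exists x : X, mseq x 0 = i /\ iter n sigma x = y.
Proof.
elim: n i => [|n IH] i.
  rewrite expr0 mxE; case: eqP => [->|]//= _; exists y; split=> //.
rewrite exprS => /mulmx_gt0 [k [Aik]] /IH [x [xk xy]].
have [|z [zi zx]] := @prepend_exists _ A i x; first by rewrite xk entry_gt0.
by exists z; rewrite iterSr zx.
Qed.

Lemma successor_exists i : exists j, A i j = 1%N.
Proof.
have [[|n] [n0 An]] := A_irr i i; first by [].
move: An; rewrite exprS => /mulmx_gt0 [k [Aik _]]; exists k; exact: entry_gt0.
Qed.

Lemma predecessor_exists j : exists i, A i j = 1%N.
Proof.
have [[|n] [n0 An]] := A_irr j j; first by [].
move: An; rewrite exprSr => /mulmx_gt0 [k [_ Akj]]; exists k; exact: entry_gt0.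
Qed.

Lemma point_starting i : exists x : X, mseq x 0 = i.
Proof.
pose s j := sval (cid (successor_exists j)).
have [n|x xs] := @point_exists _ A (fun n => iter n s i).
  exact: (svalP (cid (successor_exists _))).
by exists x; rewrite xs.
Qed.

Lemma connecting_point (i : 'I_N) (y : X) :
  exists (x : X) n, [/\ (0 < n)%N, mseq x 0 = i & iter n sigma x = y].
Proof.
have [n [n0 /path_exists [x [xi xy]]]] := A_irr i (mseq y 0).
by exists x, n.
Qed.

Hypothesis A_nperm : ~~ is_perm_mx A.

(** Otherwise the successor is a function of the letter; it is onto by
    irreducibility, hence a permutation, and [A] is its matrix. *)
Lemma branching_vertex : exists v a b, [/\ a != b, A v a = 1%N & A v b = 1%N].
Proof.
apply: contrapT => nobranch; move/negP: A_nperm; apply.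
pose s j := sval (cid (successor_exists j)).
have As i : A i (s i) = 1%N := svalP (cid (successor_exists i)).
have sP i j : A i j = 1%N -> j = s i.
  move=> Aij; apply/eqP/negPn/negP => ji; apply: nobranch.
  by exists i, j, (s i).
have s_inj : injective s.
  apply/injectiveP; rewrite /injectiveb /dinjectiveb.
  apply/card_uniqP; rewrite size_map -cardT; apply: eq_card => j.
  rewrite [RHS]inE; have [i /sP ->] := predecessor_exists j.
  by apply/mapP; exists i; rewrite ?mem_enum.
apply/existsP; exists (perm s_inj); apply/eqP/matrixP => i j.
rewrite !mxE permE; case: eqP => [<-|ne]; first by rewrite As.
by case: (A01 i j) => [->//|/sP ji]; case: ne.
Qed.

(** Every prefix can be continued to the branching vertex and from there in
    two ways. *)
Lemma no_isolated n (x : X) : exists y, agree n x y /\ y <> x.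
Proof.
have [v [a [b [ab Ava Avb]]]] := branching_vertex.
have [xa xa0] := point_starting a; have [xb xb0] := point_starting b.
have [|va [va0 vaE]] := @prepend_exists _ A v xa; first by rewrite xa0.
have [|vb [vb0 vbE]] := @prepend_exists _ A v xb; first by rewrite xb0.
have [ua [k [k0 ua0 uaE]]] := connecting_point (mseq x n) va.
have uk : mseq ua k = v by rewrite -va0 -uaE mseq_iter addn0.
have [|ub [ub0 ubE]] := @splice_eq _ A k ua vb; first by rewrite uk vb0.
have [|ya [ya0 yaE]] := @splice_eq _ A n x ua; first by rewrite ua0.
have [|yb [yb0 ybE]] := @splice_eq _ A n x ub; first by rewrite ub0// ua0.
have yaN : mseq ya (n + (k + 1)) = a.
  by rewrite -mseq_iter yaE -mseq_iter uaE -[LHS]/(mseq (sigma va) 0) vaE xa0.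
have ybN : mseq yb (n + (k + 1)) = b.
  by rewrite -mseq_iter ybE -mseq_iter ubE -[LHS]/(mseq (sigma vb) 0) vbE xb0.
have [yax|] := pselect (ya = x); last by exists ya; split=> //; exact: agree_sym.
exists yb; split; first exact: agree_sym.
by move=> ybx; move: ab; rewrite -yaN -ybN yax ybx eqxx.
Qed.

(** A point with [sigma^a y = sigma^b y] is determined by its first [b]
    letters, so two points with a long common prefix cannot both be of this
    kind. *)
Lemma not_eventually_periodic_near a b n (x : X) : (a < b)%N ->
  exists y, agree n x y /\ iter a sigma y <> iter b sigma y.
Proof.
move=> ab; have [xab|] := pselect (iter a sigma x = iter b sigma x); last by exists x.
have [y [xy yx]] := no_isolated (maxn n b) x; exists y; split.
  by apply: agree_le xy; rewrite leq_maxl.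
move=> yab; apply: yx; apply: mseq_inj; elim/ltn_ind => i IH.
case: (ltnP i b) => [ib|bi].
  by rewrite xy// leq_max ib orbT.
have E z : iter a sigma z = iter b sigma z -> mseq z i = mseq z (a + (i - b)).
  by move=> zab; rewrite -mseq_iter zab mseq_iter subnKC.
by rewrite !E// IH//; lia.
Qed.

(** A Baire category argument along an enumeration of the pairs [(a, b)]: the
    [k]-th step lengthens the prefix so as to exclude the [k]-th coincidence of
    iterates. *)
Lemma aperiodic_dense n (x : X) : exists y, agree n x y /\ aperiodic y.
Proof.
pose avoids (k : nat) (p : X * nat) := forall y, agree p.2 p.1 y ->
  if unpickle k is Some (a, b) then
    (a < b)%N -> iter a sigma y <> iter b sigma y else True.
have step k (p : X * nat) : exists q : X * nat,
    [/\ (p.2 < q.2)%N, agree p.2 p.1 q.1 & avoids k q].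
  case: p => z m; rewrite /avoids; case: unpickle => [[a b]|]; last by exists (z, m.+1).
  case: (ltnP a b) => [ab|_]; last by exists (z, m.+1).
  have [y [zy yab]] := not_eventually_periodic_near m z ab.
  have [i yi] : exists i, mseq y (a + i) <> mseq y (b + i).
    apply: contrapT => noi; apply: yab; apply: mseq_inj => i; rewrite !mseq_iter.
    by apply: contrapT => yi; apply: noi; exists i.
  exists (y, maxn m.+1 (b + i).+1); split => //=; first by rewrite leq_max leqnn.
  move=> w yw _ wab; apply: yi; rewrite !yw; last 2 first.
  - by rewrite leq_max; lia.
  - by rewrite leq_max; lia.
  by rewrite -!mseq_iter wab.
pose next k p := sval (cid (step k p)).
pose p := fix p k := if k is k'.+1 then next k' (p k') else (x, n).
have pS k : [/\ ((p k).2 < (p k.+1).2)%N, agree (p k).2 (p k).1 (p k.+1).1 &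
    avoids k (p k.+1)].
  exact: (svalP (cid (step k (p k)))).
have [z zp] := @limit_exists _ A (fun k => (p k).1) (fun k => (p k).2)
  (fun k => ltac:(by case: (pS k))) (fun k => ltac:(by case: (pS k))).
exists z; split; first exact: (zp 0%N).
have zab a b : (a < b)%N -> iter a sigma z <> iter b sigma z.
  have [_ _ /(_ z (zp _))] := pS (pickle (a, b)).
  by rewrite pickleK.
move=> a b E; case: (ltngtP a b) => // [/zab|/zab]; first by rewrite E.
by rewrite E.
Qed.

End Irreducible.

(** * Birkhoff sums and orbit cocycles *)

Section Birkhoff.
Variables (N : nat) (A : 'M[nat]_N).
Notation X := (shift_space A).
Notation sigma := (@shift_map N A).

Definition birkhoff (f : X -> int) n x := \sum_(i < n) f (iter i sigma x).

Lemma birkhoffD f m n x :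
  birkhoff f (m + n) x = birkhoff f m x + birkhoff f n (iter m sigma x).
Proof.
rewrite /birkhoff big_split_ord/=; congr (_ + _); apply: eq_bigr => i _.
by rewrite -iterD addnC.
Qed.

Lemma birkhoff_coboundary (f xi : X -> int) :
    (forall x, f x = xi x - xi (sigma x)) ->
  forall n x, birkhoff f n x = xi x - xi (iter n sigma x).
Proof.
move=> fE; elim=> [|n IH] x; first by rewrite /birkhoff big_ord0 subrr.
by rewrite -addn1 birkhoffD IH /birkhoff big_ord1 fE addn1 /= addrA addrNK.
Qed.

(** The groupoid cocycle that extends [f], on a pair of tail equivalent points.
    It is a relation, since the lag [a - b] of eventually periodic points is not
    unique. *)
Definition cocyc (f : X -> int) x x' v := exists a b,
  iter a sigma x = iter b sigma x' /\ v = birkhoff f a x - birkhoff f b x'.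

Lemma cocyc_sym f x x' v : cocyc f x x' v -> cocyc f x' x (- v).
Proof. by move=> [a [b [E ->]]]; exists b, a; rewrite opprB. Qed.

Lemma cocyc_trans f x x' x'' v w :
  cocyc f x x' v -> cocyc f x' x'' w -> cocyc f x x'' (v + w).
Proof.
move=> [a [b [E ->]]] [c [d [E' ->]]].
exists (a + c)%N, (d + b)%N; split.
  by rewrite addnC iterD E -iterD addnC iterD E' -iterD addnC.
rewrite !birkhoffD E -E'.
have := birkhoffD f b c x'; rewrite addnC birkhoffD => h; lia.
Qed.

Lemma cocyc_shift f x : cocyc f x (sigma x) (f x).
Proof. by exists 1%N, 0%N; rewrite /birkhoff big_ord1 big_ord0 subr0. Qed.

(** The lag is unique when [x'] is not eventually periodic, and two pairs of
    exponents with the same lag differ by a common tail, whose contribution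
    cancels. *)
Lemma cocyc_inj f x x' v w : aperiodic x' ->
  cocyc f x x' v -> cocyc f x x' w -> v = w.
Proof.
move=> ax' [a [b [E ->]]] [c [d [E' ->]]].
have bd : (b + c = d + a)%N.
  by apply: ax'; rewrite addnC iterD -E -iterD addnC iterD E' -iterD addnC.
wlog ac : a b c d E E' bd / (a <= c)%N.
  case: (leqP a c) => [ac|/ltnW ca]; first exact.
  by move=> /(_ c d a b E' E (esym bd) ca).
have [e cE] : exists e, c = (a + e)%N by exists (c - a)%N; lia.
have dE : d = (b + e)%N by lia.
by rewrite cE dE !birkhoffD E; lia.
Qed.

Lemma aperiodic_shift x : aperiodic x -> aperiodic (sigma x).
Proof. by move=> ax a b; rewrite -!iterSr => /ax []. Qed.

Lemma contZP (f : contZ X) x : exists n, forall y, agree n x y -> f y = f x.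
Proof. by apply/nbhs_agree; have /contZ_predP := contZ_valP f; apply. Qed.

Lemma contZ_uniform (f : contZ X) :
  exists n, forall x y, agree n x y -> f x = f y.
Proof.
have [] := @fan _ A (fun x n => forall y, agree n x y -> f x = f y).
- by move=> x n xn y xy; apply: xn; apply: agree_le xy.
- move=> x y n xy xn z yz; rewrite -(xn _ xy); apply: xn; exact: agree_trans yz.
- by move=> x; have [n xn] := contZP f x; exists n => y /xn.
by move=> n nP; exists n => x y /nP.
Qed.

Lemma contZ_agree (f : X -> int) :
  (forall x, exists n, forall y, agree n x y -> f y = f x) -> f \in @contZ_pred X.
Proof. by move=> fP; apply/contZ_predP => x; apply/nbhs_agree. Qed.

End Birkhoff.

(** * The transfer of integer functions along an orbit equivalence *)

Section Psi.
Variables (N M : nat) (A : 'M[nat]_N) (B : 'M[nat]_M).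
Variable h : homeomorphism (shift_space A) (shift_space B).
Variables k2 l2 : shift_space B -> nat.
Hypothesis kl : orbit_cocycles (homeo_inv h) k2 l2.
Notation sA := (@shift_map N A).
Notation sB := (@shift_map M B).
Notation g := (homeo_inv h).

Lemma locally_constant_nat (T : topologicalType) (m : T -> nat) : continuous m ->
  forall x, nbhs x [set y | m y = m x].
Proof. by move=> cm x; apply: (cm x [set m x]); exact: discrete_set1. Qed.

(** The relations of orbit equivalence along an orbit segment compose, and the
    sums telescope.  The exponents serve a whole neighbourhood of [y], which is
    what the comparison of germs at a periodic point needs. *)
Lemma Psi_birkhoff (f : shift_space A -> int) p y : exists a b n,
  forall y', agree n y y' ->
    iter b sA (g (iter p sB y')) = iter a sA (g y') /\
    birkhoff (Psi_fun h k2 l2 f) p y' =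
      birkhoff f a (g y') - birkhoff f b (g (iter p sB y')).
Proof.
elim: p => [|p [a [b [n IH]]]].
  by exists 0%N, 0%N, 0%N => y' _; rewrite /birkhoff !big_ord0.
have [m mP] : exists m, forall w, agree m (iter p sB y) w ->
    l2 w = l2 (iter p sB y) /\ k2 w = k2 (iter p sB y).
  apply/nbhs_agree; near=> w; split; near: w.
    exact: locally_constant_nat (orbit_cocycles_l kl) _.
  exact: locally_constant_nat (orbit_cocycles_k kl) _.
set l := l2 (iter p sB y) in mP; set k := k2 (iter p sB y) in mP.
exists (a + l)%N, (b + k)%N, (maxn n (p + m)) => y' yy'.
have [E1 E2] := IH y' (agree_le (leq_maxl _ _) yy').
have [_ /mP [lE kE]] := (agreeD p m y y').1 (agree_le (leq_maxr _ _) yy').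
have E3 := orbit_cocyclesE kl (iter p sB y'); rewrite lE kE in E3.
split.
  by rewrite iterD E3 -iterD addnC iterD E1 -iterD addnC.
rewrite -addn1 birkhoffD E2 {3}/birkhoff big_ord1 /= /Psi_fun lE kE.
rewrite addn1 /= -!/(birkhoff _ _ _).
have H1 := birkhoffD f a l (g y'); rewrite -E1 in H1.
have H2 := birkhoffD f k b (g (sB (iter p sB y'))); rewrite E3 addnC in H2.
have H3 := birkhoffD f l b (g (iter p sB y')).
have H4 := birkhoffD f b l (g (iter p sB y')); rewrite addnC in H4.
rewrite H1 H2; rewrite H3 in H4.
have aux (s t u v w z : int) : u + z = t + w -> s - t + (u - v) = s + w - (v + z).
  by lia.
exact: aux H4.
Unshelve. all: by end_near. Qed.

(** Both sums telescope, and their far ends cancel by the cocycle equation. *)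
Lemma Psi_coboundary (f xi : shift_space A -> int) y :
    (forall x, f x = xi x - xi (sA x)) ->
  Psi_fun h k2 l2 f y = xi (g y) - xi (g (sB y)).
Proof.
move=> fE; rewrite /Psi_fun -!/(birkhoff _ _ _) !(birkhoff_coboundary fE).
rewrite (orbit_cocyclesE kl); lia.
Qed.

Lemma Psi_additive : zmod_morphism (Psi kl).
Proof.
move=> f1 f2; apply: val_inj; apply/funext => y /=.
rewrite !fctE /Psi_fun /= !sumrB.
have aux (s t u v : int) : s - t - (u - v) = (s - u) - (t - v) by lia.
exact: aux.
Qed.

End Psi.

(** * Invertibility of the transfer *)

Definition homeomorphism_sym (X Y : topologicalType) (h : homeomorphism X Y) :=
  Homeomorphism (homeo_invK h) (homeoK h) (@homeo_inv_continuous _ _ h)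
    (@homeo_continuous _ _ h).

Section PsiInverse.
Variables (N M : nat) (A : 'M[nat]_N) (B : 'M[nat]_M).
Hypotheses (A01 : zero_one_mx A) (A_irr : irreducible_mx A)
  (A_nperm : ~~ is_perm_mx A).
Notation sA := (@shift_map N A).
Notation sB := (@shift_map M B).

Lemma contZ_eq_aperiodic (f f' : contZ (shift_space A)) :
  (forall x, aperiodic x -> f x = f' x) -> f = f'.
Proof.
move=> ff'; apply: val_inj; apply/funext => x /=.
have [m mf] := contZP f x; have [n nf] := contZP f' x.
have [y [xy ay]] := aperiodic_dense A01 A_irr A_nperm (maxn m n) x.
rewrite -(mf y) ?(ff' _ ay) ?(nf y)//; apply: agree_le xy.
  by rewrite leq_maxr.
by rewrite leq_maxl.
Qed.

Lemma cocyc_Psi (h : homeomorphism (shift_space A) (shift_space B))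
    (k2 l2 : shift_space B -> nat) (kl : orbit_cocycles (homeo_inv h) k2 l2)
    (f : shift_space A -> int) p y :
  cocyc f (homeo_inv h y) (homeo_inv h (iter p sB y))
    (birkhoff (Psi_fun h k2 l2 f) p y).
Proof.
have [a [b [n /(_ y (agree_refl _))[E1 E2]]]] := Psi_birkhoff kl f p y.
by exists a, b.
Qed.

(** At an aperiodic [x] both sides are the value of the cocycle of [f] on the
    pair formed by [x] and [sigma x]. *)
Lemma PsiK (h : homeomorphism (shift_space A) (shift_space B)) k1 l1 k2 l2
    (kl1 : orbit_cocycles (homeo_inv (homeomorphism_sym h)) k1 l1)
    (kl2 : orbit_cocycles (homeo_inv h) k2 l2) :
  cancel (Psi kl2) (Psi kl1).
Proof.
move=> f; apply: contZ_eq_aperiodic => x ax.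
apply: (@cocyc_inj _ _ f x (sA x)); first exact: aperiodic_shift.
  rewrite /= /Psi_fun /= -!/(birkhoff _ _ _).
  have c1 := cocyc_Psi kl2 f (l1 x) (h x).
  have := cocyc_Psi kl2 f (k1 x) (h (sA x)).
  rewrite (orbit_cocyclesE kl1 x) => /cocyc_sym c2.
  have := cocyc_trans c1 c2; rewrite !homeoK; exact.
exact: cocyc_shift.
Qed.

End PsiInverse.

(** * Functions with nonnegative sums over periodic orbits *)

Section Potential.
Variables (N : nat) (A : 'M[nat]_N).
Notation X := (shift_space A).
Notation sigma := (@shift_map N A).

Lemma contZ_bounded (f : contZ X) : exists C : nat, forall x, `|f x| <= C%:Z.
Proof.
have [] := @fan _ A (fun x n => forall y, agree n x y -> `|f y| <= n%:Z).
- move=> x n xn y xy; apply: (@le_trans _ _ n%:Z); last by rewrite lez_nat.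
  by apply: xn; apply: agree_le xy.
- by move=> x y n xy xn z yz; apply: xn; exact: agree_trans yz.
- move=> x; have [n xn] := contZP f x; exists (maxn n `|f x|%N) => y xy.
  rewrite xn; last by apply: agree_le xy; rewrite leq_maxl.
  by rewrite -abszE lez_nat leq_maxr.
by move=> C CP; exists C => x; apply: (CP x).
Qed.

Variables (f : X -> int) (n : nat).
Hypothesis n_gt0 : (0 < n)%N.
Hypothesis f_agree : forall x y, agree n x y -> f x = f y.

Lemma agree_birkhoff k x y : agree (k + n) x y -> birkhoff f k x = birkhoff f k y.
Proof.
move=> xy; apply: eq_bigr => i _; apply: f_agree => j jn.
rewrite !mseq_iter; apply: xy; rewrite -addnS.
exact: leq_add (ltnW (ltn_ord i)) jn.
Qed.

(** The first [d] letters of [w] can be repeated forever because the letter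
    that follows them is the first one. *)
Lemma closing_point d (w : X) : (0 < d)%N -> agree n w (iter d sigma w) ->
  exists p, iter d sigma p = p /\ agree (d + n) p w.
Proof.
move=> d0 wd; have [i|p ps] := @point_exists _ A (fun i => mseq w (i %% d)).
  have id := ltn_pmod i d0.
  case: (ltnP (i %% d).+1 d) => [id'|id'].
    by rewrite -addn1 -modnDml addn1 (modn_small id') mseqP.
  have {id id'} idE : (i %% d).+1 = d by lia.
  rewrite -addn1 -modnDml addn1 idE modnn (wd 0%N)// mseq_iter addn0 -{2}idE.
  exact: mseqP.
exists p; split.
  by apply: mseq_inj => i; rewrite mseq_iter !ps modnDl.
elim/ltn_ind => i IH idn; rewrite ps.
case: (ltnP i d) => [id|di]; first by rewrite modn_small.
have -> : i = (d + (i - d))%N by lia.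
rewrite modnDl -ps IH; [|lia|lia].
rewrite wd ?mseq_iter //; lia.
Qed.

Hypothesis f_periodic : forall p x, (0 < p)%N -> iter p sigma x = x ->
  0 <= birkhoff f p x.

(** A long orbit segment visits some cylinder of length [n] twice.  Cutting out
    the loop does not increase the sum, because the loop contributes the sum
    over a periodic orbit, and the segments that remain have bounded length. *)
Lemma birkhoff_bounded_below : (exists C : nat, forall x, `|f x| <= C%:Z) ->
  exists K : nat, forall k x, - K%:Z <= birkhoff f k x.
Proof.
move=> [C fC].
pose word (x : X) : {ffun 'I_n -> 'I_N} := [ffun i : 'I_n => mseq x i].
pose c := #|{ffun 'I_n -> 'I_N}|.
exists (c * C)%N; elim/ltn_ind => k IH x.
case: (leqP k c) => [kc|ck].
  have : `|birkhoff f k x| <= (k * C)%:Z.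
    apply: le_trans (ler_norm_sum _ _ _) _.
    apply: (@le_trans _ _ (\sum_(i < k) C%:Z)); first by apply: ler_sum => i _.
    by rewrite sumr_const card_ord -mulr_natl natz PoszM.
  rewrite ler_norml => /andP[+ _]; apply: le_trans.
  by rewrite lerN2 lez_nat leq_mul2r kc orbT.
have [i [j [ij jc wij]]] : exists i j, [/\ (i < j)%N, (j <= c)%N &
    word (iter i sigma x) = word (iter j sigma x)].
  apply: contrapT => noij.
  have : injective (fun i : 'I_c.+1 => word (iter i sigma x)).
    move=> i j ij; apply/val_inj/eqP; apply/negPn/negP => /=.
    rewrite neq_ltn => /orP[] lt; apply: noij.
      by exists i, j; split=> //; rewrite -ltnS.
    by exists j, i; split=> //; rewrite -ltnS.
  by move=> /leq_card; rewrite card_ord ltnn.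
have ag : agree n (iter i sigma x) (iter j sigma x).
  by move=> t tn; have /ffunP/(_ (Ordinal tn)) := wij; rewrite !ffunE.
have [|z [zx zj]] := @splice_eq _ A i x (iter j sigma x).
  by have := ag 0%N n_gt0; rewrite mseq_iter addn0.
have [||p [pp pw]] := closing_point (d := (j - i)%N) (w := iter i sigma x).
- lia.
- by rewrite -iterD subnK// ltnW.
have S1 := f_periodic _ pp; rewrite (agree_birkhoff pw) in S1.
have S2 : birkhoff f i z = birkhoff f i x.
  apply: agree_birkhoff; apply/agreeD; split=> //.
  by rewrite zj; apply: agree_sym.
have S3 := IH (i + (k - j))%N ltac:(lia) z.
rewrite birkhoffD S2 zj in S3.
have -> : k = (i + ((j - i) + (k - j)))%N by lia.
rewrite !birkhoffD -iterD subnK ?(ltnW ij)//.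
apply: le_trans S3 _; rewrite lerD2l lerDr; apply: S1; lia.
Qed.

Lemma int_min (P : int -> Prop) (K : int) : (exists v, P v) ->
  (forall v, P v -> K <= v) -> exists2 m, P m & forall v, P v -> m <= v.
Proof.
move=> [v0 Pv0] KP; pose Q k := `[< P (K + k%:Z) >].
have exQ : exists k, Q k.
  exists `|v0 - K|%N; apply/asboolP; rewrite gez0_abs ?subr_ge0 ?KP//.
  by rewrite subrKC.
case: (ex_minnP exQ) => m /asboolP Pm mmin; exists (K + m%:Z) => // v Pv.
have Kv := KP _ Pv.
suff : (m <= `|v - K|)%N by lia.
by apply: mmin; apply/asboolP; rewrite gez0_abs ?subr_ge0// subrKC.
Qed.

(** The value [xi x] is the length of a shortest path, namely the least
    Birkhoff sum of [f] over finite orbit segments that start in the cylinder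
    of [x]; prefixing one letter to a path gives the inequality. *)
Lemma potential_exists : (exists C : nat, forall x, `|f x| <= C%:Z) ->
  exists xi : contZ X, forall x, 0 <= f x - xi x + xi (sigma x).
Proof.
move=> /birkhoff_bounded_below[K fK].
pose P x v := exists k y, agree n x y /\ birkhoff f k y = v.
have Pmin x : exists2 m, P x m & forall v, P x v -> m <= v.
  apply: (@int_min _ (- K%:Z)); last by move=> v [k [y [_ <-]]].
  by exists (birkhoff f 0 x), 0%N, x.
have [xi xiP] : exists xi : X -> int, forall x, P x (xi x) /\ forall v, P x v -> xi x <= v.
  exists (fun x => s2val (cid2 (Pmin x))) => x.
  by case: (cid2 (Pmin x)).
have xi_le x y : agree n x y -> xi x <= xi y.
  move=> xy; apply: (xiP x).2; have [k [z [yz zE]]] := (xiP y).1.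
  by exists k, z; split=> //; exact: agree_trans yz.
have xiZ : xi \in @contZ_pred X.
  apply: contZ_agree => x; exists n => y xy; apply/eqP.
  by rewrite eq_le !xi_le//; exact: agree_sym.
exists (ContZ xiZ) => x /=.
suff : xi x <= f x + xi (sigma x) by lia.
have [k [y [xy <-]]] := (xiP (sigma x)).1.
have [|z [z0 zy]] := @splice_eq _ A 1 x y; first by rewrite -xy.
have xz : agree n x z.
  apply: agree_le (_ : (n <= 1 + n)%N) _; first by lia.
  by apply/agreeD; split; [exact: agree_sym|rewrite zy].
apply: (xiP x).2; exists (1 + k)%N, z; split=> //.
by rewrite birkhoffD zy /birkhoff big_ord1 /= (f_agree xz).
Qed.

End Potential.

(** * Nonnegativity of periodic sums under the transfer *)

Section Order.
Variables (N M : nat) (A : 'M[nat]_N) (B : 'M[nat]_M).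
Hypotheses (B01 : zero_one_mx B) (B_irr : irreducible_mx B)
  (B_nperm : ~~ is_perm_mx B).
Variable h : homeomorphism (shift_space A) (shift_space B).
Variables k2 l2 : shift_space B -> nat.
Hypothesis kl : orbit_cocycles (homeo_inv h) k2 l2.
Notation sA := (@shift_map N A).
Notation sB := (@shift_map M B).
Notation g := (homeo_inv h).

Lemma continuous_agree (T S : nat) (C : 'M[nat]_T) (D : 'M[nat]_S)
    (u : shift_space C -> shift_space D) : continuous u ->
  forall x n, exists m, forall y, agree m x y -> agree n (u x) (u y).
Proof.
by move=> cu x n; have /nbhs_agree := cu x _ (agree_nbhs (u x) n).
Qed.

(** The inverse branch of the [p]-th power of the shift at the periodic point
    [y] maps a neighbourhood of [y] into itself.  If [a < b], its conjugate by
    [g] lowers the first index at which a point differs from [g y], which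
    cannot go on forever. *)
Lemma no_contraction p y a b n : (0 < p)%N -> iter p sB y = y -> (a < b)%N ->
    (forall y', agree n y y' ->
       iter b sA (g (iter p sB y')) = iter a sA (g y')) -> False.
Proof.
move=> p0 py ab gE.
have [m gm] := continuous_agree (@homeo_inv_continuous _ _ h) y b.
pose q := (maxn (maxn n m) 1)%N.
have [y0 [yy0 y0y]] := no_isolated B01 B_irr B_nperm q y.
have pull y' : agree q y y' -> exists y'', agree q y y'' /\ iter p sB y'' = y'.
  move=> yy'; have [|z [zy zE]] := @splice_eq _ B p y y'.
    by rewrite -[p in mseq _ p]addn0 -mseq_iter py yy'// leq_max orbT.
  exists z; split=> //; apply: agree_le (_ : (q <= p + q)%N) _; first by lia.
  by apply/agreeD; split; [exact: agree_sym|rewrite py zE].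
(* [pull] applies the inverse branch of the shift that fixes [y]. *)
have descent i y' : agree q y y' -> mseq (g y') i <> mseq (g y) i -> False.
  elim/ltn_ind: i y' => i IH y' yy' ne.
  have bi : (b <= i)%N.
    rewrite leqNgt; apply/negP => ib; apply: ne; apply/esym/gm => //.
    by apply: agree_le yy'; rewrite !leq_max leqnn orbT.
  have [y'' [yy'' y''E]] := pull _ yy'.
  apply: (IH (a + (i - b))%N _ y'' yy''); first lia.
  have qn : (n <= q)%N by rewrite !leq_max leqnn.
  move=> E; apply: ne.
  rewrite -(subnKC bi) -!mseq_iter -y''E (gE y'' (agree_le qn yy'')).
  have := gE y (@agree_refl _ _ _ _); rewrite py => ->.
  by rewrite !mseq_iter.
apply: y0y; rewrite -[y0](homeo_invK h) -[y](homeo_invK h); congr (h _).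
apply: mseq_inj => i; apply: contrapT; exact: descent yy0.
Qed.

(** Since [no_contraction] forces [b <= a], the difference of the Birkhoff
    sums of [f] of lengths [a] and [b] is again a Birkhoff sum of [f]. *)
Lemma Psi_periodic_ge0 (f : shift_space A -> int) : (forall x, 0 <= f x) ->
  forall p y, (0 < p)%N -> iter p sB y = y ->
  0 <= birkhoff (Psi_fun h k2 l2 f) p y.
Proof.
move=> f0 p y p0 py; have [a [b [n abn]]] := Psi_birkhoff kl f p y.
have [_ ->] := abn y (@agree_refl _ _ _ _); rewrite py.
have [ba|ab] := leqP b a; last first.
  by exfalso; apply: (no_contraction p0 py ab) => y' /abn[].
by rewrite -(subnKC ba) birkhoffD addrC addKr; apply: sumr_ge0.
Qed.

Lemma Psi_nonneg_class (f : contZ (shift_space A)) : (forall x, 0 <= f x) ->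
  Hpos B (Hclass (Psi kl f)).
Proof.
move=> f0; have [n fn] := contZ_uniform (Psi kl f).
have [||||xi xiP] := @potential_exists _ B (Psi kl f) n.+1.
- by [].
- by move=> x y xy; apply: fn; apply: agree_le xy.
- by move=> p x; exact: Psi_periodic_ge0.
- exact: contZ_bounded.
have xisZ : (xi \o sB) \in @contZ_pred (shift_space B).
  apply: contZ_agree => x; have [m xim] := contZP xi (sB x).
  exists m.+1 => y xy; apply: xim => i im.
  by have := xy i.+1 im.
exists (Psi kl f - xi + ContZ xisZ).
  by move=> x /=; have := xiP x; rewrite /= !fctE.
apply/eqP; rewrite -Quotient.idealrBE; apply/asboolP.
exists (- xi) => x.
by rewrite /= !fctE; lia.
Qed.

End Order.

(** * The isomorphism of ordered cohomology groups *)

Section OrderedIso.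
Variables (N M : nat) (A : 'M[nat]_N) (B : 'M[nat]_M).
Hypotheses (A01 : zero_one_mx A) (A_irr : irreducible_mx A)
  (A_nperm : ~~ is_perm_mx A).
Hypotheses (B01 : zero_one_mx B) (B_irr : irreducible_mx B)
  (B_nperm : ~~ is_perm_mx B).

Lemma Hclass_eq (T : nat) (C : 'M[nat]_T) (f f' : contZ (shift_space C)) :
  Hclass f = Hclass f' <-> f - f' \in @coboundary T C.
Proof. by rewrite Quotient.idealrBE; split=> /eqP. Qed.

Lemma Psi_Hclass (T S : nat) (A' : 'M[nat]_T) (B' : 'M[nat]_S)
    (h : homeomorphism (shift_space A') (shift_space B')) k2 l2
    (kl : orbit_cocycles (homeo_inv h) k2 l2) (f f' : contZ (shift_space A')) :
  Hclass f = Hclass f' -> Hclass (Psi kl f) = Hclass (Psi kl f').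
Proof.
move=> /Hclass_eq /asboolP[xi xiE]; apply/Hclass_eq; rewrite -Psi_additive.
have xigZ : (xi \o homeo_inv h) \in @contZ_pred (shift_space B').
  apply: contZ_agree => y; have [m xim] := contZP xi (homeo_inv h y).
  have [n gn] := continuous_agree (@homeo_inv_continuous _ _ h) y m.
  by exists n => y' /gn /xim.
by apply/asboolP; exists (ContZ xigZ) => y; exact: Psi_coboundary.
Qed.

Lemma Psi_induces_ordered_iso (h : homeomorphism (shift_space A) (shift_space B))
    k1 l1 k2 l2
    (kl1 : orbit_cocycles (homeo_inv (homeomorphism_sym h)) k1 l1)
    (kl2 : orbit_cocycles (homeo_inv h) k2 l2) :
  induces_ordered_iso (Psi kl2).
Proof.
pose theta (c : Hgroup A) : Hgroup B := Hclass (Psi kl2 (repr c)).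
pose theta' (c : Hgroup B) : Hgroup A := Hclass (Psi kl1 (repr c)).
have HclassK T (C : 'M[nat]_T) (c : Hgroup C) : Hclass (repr c) = c.
  exact: reprK.
have thetaE f : theta (Hclass f) = Hclass (Psi kl2 f).
  by rewrite /theta; apply: (Psi_Hclass kl2); rewrite HclassK.
have thetaE' f : theta' (Hclass f) = Hclass (Psi kl1 f).
  by rewrite /theta'; apply: (Psi_Hclass kl1); rewrite HclassK.
have PsiK21 := PsiK A01 A_irr A_nperm kl1 kl2.
have PsiK12 : cancel (Psi kl1) (Psi kl2).
  move=> f; apply: val_inj.
  exact: (congr1 val (PsiK B01 B_irr B_nperm (h := homeomorphism_sym h) kl2 kl1 f)).
have thetaK : cancel theta theta'.
  by move=> c; rewrite -[c]HclassK thetaE thetaE' PsiK21.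
have thetaK' : cancel theta' theta.
  by move=> c; rewrite -[c]HclassK thetaE' thetaE PsiK12.
have thetaB : zmod_morphism theta.
  move=> c d; rewrite -[c]HclassK -[d]HclassK.
  have HclassB T (C : 'M[nat]_T) (f f' : contZ (shift_space C)) :
    Hclass (f - f') = Hclass f - Hclass f' by exact: raddfB.
  by rewrite -HclassB !thetaE Psi_additive HclassB.
pose theta_add := GRing.isZmodMorphism.Build _ _ theta thetaB.
pose Theta : {additive Hgroup A -> Hgroup B} := HB.pack theta theta_add.
exists Theta; split=> //; first by exists theta'.
apply/seteqP; split=> [_ [_ [f f0 <-] <-]|_ [f f0 <-]].
  by change (Hpos B (theta (Hclass f))); rewrite thetaE; apply: Psi_nonneg_class.
exists (Hclass (Psi kl1 f)).
  exact: (@Psi_nonneg_class _ _ _ _ A01 A_irr A_nperm (homeomorphism_sym h)).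
by change (theta (Hclass (Psi kl1 f)) = Hclass f); rewrite thetaE PsiK12.
Qed.

End OrderedIso.

Local Open Scope complex_scope.
Local Notation normc := ComplexField.Normc.normc.

(** * The norm of a C*-algebra and the extreme point 1 *)

Section CStarBasics.
Variables (R : realType) (E : cstarType R).
Implicit Types x y z : E.

Lemma normc_real (r : R) : normc r%:C = `|r|.
Proof. by rewrite /ComplexField.Normc.normc /= expr0n addr0 sqrtr_sqr. Qed.

Lemma cnormZr (r : R) x : cnorm (r%:C *: x) = `|r| * cnorm x.
Proof. by rewrite cnormZ normc_real. Qed.

Lemma cnorm0 : cnorm (0 : E) = 0.
Proof. by rewrite -(scale0r (0 : E)) -[0 : R[i]]/(0%:C) cnormZr normr0 mul0r. Qed.

Lemma cnormN x : cnorm (- x) = cnorm x.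
Proof.
by rewrite -scaleN1r -[1 : R[i]]/(1%:C) -rmorphN cnormZr normrN1 mul1r.
Qed.

Lemma cnorm_ge0 x : 0 <= cnorm x.
Proof.
have := cnormD x (- x); rewrite subrr cnorm0 cnormN -mulr2n.
by rewrite pmulrn_lge0.
Qed.

Lemma cnorm_eq0 x : (cnorm x == 0) = (x == 0).
Proof. by apply/eqP/eqP => [/cnorm0_eq0//|->]; exact: cnorm0. Qed.

Lemma cnormB x y : cnorm (x - y) <= cnorm x + cnorm y.
Proof. by rewrite -(cnormN y) cnormD. Qed.

Lemma cnorm_distC x y : cnorm (x - y) = cnorm (y - x).
Proof. by rewrite -cnormN opprB. Qed.

Lemma cnorm_sum (I : Type) (r : seq I) (P : pred I) (F : I -> E) :
  cnorm (\sum_(i <- r | P i) F i) <= \sum_(i <- r | P i) cnorm (F i).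
Proof.
elim/big_rec2: _ => [|i u v _ IH]; first by rewrite cnorm0.
by apply: le_trans (cnormD _ _) _; rewrite lerD2l.
Qed.

Lemma cnorm_le0 x : (forall e, 0 < e -> cnorm x <= e) -> x = 0.
Proof.
move=> xe; apply: cnorm0_eq0; apply/eqP; rewrite eq_le cnorm_ge0 andbT.
by apply/ler_addgt0Pl => e /xe; rewrite addr0.
Qed.

Lemma star0 : star (0 : E) = 0.
Proof. by rewrite -(scale0r (0 : E)) starZ conjc0 !scale0r. Qed.

Lemma starN x : star (- x) = - star x.
Proof.
by apply/eqP; rewrite -subr_eq0 opprK -starD addNr star0.
Qed.

Lemma starB x y : star (x - y) = star x - star y.
Proof. by rewrite starD starN. Qed.

Lemma star1 : star (1 : E) = 1.
Proof. by rewrite -[LHS]mul1r -{1}(starK 1) -starM mul1r starK. Qed.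

Lemma cnorm_star x : cnorm (star x) = cnorm x.
Proof.
have le y : cnorm y <= cnorm (star y).
  have [->|y0] := eqVneq y 0; first by rewrite star0.
  have y0' : 0 < cnorm y by rewrite lt_neqAle eq_sym cnorm_eq0 y0 cnorm_ge0.
  by rewrite -(ler_pM2r y0') -expr2 -cnorm_starM cnormM.
by apply/eqP; rewrite eq_le le -{2}(starK x) le.
Qed.

Lemma star_mul_eq0 x : star x * x = 0 -> x = 0.
Proof.
move=> xx; apply: cnorm0_eq0; apply/eqP.
by rewrite -[_ == 0](expf_eq0 _ 2) -cnorm_starM xx cnorm0.
Qed.

Lemma cnorm1 : cnorm (1 : E) = 1.
Proof.
have := cnorm_starM (1 : E); rewrite star1 mulr1 => /eqP.
rewrite expr2 -subr_eq0 -{1}[cnorm 1]mulr1 -mulrBr mulf_eq0 cnorm_eq0 oner_eq0 /=.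
by rewrite subr_eq0 eq_sym => /eqP.
Qed.

Lemma cnorm_unitary x : star x * x = 1 -> cnorm x = 1.
Proof.
move=> xx; have /eqP := cnorm_starM x; rewrite xx cnorm1 eq_sym sqrf_eq1.
case/orP => /eqP // xN; have := cnorm_ge0 x; rewrite xN; lra.
Qed.

Definition projection x := star x = x /\ x * x = x.

Lemma projection_cnorm_le1 x : projection x -> cnorm x <= 1.
Proof.
move=> [xs xx]; have := cnorm_starM x; rewrite xs xx => xE.
have := cnorm_ge0 x; rewrite le_eqVlt => /predU1P[<-//|x0].
by rewrite -(ler_pM2r x0) -expr2 -xE mul1r.
Qed.

Lemma projection_compl x : projection x -> projection (1 - x).
Proof.
move=> [xs xx]; split; first by rewrite starB star1 xs.
by rewrite mulrBr mulr1 mulrBl mul1r xx subrr subr0.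
Qed.

Lemma mul_le1 x y : cnorm x <= 1 -> cnorm y <= 1 -> cnorm (x * y) <= 1.
Proof.
by move=> x1 y1; apply: le_trans (cnormM _ _) _; rewrite mulr_ile1 ?cnorm_ge0.
Qed.

Lemma cnormMn x n : cnorm (x *+ n) = n%:R * cnorm x.
Proof.
by rewrite -scaler_nat -(rmorph_nat (real_complex R)) cnormZr ger0_norm.
Qed.

(** The identity is an extreme point of the unit ball of a Banach algebra; here
    it is [q] that plays the role of the identity.  The elements
    [w m t = t q + m c] satisfy
    [2 (w (m + 1) t) = (q + c) (w m (t + 1)) + (q - c) (w m (t - 1))], so that
    their norm grows no faster than the mean distance of a random walk: the
    norm of [m c] is at most of the order of the square root of [m]. *)
Lemma extreme_point (q c : E) : q * q = q -> q * c = c -> c * q = c ->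
    cnorm q <= 1 -> cnorm (q + c) <= 1 -> cnorm (q - c) <= 1 ->
  c = 0.
Proof.
move=> qq qc cq q1 pc1 mc1.
(* A random walk started at [t] has mean square [m + t ^+ 2] after [m] steps,
   and its mean distance is bounded by the mean of [(Z ^+ 2 / s + s) / 2]. *)
have bound (s : R) m (t : R) : 0 < s ->
    cnorm (t%:C *: q + c *+ m) <= ((m%:R + t ^+ 2) / s + s) / 2.
  move=> s0; elim: m t => [|m IH] t.
    rewrite mulr0n addr0 cnormZr add0r.
    apply: (@le_trans _ _ `|t|).
      by rewrite -[leRHS]mulr1 ler_wpM2l.
    rewrite ler_pdivlMr// -subr_ge0 -(pmulr_rge0 _ s0).
    have -> : s * (t ^+ 2 / s + s - `|t| * 2) = (`|t| - s) ^+ 2.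
      rewrite -[t ^+ 2]real_normK ?num_real//; field; exact: lt0r_neq0.
    exact: sqr_ge0.
  pose w r := r%:C *: q + c *+ m.
  pose a := t%:C *: q + c *+ m; pose b := t%:C *: c + (c * c) *+ m.
  have qa : q * a = a by rewrite mulrDr -scalerAr qq mulrnAr qc.
  have ca : c * a = b by rewrite mulrDr -scalerAr cq mulrnAr.
  have wp : w (t + 1) = a + q.
    by rewrite /w rmorphD scalerDl scale1r addrAC.
  have wm : w (t - 1) = a - q.
    by rewrite /w rmorphB scalerBl scale1r addrAC.
  have -> : t%:C *: q + c *+ m.+1 = a + c by rewrite mulrSr addrA.
  have w1 : cnorm (a + q) <= ((m%:R + (t + 1) ^+ 2) / s + s) / 2.
    by rewrite -wp; exact: IH.
  have w2 : cnorm (a - q) <= ((m%:R + (t - 1) ^+ 2) / s + s) / 2.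
    by rewrite -wm; exact: IH.
  clearbody a b; clear w wp wm IH.
  have -> : a + c = (2^-1)%:C *: ((q + c) * (a + q) + (q - c) * (a - q)).
    rewrite mulrBl mulrDl !mulrBr !mulrDr qa ca qq cq opprB.
    rewrite addrACA [a + q + _]addrACA subrr addr0.
    rewrite [b + c + _]addrACA addrC [c + - b]addrC.
    rewrite [b + c + _]addrACA subrr add0r -!mulr2n -mulrnDl addrC.
    rewrite mulr2n scalerDr -scalerDl -rmorphD.
    by rewrite (_ : 2^-1 + 2^-1 = 1) ?scale1r//; lra.
  rewrite cnormZr ger0_norm ?invr_ge0// mulrC ler_pM2r ?invr_gt0//.
  apply: le_trans (cnormD _ _) _.
  have le x y : cnorm x <= 1 -> cnorm (x * y) <= cnorm y.
    by move=> x1; apply: le_trans (cnormM _ _) _; rewrite ler_piMl ?cnorm_ge0.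
  apply: le_trans (lerD (le _ _ pc1) (le _ _ mc1)) _.
  apply: le_trans (lerD w1 w2) _; rewrite le_eqVlt; apply/orP; left; apply/eqP.
  by rewrite -natr1; field; exact: lt0r_neq0.
apply: cnorm_le0 => e e0.
have [n ne] : exists n : nat, e^-1 < n.+1%:R.
  exists (Num.bound e^-1); rewrite -natr1 ltr_wpDr//.
  by apply: archi_boundP; rewrite ltW// invr_gt0.
have n0 : 0 < n.+1%:R :> R by [].
(* With [m = s ^+ 2] the bound on the norm of [m c] is [s]. *)
have := bound n.+1%:R (n.+1 * n.+1)%N 0 n0.
rewrite scale0r add0r cnormMn natrM expr0n addr0 -mulrA mulfK ?lt0r_neq0//.
have -> : (n.+1%:R + n.+1%:R) / 2 = n.+1%:R * 1 :> R by lra.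
rewrite ler_pM2l// => H.
apply: le_trans (_ : n.+1%:R^-1 <= e); last by rewrite -[leRHS]invrK lef_pV2 ?posrE ?invr_gt0// ltW.
by rewrite -[leRHS]mul1r ler_pdivlMr// mulrC.
Qed.

End CStarBasics.

(** * Projections that sum to 1 *)

Section Orthogonality.
Variables (R : realType) (E : cstarType R).

(** Compressing the sum by [p i] shows that the elements [p i * p j * p i] with
    [j != i] sum to [0].  All [p i - p i * p j * p i] lie in the unit ball, so
    a small multiple of [p i * p k * p i] can be both added to [p i] and
    subtracted from it within the unit ball, and [extreme_point] applies. *)
Lemma partition_orthogonal (I : finType) (p : I -> E) :
    (forall i, projection (p i)) -> \sum_i p i = 1 ->
  forall i k, i != k -> p i * p k = 0.
Proof.
move=> pP p1 i k ik.
pose x j := p i * p j * p i.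
have pp j : p j * p j = p j := (pP j).2.
have ps j : star (p j) = p j := (pP j).1.
have xsum : \sum_(j | j != i) x j = 0.
  have : \sum_j x j = p i by rewrite -mulr_suml -mulr_sumr p1 mulr1 pp.
  rewrite (bigD1 i)//= /x !pp => /eqP; rewrite -subr_eq0 addrAC subrr add0r.
  by move/eqP.
have qx j : cnorm (p i - x j) <= 1.
  have -> : p i - x j = p i * (1 - p j) * p i.
    by rewrite mulrBr mulr1 mulrBl pp.
  by rewrite !mul_le1//; apply: projection_cnorm_le1 => //; exact: projection_compl.
have q1 : cnorm (p i) <= 1 by exact: projection_cnorm_le1.
(* [K] is the number of indices other than [i]; dividing by it keeps
   [p i + x k / K] in the unit ball, as a mean of [K] elements of it. *)
pose K : R := \sum_(j | j != i) 1.
have KD : K = 1 + \sum_(j | (j != i) && (j != k)) 1.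
  by rewrite /K (bigD1 k) ?(eq_sym k).
have K1 : 1 <= K by rewrite KD lerDl sumr_ge0.
have K0 : 0 < K by apply: lt_le_trans K1.
have KE : \sum_(j | j != i) p i = K%:C *: p i.
  rewrite /K rmorph_sum scaler_suml; apply: eq_bigr => j _.
  by rewrite rmorph1 scale1r.
have xk0 : (K^-1)%:C *: x k = 0.
  apply: (extreme_point (q := p i)) => //.
  - by rewrite -scalerAr /x !mulrA pp.
  - by rewrite -scalerAl /x -!mulrA pp.
  - have -> : p i + K^-1%:C *: x k =
        K^-1%:C *: (p i + \sum_(j | (j != i) && (j != k)) (p i - x j)).
      have -> : p i + \sum_(j | (j != i) && (j != k)) (p i - x j) =
          K%:C *: p i + x k.
        have : \sum_(j | j != i) (p i - x j) = K%:C *: p i.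
          by rewrite sumrB xsum subr0 KE.
        rewrite (bigD1 k) ?(eq_sym k)//= => <-.
        by rewrite addrAC addrNK.
      by rewrite scalerDr scalerA -rmorphM mulVf ?lt0r_neq0// scale1r.
    rewrite cnormZr ger0_norm ?invr_ge0 ?(ltW K0)// ler_pdivrMl// mulr1.
    apply: le_trans (cnormD _ _) _; rewrite KD.
    apply: lerD => //; apply: le_trans (cnorm_sum _ _ _) _.
    by apply: ler_sum => j _.
  - have -> : p i - K^-1%:C *: x k = (1 - K^-1)%:C *: p i + K^-1%:C *: (p i - x k).
      by rewrite rmorphB scalerBl scale1r scalerBr addrA addrNK.
    apply: le_trans (cnormD _ _) _; rewrite !cnormZr.
    rewrite !ger0_norm ?invr_ge0 ?subr_ge0 ?invf_le1 ?(ltW K0)//.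
    have h1 : (1 - K^-1) * cnorm (p i) <= 1 - K^-1.
      by rewrite ler_piMr// subr_ge0 invf_le1.
    have h2 : K^-1 * cnorm (p i - x k) <= K^-1.
      by rewrite ler_piMr// invr_ge0 ltW.
    lra.
have {}xk0 : x k = 0.
  by rewrite -[x k](scale1r) -[1 : R[i]]/(1%:C) -(divff (lt0r_neq0 K0)) rmorphM
    -scalerA xk0 scaler0.
have : p k * p i = 0.
  by apply: star_mul_eq0; rewrite starM !ps mulrA -[p i * p k * p k]mulrA pp.
by move=> /(congr1 star); rewrite starM !ps star0.
Qed.

End Orthogonality.

(** * Norm limits and contractivity of star homomorphisms *)

Section Limits.
Variable R : realType.

Definition ccvg (E : cstarType R) (u : nat -> E) x :=
  forall e : R, 0 < e -> exists n0 : nat, forall n, (n0 <= n)%N -> cnorm (u n - x) <= e.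

Lemma ccvgP (E : cstarType R) (u : nat -> E) x :
  ((fun n => cnorm (u n - x)) @ \oo --> (0 : R)) <-> ccvg u x.
Proof.
split=> [/cvgrPdist_le ux e e0|ux].
  have [n0 _ n0P] := ux e e0; exists n0 => n /n0P /=.
  by rewrite sub0r normrN ger0_norm ?cnorm_ge0.
apply/cvgrPdist_le => e /ux [n0 n0P]; exists n0 => // n /= /n0P.
by rewrite sub0r normrN ger0_norm ?cnorm_ge0.
Qed.

Variables E F : cstarType R.
Implicit Types u v : nat -> E.

Lemma ccvg_unique u x y : ccvg u x -> ccvg u y -> x = y.
Proof.
move=> ux uy; apply/eqP; rewrite -subr_eq0; apply/eqP/cnorm_le0 => e e0.
have e2 : 0 < e / 2 by rewrite divr_gt0.
have [m mP] := ux _ e2; have [n nP] := uy _ e2.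
have -> : x - y = (u (maxn m n) - y) - (u (maxn m n) - x).
  by rewrite opprB [RHS]addrC addrA addrNK.
apply: le_trans (cnormB _ _) _; rewrite [leRHS]splitr.
by apply: lerD; [apply: nP|apply: mP]; rewrite ?leq_maxl ?leq_maxr.
Qed.

Lemma ccvg_lipschitz (f : E -> F) (C : R) u x :
    (forall y, cnorm (f y - f x) <= C * cnorm (y - x)) ->
  ccvg u x -> ccvg (f \o u) (f x).
Proof.
move=> fC ux e e0; have C0 : 0 < `|C| + 1 by rewrite ltr_wpDl.
have [n0 n0P] := ux (e / (`|C| + 1)) (divr_gt0 e0 C0).
exists n0 => n /n0P; rewrite ler_pdivlMr// => h; apply: le_trans (fC _) _.
apply: le_trans h; rewrite mulrC ler_wpM2l ?cnorm_ge0//.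
by apply: le_trans (ler_norm _) _; rewrite lerDl.
Qed.

Lemma ccvgD u v x y : ccvg u x -> ccvg v y -> ccvg (fun n => u n + v n) (x + y).
Proof.
move=> ux vy e e0; have e2 : 0 < e / 2 by rewrite divr_gt0.
have [m mP] := ux _ e2; have [n nP] := vy _ e2.
exists (maxn m n) => k; rewrite geq_max => /andP[/mP h1 /nP h2].
rewrite opprD addrACA; apply: le_trans (cnormD _ _) _.
by rewrite [leRHS]splitr lerD.
Qed.

Lemma ccvgM u v x y : ccvg u x -> ccvg v y -> ccvg (fun n => u n * v n) (x * y).
Proof.
move=> ux vy e e0.
have x0 := cnorm_ge0 x; have y0 := cnorm_ge0 y.
pose C := cnorm x + cnorm y + 1; have C0 : 0 < C by rewrite /C; lra.
pose d := Num.min 1 (e / C).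
have d0 : 0 < d by rewrite lt_min ltr01 divr_gt0.
have [m mP] := ux _ d0; have [n nP] := vy _ d0.
exists (maxn m n) => k; rewrite geq_max => /andP[/mP h1 /nP h2].
have -> : u k * v k - x * y = (u k - x) * v k + x * (v k - y).
  by rewrite mulrBl mulrBr addrA addrNK.
apply: le_trans (cnormD _ _) _.
have h3 : cnorm (v k) <= cnorm y + 1.
  rewrite -[v k](subrK y) [leRHS]addrC; apply: le_trans (cnormD _ _) _.
  by rewrite lerD2r (le_trans h2)// ge_min lexx.
have dC : d * C <= e by rewrite -ler_pdivlMr// ge_min lexx orbT.
apply: le_trans dC; have -> : d * C = d * (cnorm y + 1) + cnorm x * d.
  by rewrite /C; ring.
apply: lerD; apply: le_trans (cnormM _ _) _.
  by apply: ler_pM; rewrite ?cnorm_ge0.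
by rewrite ler_wpM2l.
Qed.

End Limits.

Section Contractive.
Variables (R : realType) (E F : cstarType R).

Lemma geometric_cvg (u : nat -> E) (s : R) : 0 <= s -> s < 1 ->
    (forall n, cnorm (u n.+1 - u n) <= s ^+ n) ->
  exists x, ccvg u x.
Proof.
move=> s0 s1 us; have s1' : 0 < 1 - s by rewrite subr_gt0.
have tail n k : (1 - s) * cnorm (u (n + k)%N - u n) <= s ^+ n - s ^+ (n + k).
  elim: k => [|k IH]; first by rewrite addn0 !subrr cnorm0 mulr0.
  have -> : u (n + k.+1)%N - u n =
      (u (n + k).+1 - u (n + k)%N) + (u (n + k)%N - u n).
    by rewrite addrA addrNK addnS.
  apply: le_trans (ler_wpM2l (ltW s1') (cnormD _ _)) _; rewrite mulrDr.
  apply: le_trans (lerD (ler_wpM2l (ltW s1') (us _)) IH) _.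
  by rewrite addnS exprS le_eqVlt; apply/orP; left; apply/eqP; ring.
have small (e : R) : 0 < e -> exists n0, forall n, (n0 <= n)%N -> s ^+ n < e.
  move=> e0; have /cvgrPdist_lt/(_ e e0) [n0 _ n0P] := cvg_expr (z := s) ltac:(by rewrite ger0_norm).
  exists n0 => n /n0P /=; by rewrite sub0r normrN ger0_norm// exprn_ge0.
have [|x /ccvgP xP] := @cnorm_complete _ _ u; last by exists x.
move=> e e0; have [n0 n0P] := small ((1 - s) * e) (mulr_gt0 s1' e0).
have le m n : (n0 <= n)%N -> (n <= m)%N -> cnorm (u m - u n) < e.
  move=> nn0 nm; rewrite -(ltr_pM2l s1'); apply: le_lt_trans (n0P n nn0).
  have := tail n (m - n)%N; rewrite subnKC// => h; apply: le_trans h _.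
  by rewrite gerBl exprn_ge0.
exists n0 => m n m0 nn0; case: (leqP n m) => [|/ltnW] mn; first exact: le.
by rewrite cnorm_distC; exact: le.
Qed.

(** The element [1 - b] is the fixed point of [c |-> (a * a + c * c) / 2], a
    contraction of the ball of radius [cnorm a ^+ 2]. *)
Lemma sqrt_one_minus_sqr (a : E) : star a = a -> cnorm a < 1 ->
  exists b, [/\ star b = b, a * b = b * a & a * a + b * b = 1].
Proof.
move=> sa a1.
pose s := cnorm a ^+ 2.
have saa : cnorm (a * a) = s by rewrite /s -cnorm_starM sa.
have s0 : 0 <= s by rewrite exprn_ge0// cnorm_ge0.
have s1 : s < 1 by rewrite /s expr_lt1// cnorm_ge0.
pose half (x : E) : E := (2^-1)%:C *: x.
have cnorm_half x : cnorm (half x) = cnorm x / 2.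
  by rewrite cnormZr ger0_norm ?invr_ge0// mulrC.
pose c := fix c n : E := if n is n'.+1 then half (a * a + c n' * c n') else 0.
have cS n : c n.+1 = half (a * a + c n * c n) by [].
have cle n : cnorm (c n) <= s.
  elim: n => [|n IH]; first by rewrite cnorm0.
  rewrite cS cnorm_half ler_pdivrMr//; apply: le_trans (cnormD _ _) _.
  have : cnorm (c n * c n) <= s.
    apply: le_trans (cnormM _ _) _; rewrite -[leRHS]mulr1.
    by apply: ler_pM; rewrite ?cnorm_ge0// (le_trans IH)// ltW.
  by rewrite saa; lra.
have [n|x cx] := @geometric_cvg c s s0 s1.
  elim: n => [|n IH].
    by rewrite cS mulr0 addr0 subr0 cnorm_half saa expr0; lra.
  have -> : c n.+2 - c n.+1 =
      half (c n.+1 * (c n.+1 - c n) + (c n.+1 - c n) * c n).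
    rewrite [c n.+2]cS {2}[c n.+1]cS /half -scalerBr; congr (_ *: _).
    rewrite opprD addrACA subrr add0r.
    by rewrite mulrBr mulrBl addrA addrNK.
  rewrite cnorm_half ler_pdivrMr// exprS; apply: le_trans (cnormD _ _) _.
  have h1 : cnorm (c n.+1 * (c n.+1 - c n)) <= s * s ^+ n.
    by apply: le_trans (cnormM _ _) _; apply: ler_pM; rewrite ?cnorm_ge0.
  have h2 : cnorm ((c n.+1 - c n) * c n) <= s * s ^+ n.
    apply: le_trans (cnormM _ _) _; rewrite [leRHS]mulrC.
    by apply: ler_pM; rewrite ?cnorm_ge0.
  lra.
have star_c n : star (c n) = c n.
  elim: n => [|n IH]; first exact: star0.
  by rewrite cS /half starZ conjc_real starD !starM IH sa.
have ac n : a * c n = c n * a.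
  elim: n => [|n IH]; first by rewrite mulr0 mul0r.
  by rewrite cS /half -scalerAr -scalerAl mulrDr mulrDl !mulrA IH -!mulrA IH.
have xs : star x = x.
  apply: (ccvg_unique (u := c)) => //.
  have := @ccvg_lipschitz _ _ _ star 1 c x _ cx.
  rewrite (_ : star \o c = c); last by apply/funext => n /=.
  by apply=> y; rewrite -starB cnorm_star mul1r.
have ax : a * x = x * a.
  apply: (ccvg_unique (u := fun n => a * c n)).
    apply: (@ccvg_lipschitz _ _ _ ( *%R a) (cnorm a) c x _ cx).
    by move=> y; rewrite -mulrBr cnormM.
  rewrite (_ : (fun n => a * c n) = (fun n => c n * a)); last by apply/funext.
  apply: (@ccvg_lipschitz _ _ _ (fun y => y * a) (cnorm a) c x _ cx).
  by move=> y; rewrite -mulrBl mulrC; apply: cnormM.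
have xE : x = half (a * a + x * x).
  apply: (ccvg_unique (u := fun n => c n.+1)).
    by move=> e /cx[n0 n0P]; exists n0 => n n0n; apply: n0P; apply: leqW.
  apply: (@ccvg_lipschitz _ _ _ half 1 (fun n => a * a + c n * c n)).
    by move=> y; rewrite -scalerBr cnorm_half; have := cnorm_ge0 (y - (a * a + x * x)); lra.
  apply: ccvgD; last exact: ccvgM.
  by move=> e e0; exists 0%N => n _; rewrite subrr cnorm0 ltW.
exists (1 - x); split; first by rewrite starB star1 xs.
  by rewrite mulrBr mulrBl mulr1 mul1r ax.
have xx : x + x = a * a + x * x.
  rewrite {1 2}xE -scalerDl -rmorphD (_ : 2^-1 + 2^-1 = 1) ?scale1r//; lra.
rewrite mulrBr mulr1 mulrBl mul1r opprB.
by rewrite addrCA [a * a + _]addrA -xx addrK addrNK.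
Qed.

Lemma star_hom0 (phi : E -> F) : star_hom phi -> phi 0 = 0.
Proof. by case=> _ phiZ _ _ _; rewrite -(scale0r (0 : E)) phiZ !scale0r. Qed.

Lemma star_homB (phi : E -> F) x y : star_hom phi -> phi (x - y) = phi x - phi y.
Proof. by case=> phiD phiZ _ _ _; rewrite -scaleN1r phiD phiZ scaleN1r. Qed.

(** A self-adjoint [a] of norm less than 1 is the real part of the unitary
    [a + i b] with [b] the square root of [1 - a ^+ 2], and star homomorphisms
    preserve unitaries. *)
Lemma star_hom_contractive (phi : E -> F) : star_hom phi ->
  forall x, cnorm (phi x) <= cnorm x.
Proof.
move=> sphi.
have sa_le1 (a : E) : star a = a -> cnorm a < 1 -> cnorm (phi a) <= 1.
  move=> sa a1; have [b [sb ab aabb]] := sqrt_one_minus_sqr sa a1.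
  pose w : E := a + 'i%C *: b.
  have conj_i : conjc 'i%C = - 'i%C :> R[i].
    by apply/eqP; rewrite eq_complex /= oppr0 !eqxx.
  have ii : 'i%C * 'i%C = - 1 :> R[i] by rewrite -expr2 sqr_i.
  have sw : star w = a - 'i%C *: b.
    by rewrite starD starZ sa sb conj_i scaleNr.
  have w1 : star w * w = 1.
    rewrite sw mulrDr !mulrBl -!scalerAr -!scalerAl scalerA ii scaleN1r.
    by rewrite opprK ab addrA addrNK.
  have sw1 : star (star w) * star w = 1.
    rewrite starK sw mulrDl !mulrBr -!scalerAr -!scalerAl scalerA ii scaleN1r.
    by rewrite opprK ab addrA addrNK.
  have aE : a = (2^-1)%:C *: (w + star w).
    rewrite sw addrACA subrr addr0 scalerDr -scalerDl -rmorphD.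
    by rewrite (_ : 2^-1 + 2^-1 = 1) ?scale1r//; lra.
  have pu (v : E) : star v * v = 1 -> cnorm (phi v) = 1.
    move=> vv; apply: cnorm_unitary.
    by rewrite -(star_hom_star sphi) -(star_homM sphi) vv (star_hom1 sphi).
  rewrite aE (star_homZ sphi) (star_homD sphi) cnormZr ger0_norm ?invr_ge0//.
  rewrite ler_pdivrMl// mulr1; apply: le_trans (cnormD _ _) _.
  by rewrite !pu//; lra.
have sa_le (a : E) : star a = a -> cnorm (phi a) <= cnorm a.
  move=> sa; apply/ler_addgt0Pr => e e0.
  have r0 : 0 < cnorm a + e by rewrite ltr_wpDl ?cnorm_ge0.
  pose a' := ((cnorm a + e)^-1)%:C *: a.
  have : cnorm (phi a') <= 1.
    apply: sa_le1; first by rewrite starZ conjc_real sa.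
    rewrite cnormZr ger0_norm ?invr_ge0 ?(ltW r0)//.
    by rewrite ltr_pdivrMl// mulr1 ltrDl.
  rewrite (star_homZ sphi) cnormZr ger0_norm ?invr_ge0 ?(ltW r0)//.
  by rewrite ler_pdivrMl// mulr1.
move=> x; rewrite -(ler_pXn2r (n := 2)) ?nnegrE ?cnorm_ge0//.
rewrite -!cnorm_starM -(star_hom_star sphi) -(star_homM sphi).
by apply: sa_le; rewrite starM starK.
Qed.

Lemma ccvg_star_hom (phi : E -> F) u x : star_hom phi -> ccvg u x ->
  ccvg (phi \o u) (phi x).
Proof.
move=> sphi; apply: (@ccvg_lipschitz _ _ _ _ 1) => y.
by rewrite mul1r -star_homB//; exact: star_hom_contractive.
Qed.

End Contractive.

(** * Generated C*-subalgebras *)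

Section Generation.
Variables (R : realType).

Lemma cstar_generated_sub (E : cstarType R) (G D : set E) :
  cstar_subalgebra D -> G `<=` D -> cstar_generated G `<=` D.
Proof. by move=> DC GD; apply: smallest_sub. Qed.

(** The equalizer is closed by contractivity. *)
Lemma star_hom_eq_on_generators (E F : cstarType R) (I : Type) (S : I -> E)
    (phi psi : E -> F) : star_hom phi -> star_hom psi ->
    cstar_generated (range S) = setT ->
  (forall i, phi (S i) = psi (S i)) -> phi = psi.
Proof.
move=> sphi spsi gen eqS; apply/funext => x.
suff : cstar_generated (range S) `<=` [set x | phi x = psi x].
  by apply; rewrite gen.
apply: cstar_generated_sub; last by move=> _ [i _ <-] /=.
split=> /=.
- by rewrite !star_hom0.
- by move=> y z yE zE; rewrite (star_homD sphi) (star_homD spsi) yE zE.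
- by move=> a y yE; rewrite (star_homZ sphi) (star_homZ spsi) yE.
- by move=> y z yE zE; rewrite (star_homM sphi) (star_homM spsi) yE zE.
- by move=> y yE; rewrite (star_hom_star sphi) (star_hom_star spsi) yE.
- move=> u y uE /ccvgP uy; apply: (ccvg_unique (u := phi \o u)).
    exact: ccvg_star_hom.
  rewrite (_ : phi \o u = psi \o u); last by apply/funext => n /=.
  exact: ccvg_star_hom.
Qed.

Lemma cstar_generated_cstar (E : cstarType R) (G : set E) :
  cstar_subalgebra (cstar_generated G).
Proof.
split; rewrite /cstar_generated /smallest.
- by move=> D [DC _]; exact: cstar_sub0.
- move=> x y xG yG D DG; have [DC _] := DG.
  by apply: (cstar_subD DC); [exact: xG|exact: yG].
- move=> a x xG D DG; have [DC _] := DG; apply: (cstar_subZ DC); exact: xG.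
- move=> x y xG yG D DG; have [DC _] := DG.
  by apply: (cstar_subM DC); [exact: xG|exact: yG].
- move=> x xG D DG; have [DC _] := DG; apply: (cstar_sub_star DC); exact: xG.
- move=> u x uG ux D DG; have [DC _] := DG.
  by apply: (cstar_sub_closed DC _ ux) => n; exact: uG.
Qed.

Lemma preimage_cstar_subalgebra (E F : cstarType R) (phi : E -> F) (D : set F) :
  star_hom phi -> cstar_subalgebra D -> cstar_subalgebra (phi @^-1` D).
Proof.
move=> sphi DC; split=> /=.
- by rewrite star_hom0//; exact: cstar_sub0.
- by move=> x y xD yD; rewrite (star_homD sphi); exact: cstar_subD.
- by move=> a x xD; rewrite (star_homZ sphi); exact: cstar_subZ.
- by move=> x y xD yD; rewrite (star_homM sphi); exact: cstar_subM.
- by move=> x xD; rewrite (star_hom_star sphi); exact: cstar_sub_star.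
- move=> u x uD /ccvgP ux; apply: (cstar_sub_closed DC (u := phi \o u)) => //.
  by apply/ccvgP; exact: ccvg_star_hom.
Qed.

End Generation.

(** * Words and cylinder projections of a Cuntz-Krieger family *)

Section CKFamily.
Variables (R : realType) (N : nat) (A : 'M[nat]_N) (O : cstarType R) (S : 'I_N -> O).
Hypothesis S_CK : CK_family A S.
Hypotheses (A01 : zero_one_mx A) (A_irr : irreducible_mx A).
Hypothesis (N_gt0 : (0 < N)%N).
Notation X := (shift_space A).
Notation sigma := (@shift_map N A).

Lemma range_projection i : projection (S i * star (S i)).
Proof.
split; first by rewrite starM starK.
by rewrite mulrA (CK_partial_isometry S_CK).
Qed.

(** The range projections sum to 1, so they are orthogonal; this is not among
    the relations. *)
Lemma generators_orthogonal i k : i != k -> star (S i) * S k = 0.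
Proof.
move=> ik; have := partition_orthogonal range_projection (CK_sum1 S_CK) ik.
move=> /(congr1 (fun z => star (S i) * z * S k)); rewrite mulr0 mul0r => <-.
rewrite -[in LHS](CK_partial_isometry S_CK i) -[in LHS](CK_partial_isometry S_CK k).
by rewrite !starM starK !mulrA.
Qed.

Lemma source_mul i j : star (S i) * S i * S j = S j *+ A i j.
Proof.
rewrite (CK_relation S_CK) mulr_suml (bigD1 j)//= mulrnAl.
rewrite (CK_partial_isometry S_CK) big1 ?addr0// => k kj.
by rewrite mulrnAl -mulrA generators_orthogonal// mulr0 mul0rn.
Qed.

Lemma generators_mul0 i j : A i j <> 1%N -> S i * S j = 0.
Proof.
move=> Aij; rewrite -(CK_partial_isometry S_CK i) -!mulrA mulrA mulrA.
rewrite -[_ * star _ * _]mulrA -mulrA source_mul.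
by case: (A01 i j) => // ->; rewrite mulr0n mulr0.
Qed.

Lemma source_mul_word i j mu :
  star (S i) * S i * CK_word S (j :: mu) = CK_word S (j :: mu) *+ A i j.
Proof. by rewrite /CK_word big_cons mulrA source_mul mulrnAl. Qed.

Lemma words_orthogonal mu nu : size mu = size nu -> mu <> nu ->
  star (CK_word S mu) * CK_word S nu = 0.
Proof.
elim: mu nu => [|i mu IH] [|j nu]//= [sz] ne.
rewrite /CK_word !big_cons starM -mulrA [star (S i) * _]mulrA.
have [ij|ij] := eqVneq i j; last by rewrite generators_orthogonal// mul0r mulr0.
rewrite -ij -!/(CK_word _ _); move: sz ne; rewrite -ij.
case: mu nu IH => [|k mu] [|l nu]// IH sz ne.
by rewrite source_mul_word mulrnAr IH ?mul0rn// => E; apply: ne; rewrite E.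
Qed.

Lemma CK_word_cat mu nu : CK_word S (mu ++ nu) = CK_word S mu * CK_word S nu.
Proof. exact: big_cat. Qed.

Definition prefix_word (x : X) n := CK_word S (mkseq (mseq x) n).
Definition prefix_proj (x : X) n := prefix_word x n * star (prefix_word x n).
Notation W := prefix_word.
Notation P := prefix_proj.

Lemma prefix_word0 x : W x 0 = 1.
Proof. exact: big_nil. Qed.

Lemma prefix_word1 x : W x 1 = S (mseq x 0).
Proof. by rewrite /W /mkseq /= /CK_word big_seq1. Qed.

Lemma prefix_wordD x m n : W x (m + n) = W x m * W (iter m sigma x) n.
Proof.
rewrite /W /mkseq iotaD map_cat CK_word_cat add0n; congr (_ * CK_word S _).
by rewrite -{1}[m]addn0 iotaDl -map_comp; apply: eq_map => i /=; rewrite mseq_iter.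
Qed.

Lemma prefix_wordS x n : W x n.+1 = S (mseq x 0) * W (sigma x) n.
Proof. by rewrite -[n.+1]add1n prefix_wordD prefix_word1. Qed.

Lemma prefix_word_agree n x y : agree n x y -> W x n = W y n.
Proof.
move=> xy; congr (CK_word S _); apply/eq_in_map => i; rewrite mem_iota add0n.
exact: xy.
Qed.

(** Each letter of an admissible word lies under the source projection of the
    preceding one. *)
Lemma prefix_word_absorb x n k :
  star (W x n) * W x (n + k.+1) = W (iter n sigma x) k.+1.
Proof.
elim: n x => [|n IH] x; first by rewrite prefix_word0 star1 mul1r.
rewrite iterSr -IH -add1n prefix_wordD -addnA prefix_wordD prefix_word1.
rewrite starM -mulrA [star (S _) * _]mulrA; congr (_ * _).
rewrite addnS /W /mkseq /= source_mul_word /=.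
by rewrite mseqP.
Qed.

Lemma prefix_word_isometry x n :
  star (W x n.+1) * W x n.+1 = star (S (mseq x n)) * S (mseq x n).
Proof.
have xn : W (iter n sigma x) 1 = S (mseq x n).
  by rewrite prefix_word1 mseq_iter addn0.
rewrite -addn1 {1}prefix_wordD starM -mulrA prefix_word_absorb.
by rewrite xn.
Qed.

Lemma prefix_word_partial_isometry x n : W x n * star (W x n) * W x n = W x n.
Proof.
case: n => [|n]; first by rewrite prefix_word0 star1 !mulr1.
rewrite -mulrA prefix_word_isometry -addn1 prefix_wordD prefix_word1.
rewrite mseq_iter addn0 -mulrA [S _ * (_ * _)]mulrA.
by rewrite (CK_partial_isometry S_CK).
Qed.

Lemma prefix_proj_word x m n : (m <= n)%N -> P x m * W x n = W x n.
Proof.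
rewrite leq_eqVlt => /predU1P[->|mn]; first exact: prefix_word_partial_isometry.
have -> : n = (m + (n - m.+1).+1)%N by rewrite addnS -addSn subnKC.
by rewrite -mulrA prefix_word_absorb -prefix_wordD.
Qed.

Lemma prefix_proj_star x n : star (P x n) = P x n.
Proof. by rewrite starM starK. Qed.

Lemma prefix_projM x m n : (m <= n)%N -> P x m * P x n = P x n.
Proof. by move=> mn; rewrite mulrA prefix_proj_word. Qed.

Lemma prefix_projMr x m n : (m <= n)%N -> P x n * P x m = P x n.
Proof.
by move=> mn; rewrite -(prefix_proj_star x n) -(prefix_proj_star x m) -starM
  prefix_projM.
Qed.

Lemma mul_prefix_proj_le (a b : O) x m n : (m <= n)%N ->
  a * P x m = b * P x m -> a * P x n = b * P x n.
Proof. by move=> mn ab; rewrite -(prefix_projM x mn) mulrA ab -mulrA. Qed.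

Lemma prefix_proj_agree n x y : agree n x y -> P x n = P y n.
Proof. by move=> xy; rewrite /P (prefix_word_agree xy). Qed.

Lemma prefix_word_disjoint n m x y : ~ agree n x y -> (n <= m)%N ->
  star (W x n) * W y m = 0.
Proof.
move=> xy nm; rewrite -(subnKC nm) prefix_wordD mulrA words_orthogonal ?mul0r//.
  by rewrite !size_mkseq.
move=> E; apply: xy => i ni.
have := congr1 (fun s => nth (mseq x 0) s i) E.
by rewrite !nth_mkseq.
Qed.

Lemma prefix_proj_disjoint n m x y : ~ agree n x y -> (n <= m)%N ->
  P x n * W y m = 0.
Proof. by move=> xy nm; rewrite -mulrA prefix_word_disjoint// mulr0. Qed.

Lemma prefix_proj_disjointr n m x y : ~ agree n x y -> (n <= m)%N ->
  P y m * P x n = 0.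
Proof.
move=> xy nm; have := prefix_proj_disjoint xy nm.
move=> /(congr1 (fun z => star (z * star (W y m)))).
by rewrite mul0r star0 -mulrA starM !prefix_proj_star.
Qed.

Lemma CK_proj_sum n : \sum_(mu : n.-tuple 'I_N) CK_proj S mu = 1.
Proof.
elim: n => [|n IH].
  rewrite (big_pred1 [tuple]) => [|mu]; last by apply/esym/eqP; exact: tuple0.
  by rewrite /CK_proj /CK_word big_nil star1 mulr1.
pose F (p : 'I_N * n.-tuple 'I_N) : n.+1.-tuple 'I_N := cons_tuple p.1 p.2.
have Fbij : bijective F.
  exists (fun mu : n.+1.-tuple 'I_N => (thead mu, behead_tuple mu)).
    by case=> j nu; congr pair; apply: val_inj.
  by move=> mu; rewrite [RHS]tuple_eta; apply: val_inj.
rewrite (reindex F) /=; last exact: onW_bij.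
transitivity (\sum_j \sum_(nu : n.-tuple 'I_N) S j * CK_proj S nu * star (S j)).
  rewrite pair_bigA; apply: eq_bigr => -[j nu] _ /=.
  by rewrite /CK_proj /CK_word big_cons starM !mulrA.
rewrite -[RHS](CK_sum1 S_CK); apply: eq_bigr => j _.
by rewrite -mulr_suml -mulr_sumr IH mulr1.
Qed.

Lemma mkseq_shift x n :
  mkseq (mseq x) n.+1 = mseq x 0 :: mkseq (mseq (sigma x)) n.
Proof.
by rewrite /mkseq /= -[1%N]addn0 iotaDl -map_comp.
Qed.

(** A forbidden transition makes the product vanish, and an admissible word
    extends to a point since every letter has a successor. *)
Lemma CK_word_realized mu : CK_word S mu <> 0 ->
  exists x : X, mkseq (mseq x) (size mu) = mu.
Proof.
elim: mu => [|i mu IH] ne.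
  have [x _] := point_starting A01 A_irr (Ordinal N_gt0); by exists x.
case: mu IH ne => [|j mu] IH ne.
  by have [x xi] := point_starting A01 A_irr i; exists x; rewrite /mkseq /= xi.
have Aij : A i j = 1%N.
  apply: contrapT => Aij; apply: ne.
  by rewrite /CK_word !big_cons mulrA generators_mul0// mul0r.
have [|x xE] := IH.
  move=> E; apply: ne; move: E; rewrite /CK_word [in X in _ -> X]big_cons => ->.
  by rewrite mulr0.
have xj : mseq x 0 = j by case: xE.
have [|z [zi zx]] := @prepend_exists _ A i x; first by rewrite xj.
exists z; rewrite [LHS]mkseq_shift zi zx; congr (_ :: _); exact: xE.
Qed.

Lemma point_inhabited : exists x : X, True.
Proof.
by have [x _] := point_starting A01 A_irr (Ordinal N_gt0); exists x.
Qed.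

(** The cylinder projections of length [n] sum to 1, so the values of [b] at
    one point of each cylinder can be combined into one element. *)
Lemma glue_exists (b : X -> O) n :
  exists a, forall x, exists y, agree n x y /\ a * P x n = b y * P x n.
Proof.
have [x0 _] := point_inhabited.
pose rep (mu : n.-tuple 'I_N) := xget x0 [set x | mkseq (mseq x) n = mu].
exists (\sum_(mu : n.-tuple 'I_N) b (rep mu) * CK_proj S mu) => x.
have szx : size (mkseq (mseq x) n) == n by rewrite size_mkseq.
pose mux : n.-tuple 'I_N := Tuple szx.
exists (rep mux); split.
  have : mkseq (mseq (rep mux)) n = mux.
    by apply: (@xgetPex _ x0 [set y | mkseq (mseq y) n = mux]); exists x.
  move=> E i ni; have := congr1 (fun s => nth (mseq x 0) s i) E.
  by rewrite !nth_mkseq.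
rewrite mulr_suml (bigD1 mux)//= big1 ?addr0 => [|mu mux'].
  by rewrite -mulrA; congr (_ * _); exact: prefix_projM.
rewrite -!mulrA [star _ * (_ * _)]mulrA words_orthogonal.
- by rewrite mul0r !mulr0.
- by rewrite size_tuple size_mkseq.
- by move=> E; move/eqP: mux'; apply; apply: val_inj.
Qed.

(** By compactness one length serves all points, and the cylinder projections
    of that length sum to 1. *)
Lemma local_prop (D : set O) (a : O) : (forall x y, D x -> D y -> D (x + y)) -> D 0 ->
    (forall x n, D (a * P x n) -> D (a * P x n.+1)) ->
    (forall x, exists n, D (a * P x n)) -> D a.
Proof.
move=> DD D0 DP aD.
have [L aL] : exists L, forall x, D (a * P x L).
  by apply: fan aD => // x y n xy; rewrite (prefix_proj_agree xy).
rewrite -[a]mulr1 -(CK_proj_sum L) mulr_sumr; elim/big_ind: _ => // mu _.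
have [mu0|/eqP/CK_word_realized[x]] := eqVneq (CK_word S mu) 0.
  by rewrite /CK_proj mu0 mul0r mulr0.
by rewrite size_tuple => <-; exact: aL.
Qed.

Lemma local_eq (a b : O) : (forall x, exists n, a * P x n = b * P x n) -> a = b.
Proof.
move=> ab; apply/eqP; rewrite -subr_eq0; apply/eqP.
apply: (@local_prop [set z | z = 0]) => //=.
- by move=> x y -> ->; rewrite addr0.
- by move=> x n E; rewrite -(prefix_projM x (leqnSn n)) mulrA E mul0r.
- by move=> x; have [n E] := ab x; exists n; rewrite mulrBl E subrr.
Qed.

Lemma local_eql (a b : O) : (forall x, exists n, P x n * a = P x n * b) -> a = b.
Proof.
move=> ab; rewrite -[a]starK -[b]starK; congr (star _); apply: local_eq => x.
by have [n E] := ab x; exists n; rewrite -prefix_proj_star -!starM E.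
Qed.

(** If a generator vanishes then so do the generators of its successors, hence
    all of them by irreducibility, although their ranges sum to 1. *)
Lemma CK_generator_neq0 i : S i <> 0.
Proof.
move=> Si0.
have next k j : S k = 0 -> (0 < A k j)%N -> S j = 0.
  move=> Sk0 Akj; have := source_mul k j.
  by rewrite Sk0 mulr0 mul0r (entry_gt0 A01 Akj) mulr1n.
have all0 j : S j = 0.
  have [n [_ Anij]] := A_irr i j.
  elim: n i Si0 Anij => [|n IH] k Sk0.
    by rewrite expr0 mxE; case: eqP => [<-|].
  rewrite exprS => /mulmx_gt0[l [Akl Alj]]; apply: IH Alj.
  exact: next Akl.
have := CK_sum1 S_CK; rewrite big1 => [|j _]; last by rewrite all0 mul0r.
by move/eqP; rewrite eq_sym oner_eq0.
Qed.

Lemma prefix_word_neq0 x n : W x n <> 0.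
Proof.
case: n => [|n] W0.
  by move/eqP: W0; rewrite prefix_word0 oner_eq0.
have := prefix_word_isometry x n; rewrite W0 mulr0 => /esym/star_mul_eq0.
exact: CK_generator_neq0.
Qed.

Lemma prefix_proj_norm x n : cnorm (P x n) = 1.
Proof.
have P0 : P x n <> 0.
  move=> P0; apply: (@prefix_word_neq0 x n).
  by rewrite -(prefix_proj_word x (leqnn n)) P0 mul0r.
have := cnorm_starM (P x n); rewrite prefix_proj_star prefix_projM// => /eqP.
rewrite expr2 -{1}[cnorm _]mulr1 -subr_eq0 -mulrBr mulf_eq0 cnorm_eq0 => /orP[/eqP//|].
by rewrite subr_eq0 eq_sym => /eqP.
Qed.

End CKFamily.

(** * Partial maps that exchange prefixes *)

Section LocalForm.
Variables (N : nat) (A : 'M[nat]_N).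
Notation X := (shift_space A).
Notation sigma := (@shift_map N A).

(** Near [y], the relation [G] is the graph of the partial map by which the
    product of the word [z_0 ... z_(m-1)] and the adjoint of the word
    [y_0 ... y_(n-1)] acts. *)
Definition local_form (G : X -> X -> Prop) y z m n :=
  forall y', agree n y y' -> forall z',
    G y' z' <-> agree m z z' /\ iter m sigma z' = iter n sigma y'.

(** Near each point of its domain such a relation is the graph of a compact open
    bisection of the groupoid of tail equivalence, with the lag forgotten. *)
Definition admissible (G : X -> X -> Prop) := forall y, exists n,
  (forall y', agree n y y' -> forall z', ~ G y' z') \/
  (exists z m, G y z /\ local_form G y z m n).

Variable G : X -> X -> Prop.

Lemma local_form_tail y z m n : local_form G y z m n -> G y z ->
  iter m sigma z = iter n sigma y.
Proof. by move=> yz /yz[]. Qed.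

Lemma local_form_functional y z m n y' z1 z2 : local_form G y z m n ->
  agree n y y' -> G y' z1 -> G y' z2 -> z1 = z2.
Proof.
move=> yz yy' /(yz _ yy')[a1 t1] /(yz _ yy')[a2 t2].
apply: (@agree_iter_inj _ _ m); last by rewrite t1 t2.
by apply: agree_trans a2; apply: agree_sym.
Qed.

(** Lengthening both prefixes by the same letters does not change the exchange. *)
Lemma local_form_extend y z m n k : G y z -> local_form G y z m n ->
  local_form G y z (m + k) (n + k).
Proof.
move=> Gyz yz y' yy' z'.
have tail := local_form_tail yz Gyz.
have /agreeD[yy'n yy'k] := yy'.
rewrite (yz _ yy'n); split=> [[zz' t]|[/agreeD[zz' zz'k] t]].
  split; last by rewrite addnC iterD t -iterD addnC.
  by apply/agreeD; split=> //; rewrite tail t.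
split=> //; apply: (@agree_iter_inj _ _ k); last by rewrite -!iterD addnC t addnC.
by apply: agree_trans yy'k; rewrite -tail; exact: agree_sym.
Qed.

(** Both prefixes continue with the same letter, so once that letter is fixed
    the exchanged prefix can be joined to the tail of [y']. *)
Lemma local_form_total y z m n y' : G y z -> local_form G y z m n ->
  agree n.+1 y y' -> exists z', G y' z'.
Proof.
move=> Gyz yz yy'; have tail := local_form_tail yz Gyz.
have [|z' [zz' t]] := @splice_eq _ A m z (iter n sigma y').
  by rewrite mseq_iter addn0 -yy'// -[m]addn0 -mseq_iter tail mseq_iter addn0.
exists z'; apply/yz; first exact: agree_le yy'.
by split=> //; exact: agree_sym.
Qed.

Lemma local_form_move y z m n y' z' : local_form G y z m n -> agree n y y' ->
  G y' z' -> local_form G y' z' m n.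
Proof.
move=> yz yy' Gyz' w yw v.
rewrite (yz _ (agree_trans yy' yw)).
have [zz' _] := (yz _ yy' z').1 Gyz'.
split=> -[h1 h2]; split=> //; first exact: agree_trans (agree_sym zz') h1.
exact: agree_trans zz' h1.
Qed.

Lemma local_form_intro y z l k n : G y z ->
    (forall y', agree n y y' -> exists z',
       [/\ G y' z', agree l z z' & iter l sigma z' = iter k sigma y']) ->
    (forall y' z1 z2, G y' z1 -> G y' z2 -> z1 = z2) ->
  local_form G y z (l + n) (k + n).
Proof.
move=> Gyz sect func y' yy' w.
have tail : iter l sigma z = iter k sigma y.
  by have [z' [/(func _ _ _ Gyz) <-]] := sect _ (fun i _ => erefl (mseq y i)).
have [|z' [Gz' zz' t]] := sect y'; first by apply: agree_le yy'; rewrite leq_addl.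
have H : agree (l + n) z z' /\ iter (l + n) sigma z' = iter (k + n) sigma y'.
  split; last by rewrite addnC iterD t -iterD addnC.
  apply/agreeD; split=> //; rewrite tail t.
  by have /agreeD[] := yy'.
split=> [/(func _ _ _ Gz') <- //|[zw tw]].
suff -> : w = z' by [].
apply: (@agree_iter_inj _ _ (l + n)); last by rewrite tw H.2.
exact: agree_trans (agree_sym zw) H.1.
Qed.

Hypotheses (A01 : zero_one_mx A) (A_irr : irreducible_mx A)
  (A_nperm : ~~ is_perm_mx A).

(** Evaluated at an aperiodic point near [y], two pairs of exponents for the
    same tail equivalence have the same difference. *)
Lemma lag_unique K (y : X) m n m' n' :
    (forall y', agree K y y' -> exists z',
       iter m sigma z' = iter n sigma y' /\ iter m' sigma z' = iter n' sigma y') ->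
  (m' + n = m + n')%N.
Proof.
move=> tails; have [y' [/tails[z' [t t']] ay']] := aperiodic_dense A01 A_irr A_nperm K y.
by apply: ay'; rewrite iterD -t -iterD addnC iterD t' -iterD.
Qed.

End LocalForm.

(** * Elements that implement a partial map *)

Section Implements.
Variables (R : realType) (N : nat) (A : 'M[nat]_N) (O : cstarType R) (S : 'I_N -> O).
Hypothesis S_CK : CK_family A S.
Hypotheses (A01 : zero_one_mx A) (A_irr : irreducible_mx A)
  (A_nperm : ~~ is_perm_mx A).
Hypothesis (N_gt0 : (0 < N)%N).
Notation X := (shift_space A).
Notation sigma := (@shift_map N A).
Notation W := (prefix_word S).
Notation P := (prefix_proj S).
Implicit Types G H : X -> X -> Prop.

Definition germ (a : O) G y n :=
  ((forall y', agree n y y' -> forall z', ~ G y' z') /\ a * P y n = 0) \/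
  (exists z m, [/\ G y z, local_form G y z m n & a * P y n = W z m * star (W y n)]).

Definition implements (a : O) G := forall y, exists n, germ a G y n.

Lemma word_unit_proj (z y : X) m n k : iter m sigma z = iter n sigma y ->
  W z m * star (W y n) * P y (n + k) = W z (m + k) * star (W y (n + k)).
Proof.
move=> t; rewrite /prefix_proj -mulrA [star _ * (_ * _)]mulrA.
case: k => [|k].
  rewrite !addn0; congr (_ * _).
  have := congr1 star (prefix_word_partial_isometry S_CK y n).
  by rewrite !starM starK mulrA.
by rewrite (prefix_word_absorb S_CK) mulrA (prefix_wordD S z m) t.
Qed.

Lemma germ_congr a b G y n : a * P y n = b * P y n -> germ a G y n -> germ b G y n.
Proof. by move=> E; rewrite /germ E. Qed.

Lemma germ_extend k a G y n : germ a G y n -> germ a G y (n + k).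
Proof.
have PE : a * P y (n + k) = a * P y n * P y (n + k).
  by rewrite -mulrA (prefix_projM S_CK)// leq_addr.
move=> [[noG aP]|[z [m [Gyz yz aP]]]].
  left; split; last by rewrite PE aP mul0r.
  by move=> y' yy'; apply: noG; apply: agree_le yy'; rewrite leq_addr.
right; exists z, (m + k)%N; split=> //; first exact: local_form_extend.
by rewrite PE aP word_unit_proj//; exact: local_form_tail yz Gyz.
Qed.

Lemma germ_ge m a G y n : (n <= m)%N -> germ a G y n -> germ a G y m.
Proof. by move=> nm /(germ_extend (m - n)); rewrite subnKC. Qed.

Lemma germ_move a G y n y' : germ a G y n -> agree n.+1 y y' -> germ a G y' n.+1.
Proof.
move=> gy yy'; have := germ_extend 1 gy; rewrite addn1.
case: gy => [[noG aP] _|[z [m [Gyz yz aP]]]].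
  left; split.
    move=> w yw; apply: noG; apply: agree_le (agree_trans yy' yw); exact: leqnSn.
  rewrite -(prefix_proj_agree S yy') -(prefix_projM S_CK y (leqnSn n)) mulrA aP.
  by rewrite mul0r.
move=> [[noG _]|[z1 [m1 [Gyz1 yz1 aP1]]]].
  by exfalso; apply: (noG y _ z).
have [z' Gyz'] := local_form_total Gyz yz yy'.
have [zz' _] := (yz1 _ yy' z').1 Gyz'.
right; exists z', m1; split=> //; first exact: local_form_move yz1 _ _.
by rewrite -(prefix_proj_agree S yy') aP1 (prefix_word_agree S zz') (prefix_word_agree S yy').
Qed.

(** A partial map determines the lag of its local forms by [lag_unique], hence
    also the elements that implement these forms on small cylinders. *)
Lemma implements_inj a b G : implements a G -> implements b G -> a = b.
Proof.
move=> aG bG; apply: (local_eq S_CK A01 A_irr N_gt0) => y.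
have [n /(germ_extend _)an] := aG y; have [m /(germ_extend _)bm] := bG y.
exists (n + m)%N; have := bm n; rewrite addnC => {bm}.
case: (an m) => [[noG ->]|[z [k [Gyz yz ->]]]].
  by case=> [[_ ->//]|[z [k [Gyz _ _]]]]; case: (noG y _ z).
case=> [[noG _]|[z' [k' [Gyz' yz' ->]]]]; first by case: (noG y _ z).
have {}Gyz'z : z' = z by exact: (local_form_functional yz (y' := y)).
rewrite Gyz'z in yz' *; congr (W z _ * _).
suff : (k' + (n + m) = k + (n + m))%N by move/addIn.
apply: (@lag_unique _ _ A01 A_irr A_nperm (n + m).+1 y) => y' yy'.
have [w Gw] := local_form_total Gyz yz yy'.
have yy'' := agree_le (leqnSn _) yy'.
by exists w; split; [exact: ((yz _ yy'' w).1 Gw).2|exact: ((yz' _ yy'' w).1 Gw).2].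
Qed.

(** Local forms are implemented by products of words and adjoints of words, and
    these are glued by compactness. *)
Lemma implements_exists G : admissible G -> exists a, implements a G.
Proof.
move=> adm.
have germs y : exists b n, germ b G y n.
  have [n [noG|[z [m [Gyz yz]]]]] := adm y.
    by exists 0, n; left; split=> //; rewrite mul0r.
  exists (W z m * star (W y n)), n; right; exists z, m; split=> //.
  by have := word_unit_proj 0 (local_form_tail yz Gyz); rewrite !addn0.
pose Q y n := exists b, forall y', agree n y y' -> exists k, germ b G y' k.
have [||y|L LP] := @fan _ A Q.
- by move=> x n [b bP]; exists b => y xy; apply: bP; apply: agree_le xy.
- by move=> x y n xy [b bP]; exists b => z yz; apply: bP; exact: agree_trans yz.
- have [b [n bn]] := germs y; exists n.+1, b => y' yy'.
  by exists n.+1; exact: germ_move bn yy'.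
pose b y := sval (cid (LP y)).
have bP y : forall y', agree L y y' -> exists k, germ (b y) G y' k := svalP (cid (LP y)).
have [a aP] := glue_exists S_CK A01 A_irr N_gt0 b L.
exists a => x; have [y [xy aE]] := aP x.
have [k gk] := bP y x (agree_sym xy).
exists (L + k)%N; apply: germ_congr (germ_ge (leq_addl L k) gk).
by apply: (mul_prefix_proj_le S_CK (leq_addr k L)).
Qed.

Lemma prefix_word_range (z w : X) m n : mseq z m = mseq w n ->
  W z m.+1 * (star (W w n.+1) * W w n.+1) = W z m.+1.
Proof.
move=> zw; rewrite (prefix_word_isometry S_CK) -zw -addn1 prefix_wordD prefix_word1.
by rewrite mseq_iter addn0 -!mulrA [S _ * (_ * _)]mulrA (CK_partial_isometry S_CK).
Qed.

(** Both local forms are lengthened until the target prefix of the inner one is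
    the source prefix of the outer one; one further letter absorbs the source
    projection that appears between them. *)
Lemma implements_mul a b G H : implements a G -> implements b H ->
  implements (a * b) (fun y z => exists w, H y w /\ G w z).
Proof.
move=> aG bH y; have [n bn] := bH y.
case: (bn) => [[noH bP]|[w [m [Hyw yw bP]]]].
  exists n; left; split; last by rewrite -mulrA bP mulr0.
  by move=> y' yy' z [w [/noH]].
have [p ap] := aG w.
have tail := local_form_tail yw Hyw.
have yw' := local_form_extend (k := p.+1) Hyw yw.
have bP' : b * P y (n + p.+1) = W w (m + p.+1) * star (W y (n + p.+1)).
  by rewrite -word_unit_proj// -bP -mulrA (prefix_projM S_CK)// leq_addr.
exists (n + p.+1)%N.
have ap' : germ a G w (m + p) by apply: germ_ge ap; rewrite leq_addl.
have aW : a * W w (m + p.+1) = a * P w (m + p) * W w (m + p.+1).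
  by rewrite -mulrA (prefix_proj_word S_CK)// addnS.
case: ap' => [[noG aP]|[z [q [Gwz wz aP]]]].
  left; split.
    move=> y' yy' z [w' [Hyw' Gwz]]; apply: (noG w' _ z) => //.
    by have [ww' _] := (yw' _ yy' w').1 Hyw'; apply: agree_le ww'; rewrite addnS.
  by rewrite -mulrA bP' mulrA aW aP !mul0r.
have tail' := local_form_tail wz Gwz.
have wz' := local_form_extend (k := 1) Gwz wz.
rewrite !addn1 -addnS in wz'.
right; exists z, q.+1; split; first by exists w.
  move=> y' yy' z'; split.
    move=> [w' [Hyw' Gwz']].
    have [ww' tw'] := (yw' _ yy' w').1 Hyw'.
    by have [zz' tz'] := (wz' _ ww' z').1 Gwz'; rewrite tz' tw'.
  move=> [zz' tz'].
  have [|w' [ww' tw']] := @splice_exists _ A (m + p).+1 w (iter (n + p.+1) sigma y').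
    right; rewrite /= -mseq_iter tail !mseq_iter addn0 yy' ?addnS//.
    exact: mseqP.
  rewrite -addnS in ww' tw'; exists w'; split; first by apply/yw' => //; split=> //; exact: agree_sym.
  by apply/wz'; [exact: agree_sym|split=> //; rewrite tz' tw'].
have aP' : a * P w (m + p) * P w (m + p).+1 = W z q.+1 * star (W w (m + p).+1).
  by have := word_unit_proj 1 tail'; rewrite !addn1 aP.
rewrite -mulrA bP' addnS.
have -> : a * (W w (m + p).+1 * star (W y (n + p.+1))) =
    a * P w (m + p) * P w (m + p).+1 * (W w (m + p).+1 * star (W y (n + p.+1))).
  rewrite -[_ * P w (m + p) * _]mulrA (prefix_projM S_CK)//.
  by rewrite -[RHS]mulrA [P w _ * _]mulrA (prefix_proj_word S_CK).
rewrite aP' -mulrA [star _ * (_ * _)]mulrA mulrA prefix_word_range//.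
by rewrite -[q]addn0 -mseq_iter tail' mseq_iter addn0.
Qed.

End Implements.

(** * Adjoints, generators and indicators as implementing elements *)

Section ImplementsStar.
Variables (R : realType) (N : nat) (A : 'M[nat]_N) (O : cstarType R) (S : 'I_N -> O).
Hypothesis S_CK : CK_family A S.
Hypotheses (A01 : zero_one_mx A) (A_irr : irreducible_mx A)
  (A_nperm : ~~ is_perm_mx A).
Hypothesis (N_gt0 : (0 < N)%N).
Notation X := (shift_space A).
Notation sigma := (@shift_map N A).
Notation W := (prefix_word S).
Notation P := (prefix_proj S).
Implicit Types G H : X -> X -> Prop.

Definition transpose G : X -> X -> Prop := fun y z => G z y.

Lemma word_unit_extend a (z y : X) m n k : iter m sigma z = iter n sigma y ->
    a * P y n = W z m * star (W y n) ->
  a * P y (n + k) = W z (m + k) * star (W y (n + k)).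
Proof.
move=> t aP; rewrite -(word_unit_proj S_CK)// -aP -mulrA.
by rewrite (prefix_projM S_CK)// leq_addr.
Qed.

Lemma transpose_disjoint a' G y n w : implements S a' (transpose G) ->
    (forall y', agree n y y' -> ~ G y' w) ->
  exists k, P y n * a' * P w k = 0.
Proof.
move=> aG noG; have [k ak] := aG w.
case: ak => [[_ aP]|[y' [l [Gy'w wy' aP]]]].
  by exists k; rewrite -mulrA aP mulr0.
exists (k + n)%N.
rewrite -mulrA (word_unit_extend _ _ aP); last exact: local_form_tail wy' Gy'w.
rewrite mulrA (prefix_proj_disjoint S_CK) ?mul0r ?leq_addl//.
by move=> yy'; apply: (noG y').
Qed.

(** Compressed to small cylinders on both sides, [a'] and the adjoint of [a] are
    the same prefix exchange read backwards.  Off the graph of [G] both vanish,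
    for [a'] because it implements the map with the graph of [G] read backwards. *)
Lemma transpose_unique a a' G : implements S a G -> implements S a' (transpose G) ->
  a' = star a.
Proof.
move=> aG a'G; apply: (local_eql S_CK A01 A_irr N_gt0) => y.
have [n [[noG aP]|[z [m [Gyz yz aP]]]]] := aG y.
  exists n; have -> : P y n * star a = 0.
    by rewrite -(prefix_proj_star S) -starM aP star0.
  apply: (local_eq S_CK A01 A_irr N_gt0) => w.
  have [|k kP] := @transpose_disjoint a' G y n w a'G.
    by move=> y' yy'; exact: noG.
  by exists k; rewrite mul0r.
have tail := local_form_tail yz Gyz.
have yn_zm : mseq y n = mseq z m.
  by rewrite -[n]addn0 -[m]addn0 -!mseq_iter tail.
have yz' := local_form_extend (k := 1) Gyz yz.
have aP' := word_unit_extend 1 tail aP.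
rewrite !addn1 in yz' aP'.
exists n.+1; apply: (local_eq S_CK A01 A_irr N_gt0) => w.
have -> : P y n.+1 * star a = W y n.+1 * star (W z m.+1).
  by rewrite -(prefix_proj_star S) -starM aP' starM starK.
have [[y' [Gy'w yy']]|noG] := pselect (exists y', G y' w /\ agree n.+1 y y').
  have [zw tw] := (yz' _ yy' w).1 Gy'w.
  have [k [[noG _]|[y1 [l [Gy1w wy1 aP1]]]]] := a'G w.
    by case: (noG w _ y').
  have y1y' : y1 = y' by exact: (local_form_functional wy1 (y' := w)).
  rewrite {}y1y' in Gy1w wy1 aP1.
  (* The exponents of the two local forms are compared at points [w'] near [w];
     these have a preimage because one letter beyond the prefix agrees. *)
  have lag : (n.+1 + k = l + m.+1)%N.
    apply: (@lag_unique _ _ A01 A_irr A_nperm (maxn k m.+2) w) => w' ww'.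
    have [|yh [yh' th]] := @splice_eq _ A n.+1 y' (iter m.+1 sigma w').
      rewrite mseq_iter addn0 -[n.+1]addn0 -mseq_iter -tw mseq_iter addn0.
      by apply: ww'; rewrite leq_max leqnn orbT.
    have Gyh : G yh w'.
      apply/yz'; first exact: agree_trans yy' (agree_sym yh').
      split=> //; apply: agree_trans zw _; apply: agree_le ww'.
      by rewrite leq_max leqnSn orbT.
    exists yh; split=> //.
    have ww'' : agree k w w' by apply: agree_le ww'; rewrite leq_maxl.
    exact: ((wy1 _ ww'' yh).1 Gyh).2.
  exists (k + m.+1)%N.
  rewrite -mulrA (word_unit_extend _ _ aP1); last exact: local_form_tail wy1 Gy1w.
  rewrite -lag mulrA (prefix_proj_agree S yy') (prefix_proj_word S_CK) ?leq_addr//.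
  rewrite (prefix_word_agree S yy') (prefix_word_agree S zw) [(k + _)%N]addnC.
  by rewrite (word_unit_proj S_CK).
have [k kP] : exists k, P y n.+1 * a' * P w k = 0.
  by apply: (transpose_disjoint a'G) => y' yy' Gy'w; apply: noG; exists y'.
exists (k + m.+1)%N.
rewrite -(prefix_projM S_CK w (leq_addr m.+1 k)) mulrA kP mul0r.
have zw : ~ agree m.+1 z w.
  move=> zw; have [|yh [yyh th]] := @splice_exists _ A n.+1 y (iter m.+1 sigma w).
    by right; rewrite mseq_iter addn0 -pred_Sn yn_zm zw//; exact: mseqP.
  apply: noG; exists yh; split; last exact: agree_sym.
  by apply/yz'; [exact: agree_sym|split].
rewrite (prefix_projM S_CK) ?leq_addr// -mulrA [star _ * (_ * _)]mulrA.
by rewrite (prefix_word_disjoint S_CK zw) ?leq_addl// mul0r mulr0.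
Qed.

Lemma implements_star a G : implements S a G -> admissible (transpose G) ->
  implements S (star a) (transpose G).
Proof.
move=> aG /(implements_exists S_CK A01 A_irr N_gt0)[a' a'G].
by rewrite -(transpose_unique aG a'G).
Qed.

Lemma implements_ext a G H : (forall y z, G y z <-> H y z) ->
  implements S a G -> implements S a H.
Proof.
by move=> GH; rewrite (_ : G = H)//; apply/funext => y; apply/funext => z; apply/propext.
Qed.

Lemma germ_ext a G H y n : (forall y', agree n y y' -> forall z, G y' z <-> H y' z) ->
  germ S a G y n -> germ S a H y n.
Proof.
move=> GH [[noG aP]|[z [m [Gyz yz aP]]]]; [left|right].
  by split=> // y' yy' z' /(GH _ yy'); exact: noG.
exists z, m; split=> //; first by apply/GH.
by move=> y' yy' z'; rewrite -GH//; exact: yz.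
Qed.

Lemma implements_one : implements S 1 (fun y z : X => z = y).
Proof.
move=> y; exists 0%N; right; exists y, 0%N; split=> //.
  by move=> y' _ z'; split=> [->//|[]].
by rewrite /prefix_proj !prefix_word0 !mul1r.
Qed.

Definition prepend_rel i : X -> X -> Prop := fun y z => mseq z 0 = i /\ sigma z = y.

Lemma implements_generator i : implements S (S i) (prepend_rel i).
Proof.
move=> y; have [Aiy|Aiy] := pselect (A i (mseq y 0) = 1%N).
  have [z [zi zy]] := prepend_exists Aiy.
  exists 0%N; right; exists z, 1%N; split=> //.
    move=> y' _ z'; split=> [[z'i z'y]|[zz' z'y]]; split=> //.
      by case=> // _; rewrite zi z'i.
    by rewrite -zz'// zi.
  by rewrite /prefix_proj !prefix_word0 prefix_word1 zi mul1r star1 mulr1.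
exists 1%N; left; split.
  move=> y' yy' z' [z'i z'y]; apply: Aiy; rewrite yy'// -z'y -z'i; exact: mseqP.
rewrite /prefix_proj prefix_word1 mulrA (generators_mul0 S_CK A01 Aiy) mul0r //.
Qed.

Definition indicator_rel (D : X -> bool) : X -> X -> Prop := fun y z => D y /\ z = y.

(** The identity has lag 0, so near a point of [D] the element [a] is a cylinder
    projection. *)
Lemma implements_indicator a (D : X -> bool) : implements S a (indicator_rel D) ->
  forall y, exists n, forall k, (n <= k)%N -> a * P y k = P y k *+ D y.
Proof.
move=> aD y; have [n [[noD aP]|[z [m [[Dy ->] yy aP]]]]] := aD y; exists n => k nk.
  have /negbTE -> : ~~ D y by apply/negP => Dy; apply: (noD y _ y).
  by rewrite mulr0n -(prefix_projM S_CK y nk) mulrA aP mul0r.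
rewrite Dy mulr1n.
have mn : (0 + n = m + 0)%N.
  apply: (@lag_unique _ _ A01 A_irr A_nperm n.+1 y) => y' yy'.
  have Gyy : indicator_rel D y y by [].
  have [z' [Dy' z'y']] := local_form_total Gyy yy yy'.
  have yy'' := agree_le (leqnSn n) yy'.
  exists y'; split=> //.
  exact: ((yy _ yy'' y').1 (conj Dy' erefl)).2.
have {}mn : m = n by rewrite addn0 add0n in mn.
rewrite -(prefix_projM S_CK y nk) mulrA aP mn.
by rewrite (prefix_projM S_CK y nk).
Qed.

(** The partial map implemented by a word times the adjoint of a word. *)
Definition unit_rel (z : X) m (x : X) n : X -> X -> Prop :=
  fun y' z' => agree n x y' /\ agree m z z' /\ iter m sigma z' = iter n sigma y'.

End ImplementsStar.

(** * Conjugation of partial maps by an orbit equivalence *)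

Section Conjugation.
Variables (N M : nat) (A : 'M[nat]_N) (B : 'M[nat]_M).
Variable h : homeomorphism (shift_space A) (shift_space B).
Notation sA := (@shift_map N A).
Notation sB := (@shift_map M B).
Notation g := (homeo_inv h).

Definition conj_rel (G : shift_space A -> shift_space A -> Prop) :
  shift_space B -> shift_space B -> Prop := fun y z => G (g y) (g z).

Lemma homeo_inv_inj y z : g y = g z -> y = z.
Proof. by move=> yz; rewrite -(homeo_invK h y) yz homeo_invK. Qed.

Lemma prepend_rel_inj i (x z z' : shift_space A) :
  prepend_rel i x z -> prepend_rel i x z' -> z = z'.
Proof.
move=> [zi zx] [z'i z'x]; apply: (@agree_iter_inj _ _ 1); last by rewrite /= zx.
by case=> // _; rewrite zi.
Qed.

Variables k1 l1 : shift_space A -> nat.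
Hypothesis kl : orbit_cocycles h k1 l1.

Lemma orbit_cocycles_near (x : shift_space A) : exists p, forall x', agree p x x' ->
  k1 x' = k1 x /\ l1 x' = l1 x.
Proof.
apply/nbhs_agree; near=> w; split; near: w.
  exact: locally_constant_nat (orbit_cocycles_k kl) _.
exact: locally_constant_nat (orbit_cocycles_l kl) _.
Unshelve. all: by end_near. Qed.

(** Put [x' = i (g y)].  The cocycle equation at [x'] says that [y] and [h x']
    have a common tail after [k1 x'] and [l1 x'] letters, and these exponents
    are locally constant. *)
Lemma conj_prepend_admissible i : admissible (conj_rel (prepend_rel i)).
Proof.
move=> y; pose x := g y.
have [Aix|Aix] := pselect (A i (mseq x 0) = 1%N); last first.
  have [n nP] := continuous_agree (@homeo_inv_continuous _ _ h) y 1.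
  exists n; left => y' /nP yy' z' [z'i z'y]; apply: Aix.
  rewrite /x yy'// -z'i -z'y; exact: mseqP.
have [x' [x'i x'x]] := prepend_exists Aix.
have [p pP] := orbit_cocycles_near x'.
have [q qP] := continuous_agree (@homeo_continuous _ _ h) x' (l1 x').
have [n nP] := continuous_agree (@homeo_inv_continuous _ _ h) y (maxn p q).+1.
exists (k1 x' + n)%N; right; exists (h x'), (l1 x' + n)%N.
have Gyx : conj_rel (prepend_rel i) y (h x') by split; rewrite homeoK.
split=> //; apply: local_form_intro => //; last first.
  by move=> y' z1 z2 G1 G2; apply: homeo_inv_inj; apply: prepend_rel_inj G1 G2.
move=> y' /nP yy'.
have [|x'' [x''i x''x]] := @prepend_exists _ A i (g y'); first by rewrite -yy'.
have xx'' : agree (maxn p q) x' x''.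
  case=> [_|j jpq]; first by rewrite x'i x''i.
  rewrite -[mseq x' _]/(mseq (sA x') j) -[mseq x'' _]/(mseq (sA x'') j) x'x x''x.
  by apply: yy'; exact: ltnW (ltnW jpq).
have [k1E l1E] := pP _ (agree_le (leq_maxl _ _) xx'').
exists (h x''); split.
- by split; rewrite homeoK.
- by apply: qP; apply: agree_le xx''; exact: leq_maxr.
- by rewrite -l1E -k1E -(orbit_cocyclesE kl) x''x homeo_invK.
Qed.

Lemma conj_prepend_transpose_admissible i :
  admissible (transpose (conj_rel (prepend_rel i))).
Proof.
move=> z; pose x' := g z.
have [x'i|x'i] := pselect (mseq x' 0 = i); last first.
  have [n nP] := continuous_agree (@homeo_inv_continuous _ _ h) z 1.
  exists n; left => z' /nP zz' y' [z'i _]; apply: x'i.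
  by rewrite /x' zz'.
have [p pP] := orbit_cocycles_near x'.
have sg : continuous (sA \o g).
  by move=> w; exact: (continuous_comp (@homeo_inv_continuous _ _ h w) (@shift_continuous N A _)).
have hsg : continuous (h \o (sA \o g)).
  by move=> w; exact: (continuous_comp (sg w) (@homeo_continuous _ _ h _)).
have [q qP] := continuous_agree hsg z (k1 x').
have [n nP] := continuous_agree (@homeo_inv_continuous _ _ h) z p.+1.
exists (l1 x' + maxn n q)%N; right; exists (h (sA x')), (k1 x' + maxn n q)%N.
have Gzy : transpose (conj_rel (prepend_rel i)) z (h (sA x')).
  by split=> //; rewrite homeoK.
split=> //; apply: local_form_intro => //; last first.
  move=> z' y1 y2 [_ G1] [_ G2]; apply: homeo_inv_inj; by rewrite -G1 -G2.
move=> z' zz'; have zz'p := nP _ (agree_le (leq_maxl _ _) zz').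
have [k1E l1E] := pP _ (agree_le (leqnSn _) zz'p).
exists (h (sA (g z'))); split.
- by split; [rewrite -zz'p|rewrite homeoK].
- by apply: qP; apply: agree_le zz'; exact: leq_maxr.
- by rewrite -k1E -l1E (orbit_cocyclesE kl) homeo_invK.
Qed.

End Conjugation.

(** * The transported Cuntz-Krieger family *)

Section Transport.
Variables (R : realType) (N M : nat) (A : 'M[nat]_N) (B : 'M[nat]_M).
Hypotheses (A01 : zero_one_mx A) (A_irr : irreducible_mx A) (N_gt0 : (0 < N)%N).
Hypotheses (B01 : zero_one_mx B) (B_irr : irreducible_mx B)
  (B_nperm : ~~ is_perm_mx B) (M_gt0 : (0 < M)%N).
Variables (OB : cstarType R) (SB : 'I_M -> OB).
Hypothesis SB_CK : CK_family B SB.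
Variable h : homeomorphism (shift_space A) (shift_space B).
Variables k1 l1 : shift_space A -> nat.
Hypothesis kl : orbit_cocycles h k1 l1.
Notation sA := (@shift_map N A).
Notation sB := (@shift_map M B).
Notation g := (homeo_inv h).
Notation XA := (shift_space A).
Notation XB := (shift_space B).
Notation Pb := (prefix_proj SB).

Lemma transported_generators : exists T : 'I_N -> OB,
  forall i, implements SB (T i) (conj_rel h (prepend_rel i)).
Proof.
have ex i := implements_exists SB_CK B01 B_irr M_gt0 (conj_prepend_admissible kl i).
by exists (fun i => sval (cid (ex i))) => i; exact: (svalP (cid (ex i))).
Qed.

Variable T : 'I_N -> OB.
Hypothesis TP : forall i, implements SB (T i) (conj_rel h (prepend_rel i)).

Lemma implements_T_star i :
  implements SB (star (T i)) (transpose (conj_rel h (prepend_rel i))).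
Proof.
apply: (implements_star SB_CK B01 B_irr B_nperm M_gt0 (TP i)).
exact: conj_prepend_transpose_admissible kl i.
Qed.

Let imp_mul := @implements_mul R M B OB SB SB_CK.

Lemma implements_T_range j : implements SB (T j * star (T j))
  (indicator_rel (fun y : XB => mseq (g y) 0 == j)).
Proof.
apply: implements_ext (imp_mul (TP j) (implements_T_star j)) => y z.
split=> [[w [G1 G2]]|[/eqP yj ->]].
  split; first by case: G1 => ->.
  by apply: (@homeo_inv_inj _ _ _ _ h); apply: prepend_rel_inj G2 G1.
by exists (h (sA (g y))); split; split=> //; rewrite homeoK.
Qed.

Lemma implements_T_source i : implements SB (star (T i) * T i)
  (indicator_rel (fun y : XB => A i (mseq (g y) 0) == 1%N)).
Proof.
apply: implements_ext (imp_mul (implements_T_star i) (TP i)) => y z.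
split=> [[w [[wi wy] [_ wz]]]|[/eqP yi ->]].
  split; first by rewrite -wy -wi; apply/eqP; exact: mseqP.
  by apply: (@homeo_inv_inj _ _ _ _ h); rewrite -wy -wz.
have [x [xi xy]] := prepend_exists yi.
by exists (h x); split; split; rewrite homeoK.
Qed.

(** Each relation compares elements that implement the same partial map: the
    ranges of the [T j] are the images of the cylinders of the letters [j], and
    the source of [T i] is the image of the points that [i] may precede. *)
Lemma transported_CK_family : CK_family A T.
Proof.
have range_at y j := implements_indicator SB_CK B01 B_irr B_nperm (implements_T_range j) y.
have uniform_at (y : XB) : exists n, forall k, (n <= k)%N -> forall j,
    T j * star (T j) * Pb y k = Pb y k *+ (mseq (g y) 0 == j).
  exists (\max_j sval (cid (range_at y j)))%N => k nk j.
  apply: (svalP (cid (range_at y j))); apply: leq_trans nk; exact: leq_bigmax.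
split.
- move=> i; apply: (implements_inj SB_CK B01 B_irr B_nperm M_gt0 _ (TP i)).
  apply: implements_ext (imp_mul (implements_T_range i) (TP i)) => y z.
  split=> [[w [G [_ ->]]]//|G]; exists z; split=> //; split=> //.
  by case: G => ->.
- apply: (local_eq SB_CK B01 B_irr M_gt0) => y.
  have [n nP] := uniform_at y; exists n.
  rewrite mul1r mulr_suml (bigD1 (mseq (g y) 0))//= nP// eqxx.
  by rewrite big1 ?addr0// => j jy; rewrite nP// eq_sym (negbTE jy).
- move=> i; apply: (local_eq SB_CK B01 B_irr M_gt0) => y.
  have [n nP] := uniform_at y.
  have [m mP] := implements_indicator SB_CK B01 B_irr B_nperm (implements_T_source i) y.
  exists (maxn m n); rewrite mP ?leq_maxl// mulr_suml (bigD1 (mseq (g y) 0))//=.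
  rewrite mulrnAl nP ?leq_maxr// eqxx big1 ?addr0 => [|j jy].
    by case: (A01 i (mseq (g y) 0)) => ->.
  by rewrite mulrnAl nP ?leq_maxr// eq_sym (negbTE jy) mul0rn.
Qed.

Variables (OA : cstarType R) (SA : 'I_N -> OA).
Hypothesis SA_CK : CK_family A SA.
Variable phi : OA -> OB.
Hypotheses (phi_hom : star_hom phi) (phiS : forall i, phi (SA i) = T i).
Notation WA := (prefix_word SA).
Notation PA := (prefix_proj SA).

Lemma implements_phi_word (z : XA) m : implements SB (phi (WA z m))
  (conj_rel h (fun y' z' => agree m z z' /\ iter m sA z' = y')).
Proof.
elim: m => [|m IH].
  rewrite prefix_word0 (star_hom1 phi_hom).
  apply: implements_ext (@implements_one R M B OB SB) => y z'; split=> [->//|[_]].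
  exact: homeo_inv_inj.
rewrite -addn1 prefix_wordD prefix_word1 (star_homM phi_hom) phiS mseq_iter addn0.
apply: implements_ext (imp_mul IH (TP (mseq z m))) => y z'.
split=> [[w [[w0 wy] [zz' tz']]]|[/agreeD[zz' zz'1] tz']].
  split; last by rewrite addnC iterD tz'.
  apply/agreeD; split=> // i; rewrite ltnS leqn0 => /eqP ->.
  by rewrite tz' w0 mseq_iter addn0.
exists (h (iter m sA (g z'))); split; split; rewrite ?homeoK//.
  by rewrite -zz'1// mseq_iter addn0.
by rewrite -tz' addnC iterD.
Qed.

Lemma implements_phi_word_star (x : XA) n : implements SB (star (phi (WA x n)))
  (conj_rel h (fun y' z' => agree n x y' /\ iter n sA y' = z')).
Proof.
elim: n => [|n IH].
  rewrite prefix_word0 (star_hom1 phi_hom) star1.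
  apply: implements_ext (@implements_one R M B OB SB) => y z'; split=> [->//|[_]].
  by move/homeo_inv_inj.
rewrite -addn1 prefix_wordD prefix_word1 (star_homM phi_hom) phiS mseq_iter addn0 starM.
apply: implements_ext (imp_mul (implements_T_star (mseq x n)) IH) => y z.
split=> [[w [[xy ty] [w0 wz]]]|[/agreeD[xy xy1] ty]].
  split; last by rewrite addnC iterD ty.
  apply/agreeD; split=> // i; rewrite ltnS leqn0 => /eqP ->.
  by rewrite ty w0 mseq_iter addn0.
exists (h (iter n sA (g y))); split; split; rewrite ?homeoK//.
  by rewrite -xy1// mseq_iter addn0.
by rewrite -ty addnC iterD.
Qed.

Lemma implements_phi_unit (z x : XA) m n :
  implements SB (phi (WA z m * star (WA x n))) (conj_rel h (unit_rel z m x n)).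
Proof.
rewrite (star_homM phi_hom) (star_hom_star phi_hom).
apply: implements_ext (imp_mul (implements_phi_word z m) (implements_phi_word_star x n)) => y z'.
split=> [[w [[xy ty] [zz' tz']]]|[xy [zz' t]]]; first by split=> //; rewrite ty.
by exists (h (iter n sA (g y))); split; split; rewrite ?homeoK.
Qed.

Lemma phi_prefix_proj (x : XA) n (y : XB) : exists K, forall k, (K <= k)%N ->
  phi (PA x n) * Pb y k = Pb y k *+ `[< agree n x (g y) >].
Proof.
apply: (implements_indicator SB_CK B01 B_irr B_nperm (D := fun y => `[< agree n x (g y) >])).
apply: implements_ext (implements_phi_unit x x n n) => {}y z.
split=> [[xy [xz t]]|[/asboolP xy ->]]; last by split.
split; first exact/asboolP.
apply: (@homeo_inv_inj _ _ _ _ h); apply: (agree_iter_inj _ t).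
exact: agree_trans (agree_sym xz) xy.
Qed.

(** On the cylinder of [g y] the element [a] is a single prefix exchange, whose
    image is known from the generators, and near [y] the image of the projection
    of that cylinder acts as the identity. *)
Lemma implements_transport a (G : XA -> XA -> Prop) : implements SA a G ->
  implements SB (phi a) (conj_rel h G).
Proof.
move=> aG y; have [n an] := aG (g y).
have [K0 PK] := phi_prefix_proj (g y) n y.
have {}PK k : (K0 <= k)%N -> phi (PA (g y) n) * Pb y k = Pb y k.
  by move=> /PK ->; rewrite asboolT.
have [K1 gK] := continuous_agree (@homeo_inv_continuous _ _ h) y n.
have aPK k : (K0 <= k)%N -> phi a * Pb y k = phi (a * PA (g y) n) * Pb y k.
  by move=> k0; rewrite (star_homM phi_hom) -mulrA PK.
case: an => [[noG aP]|[z [m [Gyz yz aP]]]].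
  exists (maxn K0 K1); left; split.
    move=> y' yy' z'; apply: noG; apply: gK.
    by apply: agree_le yy'; exact: leq_maxr.
  by rewrite aPK ?leq_maxl// aP star_hom0// mul0r.
have [K2 uK] := implements_phi_unit z (g y) m n y.
pose K := maxn (maxn K0 K1) K2; exists K.
have K0K : (K0 <= K)%N by rewrite !leq_max leqnn.
apply: (@germ_congr _ _ _ _ _ (phi (WA z m * star (WA (g y) n)))).
  by rewrite [RHS]aPK// aP.
apply: germ_ext (germ_ge SB_CK (_ : (K2 <= K)%N) uK) => [y' yy' z'|]; last first.
  by rewrite leq_max leqnn orbT.
have ay : agree n (g y) (g y').
  by apply: gK; apply: agree_le yy'; rewrite !leq_max leqnn orbT.
split=> [[_ H]|/(yz _ ay) H]; last by split.
by apply/(yz _ ay).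
Qed.

End Transport.

(** * Continuity and limits of complex values *)

Section ComplexLimits.
Variable R : realType.

Lemma continuous_complexP (N : nat) (A : 'M[nat]_N) (f : shift_space A -> R[i]^o) :
  continuous f <-> forall x (e : R), 0 < e ->
    exists n, forall y, agree n x y -> normc (f y - f x) <= e.
Proof.
split=> [cf x e e0|fP x]; have FF : Filter (nbhs x) := @nbhs_filter _ x.
  have /cvgrPdist_le/(_ e%:C) := cf x; rewrite ltcR => /(_ e0).
  move/nbhs_agree => [n nP]; exists n => y /nP.
  rewrite -lecR -[X in _ -> X <= _]/(`|f y - f x|) distrC; exact.
apply/cvgrPdist_le => e e0.
have [r r0 er] : exists2 r : R, 0 < r & e = r%:C.
  case: e e0 => a b; rewrite ltcE /= => /andP[/eqP -> a0]; exists a => //.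
have [n nP] := fP x _ r0; apply/nbhs_agree; exists n => y /nP.
by rewrite er -lecR -[X in X <= _ -> _]/(`|f y - f x|) distrC.
Qed.

Lemma normc_ge_Re (z : R[i]) : `|complex.Re z| <= normc z.
Proof.
by case: z => a b /=; rewrite -sqrtr_sqr ler_wsqrtr// lerDl sqr_ge0.
Qed.

Lemma normc_ge_Im (z : R[i]) : `|complex.Im z| <= normc z.
Proof.
by case: z => a b /=; rewrite -sqrtr_sqr ler_wsqrtr// lerDr sqr_ge0.
Qed.

Lemma normc_le_ReIm (z : R[i]) : normc z <= `|complex.Re z| + `|complex.Im z|.
Proof.
case: z => a b /=; rewrite -[leRHS]ger0_norm ?addr_ge0// -sqrtr_sqr ler_wsqrtr//.
by rewrite sqrrD !real_normK ?num_real// lerD2r lerDl mulrn_wge0// mulr_ge0.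
Qed.

Lemma real_cauchy (u : nat -> R) :
    (forall e : R, 0 < e -> exists n0, forall m n, (n0 <= m)%N -> (n0 <= n)%N -> `|u m - u n| <= e) ->
  exists l, forall e : R, 0 < e -> exists n0, forall n, (n0 <= n)%N -> `|u n - l| <= e.
Proof.
move=> uC; have : cvg (u @ \oo).
  apply/cauchy_cvgP/cauchy_exP => e e0; have e2 : 0 < e / 2 by rewrite divr_gt0.
  have [n0 n0P] := uC _ e2; exists (u n0); exists n0 => // n /= n0n.
  by rewrite /ball/= (le_lt_trans (n0P _ _ _ n0n))// ltr_pdivrMr// ltr_pMr// ltr1n.
move=> /cvgrPdist_le ul; exists (lim (u @ \oo)) => e /ul[n0 _ n0P].
by exists n0 => n /n0P; rewrite distrC.
Qed.

Lemma complex_cauchy (u : nat -> R[i]) :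
    (forall e : R, 0 < e -> exists n0, forall m n, (n0 <= m)%N -> (n0 <= n)%N ->
       normc (u m - u n) <= e) ->
  exists l, forall e : R, 0 < e -> exists n0, forall n, (n0 <= n)%N ->
    normc (u n - l) <= e.
Proof.
move=> uC.
have [a aP] : exists l, forall e : R, 0 < e -> exists n0, forall n, (n0 <= n)%N ->
    `|complex.Re (u n) - l| <= e.
  apply: real_cauchy => e /uC[n0 n0P]; exists n0 => m n m0 nn0.
  apply: le_trans (n0P m n m0 nn0); apply: le_trans (normc_ge_Re _).
  by case: (u m) (u n) => [? ?] [? ?].
have [b bP] : exists l, forall e : R, 0 < e -> exists n0, forall n, (n0 <= n)%N ->
    `|complex.Im (u n) - l| <= e.
  apply: real_cauchy => e /uC[n0 n0P]; exists n0 => m n m0 nn0.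
  apply: le_trans (n0P m n m0 nn0); apply: le_trans (normc_ge_Im _).
  by case: (u m) (u n) => [? ?] [? ?].
exists (a +i* b) => e e0; have e2 : 0 < e / 2 by rewrite divr_gt0.
have [m mP] := aP _ e2; have [n nP] := bP _ e2.
exists (maxn m n) => k; rewrite geq_max => /andP[/mP h1 /nP h2].
apply: le_trans (normc_le_ReIm _) _; rewrite [leRHS]splitr.
by apply: lerD; [move: h1|move: h2]; case: (u k).
Qed.

End ComplexLimits.

(** * The norm on the diagonal subalgebra *)

Section Diagonal.
Variables (R : realType) (N : nat) (A : 'M[nat]_N) (O : cstarType R) (S : 'I_N -> O).
Hypothesis S_CK : CK_family A S.
Hypotheses (A01 : zero_one_mx A) (A_irr : irreducible_mx A).
Hypothesis (N_gt0 : (0 < N)%N).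
Notation X := (shift_space A).
Notation sigma := (@shift_map N A).
Notation W := (prefix_word S).
Notation P := (prefix_proj S).

Lemma cnorm_scale1 (z : R[i]) : cnorm (z *: (1 : O)) = normc z.
Proof. by rewrite cnormZ cnorm1 mulr1. Qed.

Lemma normc_ge0 (z : R[i]) : 0 <= normc z.
Proof. by rewrite -cnorm_scale1 cnorm_ge0. Qed.

Lemma normcD (z w : R[i]) : normc (z + w) <= normc z + normc w.
Proof. by rewrite -!cnorm_scale1 scalerDl cnormD. Qed.

Lemma normc_distC (z w : R[i]) : normc (z - w) = normc (w - z).
Proof. by rewrite -!cnorm_scale1 !scalerBl cnorm_distC. Qed.

Lemma CK_diag_cstar : cstar_subalgebra (CK_diag S).
Proof. exact: cstar_generated_cstar. Qed.

Lemma CK_diag_proj mu : CK_diag S (CK_proj S mu).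
Proof. by move=> D [_ GD]; apply: GD; exists mu. Qed.

Lemma CK_diag_prefix (x : X) n : CK_diag S (P x n).
Proof. exact: CK_diag_proj. Qed.

Lemma CK_diag_comm d : CK_diag S d -> forall (x : X) n, d * P x n = P x n * d.
Proof.
move=> dD x n; suff : CK_diag S `<=` [set d | forall (x : X) n, d * P x n = P x n * d].
  by move=> /(_ _ dD).
have scal0 (a : R[i]) (y : O) : a *: y = (a *: 1) * y by rewrite -scalerAl mul1r.
apply: cstar_generated_sub => [|_ [mu _ <-]].
  split=> /=.
  - by move=> y m; rewrite mul0r mulr0.
  - by move=> a b aP bP y m; rewrite mulrDl mulrDr aP bP.
  - by move=> a b bP y m; rewrite -scalerAl -scalerAr bP.
  - by move=> a b aP bP y m; rewrite -mulrA bP mulrA aP mulrA.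
  - move=> a aP y m; rewrite -(prefix_proj_star S) -!starM.
    by rewrite aP.
  - move=> u a uP /ccvgP ua y m; apply: (ccvg_unique (u := fun k => u k * P y m)).
      apply: (@ccvg_lipschitz _ _ _ (fun z => z * P y m) (cnorm (P y m)) u a _ ua).
      by move=> z; rewrite -mulrBl mulrC; apply: cnormM.
    rewrite (_ : (fun k => _) = (fun k => P y m * u k)); last by apply/funext.
    apply: (@ccvg_lipschitz _ _ _ (fun z => P y m * z) (cnorm (P y m)) u a _ ua).
    by move=> z; rewrite -mulrBr; apply: cnormM.
move=> y m.
have [E|] := eqVneq (CK_word S mu) 0; first by rewrite /CK_proj E !mul0r mulr0.
move=> /eqP/(CK_word_realized S_CK A01 A_irr N_gt0)[z zE].
rewrite -zE -[CK_proj S _]/(P z (size mu)).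
have comm (x1 x2 : X) n1 n2 : (n1 <= n2)%N -> P x1 n1 * P x2 n2 = P x2 n2 * P x1 n1.
  move=> n12; have [ag|nag] := pselect (agree n1 x1 x2).
    by rewrite (prefix_proj_agree S ag) (prefix_projM S_CK)// (prefix_projMr S_CK).
  rewrite (prefix_proj_disjointr S_CK nag n12) mulrA.
  by rewrite (prefix_proj_disjoint S_CK nag n12) mul0r.
case: (leqP (size mu) m) => [|/ltnW] le; first exact: comm.
by apply/esym; exact: comm.
Qed.

Lemma mul_prefix_norm_le a (x : X) m n C : (m <= n)%N -> cnorm (a * P x m) <= C ->
  cnorm (a * P x n) <= C.
Proof.
move=> mn; apply: le_trans; rewrite -(prefix_projM S_CK x mn) mulrA.
apply: le_trans (cnormM _ _) _.
by rewrite (prefix_proj_norm S_CK A01 A_irr) mulr1.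
Qed.

Lemma cnorm_pow2 (w : O) : star w = w -> forall k, cnorm (w ^+ (2 ^ k)) = cnorm w ^+ (2 ^ k).
Proof.
move=> ws; elim=> [|k IH]; first by rewrite !expr1.
have wks m : star (w ^+ m) = w ^+ m.
  elim: m => [|m IHm]; first by rewrite expr0 star1.
  by rewrite exprS starM IHm ws -exprSr exprS.
by rewrite expnSr !exprM !expr2 -{1}(wks (2 ^ k)%N) cnorm_starM IH expr2.
Qed.

Lemma power_bound (r K : R) : 0 <= r -> (forall k, r ^+ (2 ^ k) <= K) -> r <= 1.
Proof.
move=> r0 rK; rewrite leNgt; apply/negP => r1.
have r10 : 0 < r - 1 by rewrite subr_gt0.
have bern n : 1 + n%:R * (r - 1) <= r ^+ n.
  elim: n => [|n IH]; first by rewrite mul0r addr0 expr0.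
  rewrite exprS -natr1; apply: le_trans (ler_wpM2l r0 IH).
  rewrite -subr_ge0.
  have -> : r * (1 + n%:R * (r - 1)) - (1 + (n%:R + 1) * (r - 1)) =
      n%:R * (r - 1) ^+ 2 by ring.
  by rewrite mulr_ge0// sqr_ge0.
pose n := Num.bound (K / (r - 1)).
have K0 : 0 <= K by apply: le_trans (rK 0%N); rewrite exprn_ge0.
have nK : K / (r - 1) < n%:R by apply: archi_boundP; rewrite divr_ge0// ltW.
have := rK n; apply/negP; rewrite -ltNge.
have le2 : n%:R * (r - 1) <= (2 ^ n)%:R * (r - 1).
  by rewrite ler_pM2r// ler_nat ltnW// ltn_expl.
apply: lt_le_trans (bern _); rewrite ltr_pdivrMr// in nK.
lra.
Qed.

(** For self-adjoint [w] the norm of [w ^+ (2 ^ k)] is the corresponding power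
    of the norm of [w].  Summing over the [K] cylinders of length [n] bounds it
    by [K] times the same power of the local bound, and the factor [K]
    disappears on taking roots. *)
Lemma CK_diag_norm_le d n C : CK_diag S d -> (forall x : X, cnorm (d * P x n) <= C) ->
  cnorm d <= C.
Proof.
move=> dD dC.
have C0 : 0 <= C.
  have [x _] := point_inhabited A01 A_irr N_gt0; apply: le_trans (dC x); exact: cnorm_ge0.
apply/ler_addgt0Pr => e e0; have Ce0 : 0 < C + e by rewrite ltr_wpDl.
pose w := star d * d.
have wD : CK_diag S w.
  have DC := CK_diag_cstar; apply: (cstar_subM DC) => //; exact: (cstar_sub_star DC).
have ws : star w = w by rewrite starM starK.
have wP (x : X) m : w ^+ m.+1 * P x n = (w * P x n) ^+ m.+1.
  rewrite exprMn_comm; last exact: CK_diag_comm.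
  congr (_ * _); elim: m => [|m IH]; first by rewrite expr1.
  by rewrite exprS -IH (prefix_projM S_CK).
have wC (x : X) : cnorm (w * P x n) <= (C + e) ^+ 2.
  have -> : w * P x n = star (d * P x n) * (d * P x n).
    rewrite starM (prefix_proj_star S) mulrA -(mulrA (P x n)) -/w -(CK_diag_comm wD).
    by rewrite -mulrA (prefix_projM S_CK).
  rewrite cnorm_starM ler_pXn2r ?nnegrE ?cnorm_ge0 ?(ltW Ce0)//.
  by apply: le_trans (dC x) _; rewrite lerDl ltW.
pose K : R := \sum_(mu : n.-tuple 'I_N) 1.
have wK m : cnorm (w ^+ m.+1) <= K * ((C + e) ^+ 2) ^+ m.+1.
  rewrite -[w ^+ _]mulr1 -(CK_proj_sum S_CK n) mulr_sumr /K mulr_suml.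
  apply: le_trans (cnorm_sum _ _ _) _; apply: ler_sum => mu _; rewrite mul1r.
  have [E|] := eqVneq (CK_word S mu) 0.
    by rewrite /CK_proj E mul0r mulr0 cnorm0 exprn_ge0// exprn_ge0// ltW.
  move=> /eqP/(CK_word_realized S_CK A01 A_irr N_gt0)[z]; rewrite size_tuple => <-.
  rewrite -[CK_proj S _]/(P z n) wP.
  elim: m => [|m IH]; first by rewrite !expr1.
  rewrite exprS [leRHS]exprS; apply: le_trans (cnormM _ _) _.
  by apply: ler_pM; rewrite ?cnorm_ge0.
rewrite -(ler_pXn2r (n := 2)) ?nnegrE ?cnorm_ge0 ?(ltW Ce0)// -cnorm_starM -/w.
have C2 : 0 < (C + e) ^+ 2 by rewrite exprn_gt0.
rewrite -[leRHS]mul1r -ler_pdivrMr//.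
apply: (@power_bound _ K) => [|k]; first by rewrite divr_ge0 ?cnorm_ge0// ltW.
rewrite expr_div_n ler_pdivrMr ?exprn_gt0//.
have := wK (2 ^ k).-1; rewrite prednK ?expn_gt0//.
by rewrite cnorm_pow2.
Qed.

End Diagonal.

(** * The diagonal subalgebra as continuous functions *)

Section DiagValue.
Variables (R : realType) (N : nat) (A : 'M[nat]_N) (O : cstarType R) (S : 'I_N -> O).
Hypothesis S_CK : CK_family A S.
Hypotheses (A01 : zero_one_mx A) (A_irr : irreducible_mx A).
Hypothesis (N_gt0 : (0 < N)%N).
Notation X := (shift_space A).
Notation sigma := (@shift_map N A).
Notation P := (prefix_proj S).
Implicit Types (d : O) (f g : X -> R[i]).

(** The function [f] corresponds to [d] under the identification of the diagonal
    with continuous functions: on the cylinders that shrink to [x], the element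
    [d] acts in the limit as the scalar [f x]. *)
Definition diag_value d f := CK_diag S d /\ forall x (e : R), 0 < e ->
  exists n, cnorm ((d - f x *: 1) * P x n) <= e.

Let norm_le := mul_prefix_norm_le S_CK A01 A_irr.
Let DC : cstar_subalgebra (CK_diag S) := CK_diag_cstar S.

Lemma scale1_mul (a : R[i]) d : (a *: 1) * d = a *: d.
Proof. by rewrite -scalerAl mul1r. Qed.

Lemma diag_valueD d d' f g : diag_value d f -> diag_value d' g ->
  diag_value (d + d') (fun x => f x + g x).
Proof.
move=> [dD df] [d'D d'g]; split; first exact: (cstar_subD DC).
move=> x e e0; have e2 : 0 < e / 2 by rewrite divr_gt0.
have [m mP] := df x _ e2; have [n nP] := d'g x _ e2.
exists (maxn m n); rewrite scalerDl opprD addrACA mulrDl.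
apply: le_trans (cnormD _ _) _; rewrite [leRHS]splitr; apply: lerD.
  by apply: norm_le mP; exact: leq_maxl.
by apply: norm_le nP; exact: leq_maxr.
Qed.

Lemma diag_valueM d d' f g : diag_value d f -> diag_value d' g ->
  diag_value (d * d') (fun x => f x * g x).
Proof.
move=> [dD df] [d'D d'g]; split; first exact: (cstar_subM DC).
move=> x e e0; have g0 := normc_ge0 O (g x); have d0 := cnorm_ge0 d.
pose C := cnorm d + normc (g x) + 1; have C0 : 0 < C by rewrite /C; lra.
have eC : 0 < e / C by rewrite divr_gt0.
have [m mP] := df x _ eC; have [n nP] := d'g x _ eC.
exists (maxn m n).
have -> : d * d' - (f x * g x) *: 1 = d * (d' - g x *: 1) + g x *: (d - f x *: 1).
  by rewrite mulrBr scalerBr scalerA [g x * _]mulrC -scalerAr mulr1 addrA addrNK.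
rewrite mulrDl -mulrA -scalerAl.
have h1 := norm_le (leq_maxr m n) nP; have h2 := norm_le (leq_maxl m n) mP.
apply: le_trans (cnormD _ _) _.
have h3 : cnorm (d * ((d' - g x *: 1) * P x (maxn m n))) <= cnorm d * (e / C).
  by apply: le_trans (cnormM _ _) _; rewrite ler_wpM2l.
have h4 : cnorm (g x *: ((d - f x *: 1) * P x (maxn m n))) <= normc (g x) * (e / C).
  by rewrite cnormZ ler_wpM2l.
apply: le_trans (lerD h3 h4) _; rewrite -mulrDl mulrA ler_pdivrMr// mulrC.
by rewrite ler_pM2l// lerDl.
Qed.

Lemma diag_value_cst (a : R[i]) : diag_value (a *: 1) (fun=> a).
Proof.
split.
  apply: (cstar_subZ DC); have := @CK_diag_proj R N O S [::].
  by rewrite /CK_proj /CK_word big_nil star1 mulr1.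
by move=> x e e0; exists 0%N; rewrite subrr mul0r cnorm0 ltW.
Qed.

Lemma diag_valueZ (a : R[i]) d f : diag_value d f -> diag_value (a *: d) (fun x => a * f x).
Proof. by move=> df; rewrite -scale1_mul; apply: diag_valueM => //; exact: diag_value_cst. Qed.

Lemma diag_valueB d d' f g : diag_value d f -> diag_value d' g ->
  diag_value (d - d') (fun x => f x - g x).
Proof.
move=> df dg; rewrite -scaleN1r; have := diag_valueD df (diag_valueZ (-1) dg).
by rewrite (_ : (fun x => f x - g x) = (fun x => f x + -1 * g x))//; apply/funext => x; rewrite mulN1r.
Qed.

Lemma diag_value_star d f : diag_value d f -> diag_value (star d) (fun x => conjc (f x)).
Proof.
move=> [dD df]; split; first exact: (cstar_sub_star DC).
move=> x e /(df x)[n nP]; exists n.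
have -> : star d - conjc (f x) *: 1 = star (d - f x *: 1) by rewrite starB starZ star1.
rewrite -(prefix_proj_star S x n) -starM cnorm_star.
by rewrite mulrBr -(CK_diag_comm S_CK A01 A_irr N_gt0 dD) -scalerAr mulr1
  -scale1_mul -mulrBl.
Qed.

Lemma diag_value_norm_ge d f x : diag_value d f -> normc (f x) <= cnorm d.
Proof.
move=> [_ df]; apply/ler_addgt0Pr => e /(df x)[n nP].
rewrite -[normc _]mulr1 -(prefix_proj_norm S_CK A01 A_irr x n) -cnormZ.
have -> : f x *: P x n = d * P x n - (d - f x *: 1) * P x n.
  by rewrite mulrBl scale1_mul opprB addrCA subrr addr0.
apply: le_trans (cnormB _ _) _; apply: lerD => //.
apply: le_trans (cnormM _ _) _; by rewrite (prefix_proj_norm S_CK A01 A_irr) mulr1.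
Qed.

(** Up to [e] the bound holds on small cylinders, which have bounded length by
    compactness, and [CK_diag_norm_le] makes it global. *)
Lemma diag_value_norm_le d f C : diag_value d f -> (forall x, normc (f x) <= C) ->
  cnorm d <= C.
Proof.
move=> [dD df] fC; apply/ler_addgt0Pr => e e0.
have [||x|L LP] := @fan _ A (fun x n => cnorm (d * P x n) <= C + e).
- by move=> x n; apply: norm_le.
- by move=> x y n xy; rewrite (prefix_proj_agree S xy).
- have [n nP] := df x _ e0; exists n.
  have -> : d * P x n = f x *: P x n + (d - f x *: 1) * P x n.
    by rewrite mulrBl scale1_mul addrC subrK.
  apply: le_trans (cnormD _ _) _; apply: lerD => //.
  by rewrite cnormZ (prefix_proj_norm S_CK A01 A_irr) mulr1.
exact: (CK_diag_norm_le S_CK A01 A_irr N_gt0 dD LP).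
Qed.

Lemma diag_value_unique d d' f : diag_value d f -> diag_value d' f -> d = d'.
Proof.
move=> df d'f; apply/eqP; rewrite -subr_eq0; apply/eqP/cnorm_le0 => e e0.
apply: le_trans (ltW e0); apply: (diag_value_norm_le (diag_valueB df d'f)) => x.
by rewrite subrr ComplexField.Normc.normc0.
Qed.

Lemma diag_value_inj d f g : diag_value d f -> diag_value d g -> f = g.
Proof.
move=> df dg; apply/funext => x; apply/eqP; rewrite -subr_eq0; apply/eqP.
apply: ComplexField.Normc.eq0_normc; apply/eqP; rewrite eq_le (normc_ge0 O) andbT.
by rewrite -[leRHS](cnorm0 O) -(subrr d) (diag_value_norm_ge x (diag_valueB df dg)).
Qed.

Lemma diag_value_continuous d f : diag_value d f -> continuous (f : X -> R[i]^o).
Proof.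
move=> [_ df]; apply/continuous_complexP => x e e0.
have e2 : 0 < e / 2 by rewrite divr_gt0.
have [n nP] := df x _ e2; exists n => y xy; have [m mP] := df y _ e2.
rewrite (prefix_proj_agree S xy) in nP.
have h1 := norm_le (leq_maxl n m) nP; have h2 := norm_le (leq_maxr n m) mP.
rewrite -[normc _]mulr1 -(prefix_proj_norm S_CK A01 A_irr y (maxn n m)) -cnormZ.
have -> : (f y - f x) *: P y (maxn n m) =
    (d - f x *: 1) * P y (maxn n m) - (d - f y *: 1) * P y (maxn n m).
  rewrite -mulrBl -scale1_mul scalerBl; congr (_ * _).
  by rewrite opprB [RHS]addrC addrA addrNK.
by apply: le_trans (cnormB _ _) _; rewrite [leRHS]splitr; apply: lerD.
Qed.

Lemma diag_value_cylinder mu :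
  diag_value (CK_proj S mu) (fun x => (x \in cylinder A mu)%:R).
Proof.
split; first exact: CK_diag_proj.
move=> x e e0; exists (size mu).
suff E : CK_proj S mu * P x (size mu) = (x \in cylinder A mu)%:R *: P x (size mu).
  by rewrite mulrBl E scale1_mul subrr cnorm0 ltW.
have [xmu|xmu] := pselect (mkseq (mseq x) (size mu) = mu).
  rewrite (_ : x \in cylinder A mu); last exact/mem_set.
  by rewrite scale1r -{1}xmu (prefix_projM S_CK).
rewrite (_ : x \in cylinder A mu = false); last by apply/negbTE/negP => /set_mem.
rewrite scale0r -mulrA [star _ * (_ * _)]mulrA (words_orthogonal S_CK).
- by rewrite mul0r mulr0.
- by rewrite size_mkseq.
- by move/esym.
Qed.

Lemma diag_value_limit (u : nat -> O) d : (forall k, exists f, diag_value (u k) f) ->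
  ccvg u d -> exists f, diag_value d f.
Proof.
move=> uf ud; pose f k := sval (cid (uf k)).
have fP k : diag_value (u k) (f k) := svalP (cid (uf k)).
have lim x : exists l, forall e : R, 0 < e -> exists n0, forall n, (n0 <= n)%N ->
    normc (f n x - l) <= e.
  apply: complex_cauchy => e e0; have e2 : 0 < e / 2 by rewrite divr_gt0.
  have [n0 n0P] := ud _ e2; exists n0 => m n m0 nn0.
  apply: le_trans (diag_value_norm_ge x (diag_valueB (fP m) (fP n))) _.
  have -> : u m - u n = (u m - d) - (u n - d) by rewrite opprB addrA addrNK.
  apply: le_trans (cnormB _ _) _; rewrite [leRHS]splitr.
  by apply: lerD; exact: n0P.
exists (fun x => sval (cid (lim x))); split.
  by apply: (cstar_sub_closed DC (u := u)); [move=> k; exact: (fP k).1|apply/ccvgP].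
move=> x e e0; have e3 : 0 < e / 3 by rewrite divr_gt0.
case: cid => l lP /=; have [n0 n0P] := lP _ e3; have [n1 n1P] := ud _ e3.
pose k := maxn n0 n1.
have h1 := n0P k (leq_maxl _ _); have h2 := n1P k (leq_maxr _ _).
have [n h3] := (fP k).2 x _ e3; exists n.
have -> : (d - l *: 1) * P x n = (u k - f k x *: 1) * P x n - (u k - d) * P x n
    + (f k x - l) *: P x n.
  rewrite -scale1_mul -mulrBl -mulrDl; congr (_ * _).
  rewrite opprB scalerBl addrA [u k - _ + _]addrC addrA addrNK.
  by rewrite addrNK.
apply: le_trans (cnormD _ _) _.
rewrite cnormZ (prefix_proj_norm S_CK A01 A_irr) mulr1.
have := cnormB ((u k - f k x *: 1) * P x n) ((u k - d) * P x n).
have : cnorm ((u k - d) * P x n) <= e / 3.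
  by apply: le_trans (cnormM _ _) _; rewrite (prefix_proj_norm S_CK A01 A_irr) mulr1.
lra.
Qed.

(** A continuous function is a uniform limit of step functions, and these come
    from elements glued from scalars. *)
Lemma diag_value_exists f : continuous (f : X -> R[i]^o) -> exists d, diag_value d f.
Proof.
move=> /continuous_complexP cf.
have step (e : R) : 0 < e -> exists d n, CK_diag S d /\
    forall x, cnorm ((d - f x *: 1) * P x n) <= e.
  move=> e0.
  have [||x|L LP] := @fan _ A (fun x n => forall y z, agree n x y -> agree n x z ->
    normc (f y - f z) <= e).
  - by move=> x n xP y z xy xz; apply: xP; apply: agree_le; eauto.
  - by move=> x y n xy xP z w yz yw; apply: xP; apply: agree_trans; eauto.
  - have e2 : 0 < e / 2 by rewrite divr_gt0.
    have [n nP] := cf x _ e2; exists n => y z xy xz.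
    have -> : f y - f z = (f y - f x) + (f x - f z) by rewrite addrA addrNK.
    apply: le_trans (normcD O _ _) _; rewrite (normc_distC O (f x)) [leRHS]splitr.
    by apply: lerD; exact: nP.
  have [d dP] := glue_exists S_CK A01 A_irr N_gt0 (fun y => f y *: 1) L.
  exists d, L; split.
    apply: (local_prop S_CK A01 A_irr N_gt0) => [x y||x n dPn|x].
    - exact: (cstar_subD DC).
    - exact: (cstar_sub0 DC).
    - rewrite -(prefix_projM S_CK x (leqnSn n)) mulrA; apply: (cstar_subM DC) => //.
      exact: CK_diag_prefix.
    - exists L; have [y [_ ->]] := dP x; rewrite scale1_mul.
      by apply: (cstar_subZ DC); exact: CK_diag_prefix.
  move=> x; have [y [xy dE]] := dP x.
  rewrite mulrBl dE -mulrBl -scalerBl scale1_mul cnormZ (prefix_proj_norm S_CK A01 A_irr) mulr1.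
  by apply: (LP x).
have inv0 k : 0 < k.+1%:R^-1 :> R by rewrite invr_gt0.
pose d k := sval (cid (step _ (inv0 k))).
pose lev k := sval (cid (svalP (cid (step _ (inv0 k))))).
have dlev k : CK_diag S (d k) /\ forall x, cnorm ((d k - f x *: 1) * P x (lev k)) <= k.+1%:R^-1.
  exact: (svalP (cid (svalP (cid (step _ (inv0 k)))))).
have small (e : R) : 0 < e -> exists n0 : nat, forall n, (n0 <= n)%N -> n.+1%:R^-1 <= e.
  move=> e0; exists (Num.bound e^-1) => n nb.
  rewrite -[leRHS]invrK lef_pV2 ?posrE ?invr_gt0//.
  apply: le_trans (ltW (archi_boundP _)) _; first by rewrite ltW// invr_gt0.
  by rewrite ler_nat ltnW.
have [|l /ccvgP dl] := @cnorm_complete _ _ d.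
  move=> e e0; have e4 : 0 < e / 4 by rewrite divr_gt0.
  have [n0 n0P] := small _ e4; exists n0 => m n m0 nn0.
  apply: (@le_lt_trans _ _ (e / 4 + e / 4)); last by lra.
  have DB : CK_diag S (d m - d n).
    rewrite -scaleN1r; apply: (cstar_subD DC); first exact: (dlev m).1.
    by apply: (cstar_subZ DC); exact: (dlev n).1.
  apply: (CK_diag_norm_le S_CK A01 A_irr N_gt0 (n := maxn (lev m) (lev n)) DB) => x.
  have -> : d m - d n = (d m - f x *: 1) - (d n - f x *: 1) by rewrite opprB addrA addrNK.
  rewrite mulrBl; apply: le_trans (cnormB _ _) _; apply: lerD.
    by apply: norm_le (leq_maxl _ _) _; apply: le_trans ((dlev m).2 x) (n0P _ _).
  by apply: norm_le (leq_maxr _ _) _; apply: le_trans ((dlev n).2 x) (n0P _ _).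
exists l; split.
  by apply: (cstar_sub_closed DC (u := d)); [move=> k; exact: (dlev k).1|apply/ccvgP].
move=> x e e0; have e2 : 0 < e / 2 by rewrite divr_gt0.
have [n0 n0P] := small _ e2; have [n1 n1P] := dl _ e2.
pose k := maxn n0 n1; exists (lev k).
have -> : l - f x *: 1 = (d k - f x *: 1) - (d k - l).
  by rewrite opprB [RHS]addrC addrA addrNK.
rewrite mulrBl; apply: le_trans (cnormB _ _) _; rewrite [leRHS]splitr; apply: lerD.
  by apply: le_trans ((dlev k).2 x) (n0P _ _); exact: leq_maxl.
apply: le_trans (cnormM _ _) _; rewrite (prefix_proj_norm S_CK A01 A_irr) mulr1.
by apply: n1P; exact: leq_maxr.
Qed.

End DiagValue.

(** * Phases *)

Section Expi.
Variable R : realType.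

Lemma expiD (a b : R) : expi (a + b) = expi a * expi b.
Proof.
rewrite /expi cosD sinD; apply/eqP; rewrite eq_complex /= eqxx /=.
by apply/eqP; ring.
Qed.

Lemma expi0 : expi (0 : R) = 1.
Proof. by rewrite /expi cos0 sin0. Qed.

Lemma conjc_expi (a : R) : conjc (expi a) = expi (- a).
Proof. by rewrite /expi cosN sinN. Qed.

Definition character (t : R) (v : int) : R[i] := expi (2 * pi * t * v%:~R).

Lemma characterD t v w : character t (v + w) = character t v * character t w.
Proof. by rewrite /character -expiD rmorphD mulrDr. Qed.

Lemma characterN t v : conjc (character t v) = character t (- v).
Proof. by rewrite /character conjc_expi rmorphN mulrN. Qed.

Lemma character0 t : character t 0 = 1.
Proof. by rewrite /character mulr0 expi0. Qed.

Lemma character_opp t v : character (- t) v = character t (- v).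
Proof. by rewrite /character rmorphN !mulrN mulNr. Qed.

End Expi.

(** * Gauge unitaries and gauge actions *)

Section Gauge.
Variables (R : realType) (N : nat) (A : 'M[nat]_N) (O : cstarType R) (S : 'I_N -> O).
Hypothesis S_CK : CK_family A S.
Hypotheses (A01 : zero_one_mx A) (A_irr : irreducible_mx A).
Hypothesis (N_gt0 : (0 < N)%N).
Notation X := (shift_space A).
Notation sigma := (@shift_map N A).
Notation P := (prefix_proj S).
Notation W := (prefix_word S).

(** The relation [diag_value] is the graph of such an identification; its
    domain is all of the diagonal because the elements that have values form a
    closed subalgebra. *)
Lemma diag_idP : diag_identification S (@diag_id R N A O S).
Proof.
pose iota (f : X -> R[i]^o) : O := xget 0 [set d | diag_value S d f].
have iotaE d (f : X -> R[i]^o) : diag_value S d f -> iota f = d.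
  move=> df; apply: (diag_value_unique S_CK A01 A_irr N_gt0 _ df).
  exact: (@xgetI _ 0 [set d | diag_value S d f] d df).
have iotaP (f : X -> R[i]^o) : continuous f -> diag_value S (iota f) f.
  by move=> /(diag_value_exists S_CK A01 A_irr N_gt0)[d df]; rewrite (iotaE _ _ df).
suff : diag_identification S iota.
  by move=> iotaI; apply: (@xgetPex _ _ [set iota | diag_identification S iota]); exists iota.
split.
- by move=> f g /iotaP df /iotaP dg; apply: iotaE; exact: diag_valueD.
- by move=> a f /iotaP df; apply: iotaE; exact: diag_valueZ.
- by move=> f g /iotaP df /iotaP dg; apply: iotaE; exact: diag_valueM.
- by move=> f /iotaP df; apply: iotaE; exact: diag_value_star.
- move=> f g /iotaP df /iotaP dg fg; rewrite fg in df.
  exact: (diag_value_inj S_CK A01 A_irr df dg).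
- apply/seteqP; split=> [_ [f /iotaP[dD _] <-] //|d dD].
  have [f df] : exists f : X -> R[i]^o, diag_value S d f.
    have : CK_diag S `<=` [set d | exists f : X -> R[i], diag_value S d f].
      apply: cstar_generated_sub => [|_ [mu _ <-]]; last first.
        by exists (fun x => (x \in cylinder A mu)%:R); exact: diag_value_cylinder.
      split=> /=.
      + by exists (fun=> 0); rewrite -(scale0r 1); exact: diag_value_cst.
      + by move=> x y [f xf] [g yg]; exists (fun x => f x + g x); exact: diag_valueD.
      + by move=> a x [f xf]; exists (fun x => a * f x); exact: diag_valueZ.
      + by move=> x y [f xf] [g yg]; exists (fun x => f x * g x); exact: diag_valueM.
      + by move=> x [f xf]; exists (fun x => conjc (f x)); exact: diag_value_star.
      + by move=> u x uf /ccvgP; exact: (diag_value_limit S_CK A01 A_irr).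
    exact.
  exists f; last exact: iotaE.
  exact: (diag_value_continuous S_CK A01 A_irr df).
- move=> mu; apply: iotaE.
  rewrite (_ : \1_(cylinder A mu) = (fun x : X => (x \in cylinder A mu)%:R)).
    exact: diag_value_cylinder.
  by apply/funext => x; rewrite indicE.
Qed.

Lemma continuous_locally_constant (F : X -> R[i]^o) :
  (forall x, exists n, forall y, agree n x y -> F y = F x) -> continuous F.
Proof.
move=> Floc; apply/continuous_complexP => x e e0; have [n nP] := Floc x.
by exists n => y /nP ->; rewrite subrr ComplexField.Normc.normc0 ltW.
Qed.

Lemma continuous_cylinder mu : continuous (\1_(cylinder A mu) : X -> R[i]^o).
Proof.
apply: continuous_locally_constant => x; exists (size mu) => y xy.
rewrite !indicE; congr ((_ : bool)%:R).
suff E : mkseq (mseq y) (size mu) = mkseq (mseq x) (size mu).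
  by apply/idP/idP => /set_mem H; apply/mem_set; move: H; rewrite /cylinder/= E.
by apply/eq_in_map => i; rewrite mem_iota add0n => /xy.
Qed.

(** Multiplication by the indicator of a cylinder on which [F] is constant
    reduces this to the algebraic properties of the identification. *)
Lemma diag_id_local (F : X -> R[i]^o) (x : X) n :
    (forall x, exists n, forall y, agree n x y -> F y = F x) ->
    (forall y, agree n x y -> F y = F x) ->
  diag_id S F * P x n = F x *: P x n.
Proof.
move=> Floc Fx; have I := diag_idP; have cF := continuous_locally_constant Floc.
pose mu := mkseq (mseq x) n; have PE : P x n = diag_id S \1_(cylinder A mu).
  by rewrite (diag_id_cylinder I).
rewrite PE -(diag_idM I cF (@continuous_cylinder mu)).
rewrite -(diag_idZ I _ (@continuous_cylinder mu)); congr (diag_id S _).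
apply/funext => y; rewrite indicE.
have [|_] := boolP (y \in cylinder A mu); last by rewrite !mulr0.
move=> /set_mem; rewrite /cylinder /= size_mkseq => E; rewrite Fx// => i ni.
by have := congr1 (fun s => nth (mseq x 0) s i) E; rewrite !nth_mkseq.
Qed.

Lemma diag_id_in_diag (F : X -> R[i]^o) : continuous F -> CK_diag S (diag_id S F).
Proof. by move=> cF; rewrite -(diag_id_image diag_idP); exists F. Qed.

Lemma diag_id_comm (F : X -> R[i]^o) (x : X) n : continuous F ->
  diag_id S F * P x n = P x n * diag_id S F.
Proof. by move=> cF; apply: (CK_diag_comm S_CK A01 A_irr N_gt0); exact: diag_id_in_diag. Qed.

Section Unitary.
Variables (f : contZ X) (t : R).
Notation U := (gauge_unitary S t f).

Lemma gauge_unitary_loc x : exists n, forall y, agree n x y ->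
  character t (f y) = character t (f x).
Proof. by have [n nP] := contZP f x; exists n => y /nP ->. Qed.

Lemma gauge_unitary_proj x : exists n, forall k, (n <= k)%N ->
  U * P x k = character t (f x) *: P x k.
Proof.
have [n nP] := gauge_unitary_loc x; exists n => k nk.
apply: (diag_id_local (F := fun x => character t (f x))); first exact: gauge_unitary_loc.
by move=> y xy; apply: nP; apply: agree_le xy.
Qed.

Lemma gauge_unitary_comm (x : X) n : U * P x n = P x n * U.
Proof.
apply: diag_id_comm; apply: continuous_locally_constant; exact: gauge_unitary_loc.
Qed.

Lemma star_gauge_unitary_proj x : exists n, forall k, (n <= k)%N ->
  star U * P x k = character t (- f x) *: P x k.
Proof.
have [n nP] := gauge_unitary_proj x; exists n => k /nP E.
rewrite -(prefix_proj_star S) -starM -gauge_unitary_comm E starZ characterN.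
by rewrite (prefix_proj_star S).
Qed.

Lemma gauge_unitaryK : star U * U = 1.
Proof.
apply: (local_eq S_CK A01 A_irr N_gt0) => x.
have [n nP] := gauge_unitary_proj x; have [m mP] := star_gauge_unitary_proj x.
exists (maxn n m); rewrite mul1r -mulrA nP ?leq_maxl// -scalerAr mP ?leq_maxr//.
by rewrite scalerA -characterD subrr character0 scale1r.
Qed.

Lemma gauge_unitary_invK : U * star U = 1.
Proof.
apply: (local_eq S_CK A01 A_irr N_gt0) => x.
have [n nP] := gauge_unitary_proj x; have [m mP] := star_gauge_unitary_proj x.
exists (maxn n m); rewrite mul1r -mulrA mP ?leq_maxr// -scalerAr nP ?leq_maxl//.
by rewrite scalerA -characterD addNr character0 scale1r.
Qed.

Lemma gauge_unitary_word x : exists n, forall k, (n <= k)%N ->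
  U * W x k = character t (f x) *: W x k.
Proof.
have [n nP] := gauge_unitary_proj x; exists n => k /nP E.
by rewrite -{1}(prefix_proj_word S_CK x (leqnn k)) mulrA E -scalerAl
  (prefix_proj_word S_CK).
Qed.

Lemma star_gauge_unitary_word x : exists n, forall k, (n <= k)%N ->
  star U * W x k = character t (- f x) *: W x k.
Proof.
have [n nP] := star_gauge_unitary_proj x; exists n => k /nP E.
by rewrite -{1}(prefix_proj_word S_CK x (leqnn k)) mulrA E -scalerAl
  (prefix_proj_word S_CK).
Qed.

(** The gauge unitary commutes with the range projections of the [S j]. *)
Lemma gauge_CK_family : CK_family A (fun i => U * S i).
Proof.
have range j : U * S j * star (U * S j) = S j * star (S j).
  have [x xj] := point_starting A01 A_irr j.
  have E : S j * star (S j) = P x 1 by rewrite /prefix_proj prefix_word1 xj.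
  rewrite starM mulrA -[U * S j * _]mulrA E gauge_unitary_comm -mulrA.
  by rewrite gauge_unitary_invK mulr1.
split.
- move=> i; rewrite /partial_isometry range mulrA.
  have [x xi] := point_starting A01 A_irr i.
  have E : S i * star (S i) = P x 1 by rewrite /prefix_proj prefix_word1 xi.
  by rewrite E -gauge_unitary_comm -mulrA -E (CK_partial_isometry S_CK).
- by rewrite -[RHS](CK_sum1 S_CK); apply: eq_bigr => j _; exact: range.
- move=> i; rewrite starM mulrA -[star _ * _ * _]mulrA gauge_unitaryK mulr1.
  by rewrite (CK_relation S_CK); apply: eq_bigr => j _; rewrite range.
Qed.

Variable rho : O -> O.
Hypotheses (rho_hom : star_hom rho) (rhoS : forall i, rho (S i) = U * S i).

Lemma gauge_fix_proj (x : X) n : rho (P x n) = P x n.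
Proof.
elim: n x => [|n IH] x.
  by rewrite /prefix_proj prefix_word0 star1 mulr1 (star_hom1 rho_hom).
have PE : P x n.+1 = S (mseq x 0) * P (sigma x) n * star (S (mseq x 0)).
  by rewrite /prefix_proj prefix_wordS starM !mulrA.
rewrite {1}PE (star_homM rho_hom) (star_homM rho_hom (S _)) (star_hom_star rho_hom).
rewrite IH rhoS starM.
transitivity (U * P x n.+1 * star U); first by rewrite [in RHS]PE !mulrA.
by rewrite gauge_unitary_comm -mulrA gauge_unitary_invK mulr1.
Qed.

(** The letters of the word are produced one after the other, each with the
    phase of [f] at the current point of the orbit; the word that follows makes
    these phases constant. *)
Lemma gauge_word (x : X) n : exists K, forall k, (K <= k)%N ->
  rho (W x n) * W (iter n sigma x) k = character t (birkhoff f n x) *: W x (n + k).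
Proof.
elim: n x => [|n IH] x.
  exists 0%N => k _; rewrite prefix_word0 (star_hom1 rho_hom) mul1r.
  by rewrite /birkhoff big_ord0 character0 scale1r.
have [K KP] := IH (sigma x); have [L LP] := gauge_unitary_word x.
exists (maxn K L) => k; rewrite geq_max => /andP[kK kL].
rewrite prefix_wordS (star_homM rho_hom) rhoS.
rewrite (iterSr n) -mulrA KP// -scalerAr -mulrA.
have -> : S (mseq x 0) * W (sigma x) (n + k) = W x (n.+1 + k).
  by rewrite addSn prefix_wordS.
rewrite LP; last by rewrite (leq_trans kL)// leq_addl.
by rewrite scalerA -characterD -add1n birkhoffD /birkhoff big_ord1 addrC.
Qed.

Lemma star_gauge_word (x : X) n : exists K, forall k, (K <= k)%N ->
  star (rho (W x n)) * W x (n + k) =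
  character t (- birkhoff f n x) *: W (iter n sigma x) k.
Proof.
elim: n x => [|n IH] x.
  exists 0%N => k _; rewrite prefix_word0 (star_hom1 rho_hom) star1 mul1r.
  by rewrite /birkhoff big_ord0 oppr0 character0 scale1r.
have [K KP] := IH (sigma x); have [L LP] := star_gauge_unitary_word x.
exists (maxn K (maxn L 1)) => k; rewrite !geq_max => /and3P[kK kL k1].
rewrite prefix_wordS (star_homM rho_hom) rhoS !starM.
rewrite -!mulrA LP; last by rewrite (leq_trans kL)// leq_addl.
rewrite -!scalerAr.
have -> : star (S (mseq x 0)) * W x (n.+1 + k) = W (sigma x) (n + k).
  have -> : (n.+1 + k = 1 + (n + k.-1).+1)%N by lia.
  rewrite -(prefix_word1 S) (prefix_word_absorb S_CK) /=; congr (W _ _); lia.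
rewrite KP// scalerA -characterD (iterSr n).
by rewrite -add1n birkhoffD /birkhoff big_ord1 opprD.
Qed.

End Unitary.

(** Gauge actions fix the cylinder projections, hence the diagonal. *)
Lemma gauge_fix_unitary (f f' : contZ X) t t' rho : star_hom rho ->
    (forall i, rho (S i) = gauge_unitary S t f * S i) ->
  rho (gauge_unitary S t' f') = gauge_unitary S t' f'.
Proof.
move=> rho_hom rhoS; apply: (local_eq S_CK A01 A_irr N_gt0) => x.
have [n /(_ n (leqnn n)) nP] := gauge_unitary_proj f' t' x; exists n.
have fixP := gauge_fix_proj rho_hom rhoS x n.
by rewrite -{1}fixP -(star_homM rho_hom) nP (star_homZ rho_hom) fixP.
Qed.

End Gauge.

Section GaugeAction.
Variables (R : realType) (N : nat) (A : 'M[nat]_N) (O : cstarType R) (S : 'I_N -> O).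
Hypothesis S_alg : CK_algebra A S.
Hypotheses (A01 : zero_one_mx A) (A_irr : irreducible_mx A).
Hypothesis (N_gt0 : (0 < N)%N).
Let S_CK := CK_algebra_family S_alg.

Lemma star_hom_id (E : cstarType R) : star_hom (idfun : E -> E).
Proof. by split. Qed.

Lemma star_hom_comp (E F G : cstarType R) (psi : F -> G) (phi : E -> F) :
  star_hom psi -> star_hom phi -> star_hom (psi \o phi).
Proof.
move=> sp sf; split=> /=.
- by move=> x y; rewrite (star_homD sf) (star_homD sp).
- by move=> a x; rewrite (star_homZ sf) (star_homZ sp).
- by move=> x y; rewrite (star_homM sf) (star_homM sp).
- by rewrite (star_hom1 sf) (star_hom1 sp).
- by move=> x; rewrite (star_hom_star sf) (star_hom_star sp).
Qed.

(** The action exists by the universal property, and the action for [- t]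
    inverts it because each of them fixes the gauge unitaries. *)
Lemma gauge_actionP (f : contZ (shift_space A)) t :
  star_iso (gauge_action S f t) /\
  forall i, gauge_action S f t (S i) = gauge_unitary S t f * S i.
Proof.
apply: (@xgetPex _ _ [set rho : O -> O | star_iso rho /\
   forall i, rho (S i) = gauge_unitary S t f * S i]).
have hom s : exists rho : O -> O, star_hom rho /\
    forall i, rho (S i) = gauge_unitary S s f * S i.
  exact: (CK_algebra_universal S_alg (gauge_CK_family S_CK A01 A_irr N_gt0 f s)).
have [rho [rho_hom rhoS]] := hom t; have [rho' [rho'_hom rho'S]] := hom (- t).
exists rho; split=> //; split=> //.
have inv (s : R) (u v : O -> O) : star_hom u -> star_hom v ->
    (forall i, u (S i) = gauge_unitary S s f * S i) ->
    (forall i, v (S i) = gauge_unitary S (- s) f * S i) -> u \o v = idfun.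
  move=> u_hom v_hom uS vS.
  apply: (star_hom_eq_on_generators (star_hom_comp u_hom v_hom) (star_hom_id O)
    (CK_algebra_generated S_alg)) => i /=.
  rewrite vS (star_homM u_hom) uS.
  rewrite (gauge_fix_unitary S_CK A01 A_irr N_gt0 f (- s) u_hom uS) mulrA.
  rewrite (_ : gauge_unitary S (- s) f * gauge_unitary S s f = 1) ?mul1r//.
  apply: (local_eq S_CK A01 A_irr N_gt0) => x.
  have [n nP] := gauge_unitary_proj S_CK A01 A_irr N_gt0 f s x.
  have [m mP] := gauge_unitary_proj S_CK A01 A_irr N_gt0 f (- s) x.
  exists (maxn n m); rewrite mul1r -mulrA nP ?leq_maxl// -scalerAr mP ?leq_maxr//.
  by rewrite scalerA character_opp -characterD subrr character0 scale1r.
exists rho' => x.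
  by have /(congr1 (@^~ x)) := inv (- t) _ _ rho'_hom rho_hom rho'S (fun i => ltac:(by rewrite opprK)).
by have /(congr1 (@^~ x)) := inv t _ _ rho_hom rho'_hom rhoS rho'S.
Qed.

End GaugeAction.

(** * The isomorphism of the algebras *)

Section Intertwining.
Variables (R : realType) (N M : nat) (A : 'M[nat]_N) (B : 'M[nat]_M).
Hypotheses (A01 : zero_one_mx A) (A_irr : irreducible_mx A)
  (A_nperm : ~~ is_perm_mx A) (N_gt0 : (0 < N)%N).
Hypotheses (B01 : zero_one_mx B) (B_irr : irreducible_mx B)
  (B_nperm : ~~ is_perm_mx B) (M_gt0 : (0 < M)%N).
Variables (OA OB : cstarType R) (SA : 'I_N -> OA) (SB : 'I_M -> OB).
Hypotheses (OA_CK : CK_algebra A SA) (OB_CK : CK_algebra B SB).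
Variable h : homeomorphism (shift_space A) (shift_space B).
Variables k1 l1 : shift_space A -> nat.
Hypothesis kl1 : orbit_cocycles h k1 l1.
Notation sA := (@shift_map N A).
Notation sB := (@shift_map M B).
Notation g := (homeo_inv h).
Let SA_CK := CK_algebra_family OA_CK.
Let SB_CK := CK_algebra_family OB_CK.
Variables (T : 'I_N -> OB) (Phi : OA -> OB).
Hypothesis TP : forall i, implements SB (T i) (conj_rel h (prepend_rel i)).
Hypotheses (Phi_hom : star_hom Phi) (PhiS : forall i, Phi (SA i) = T i).

Lemma Phi_diag_sub : Phi @` CK_diag SA `<=` CK_diag SB.
Proof.
move=> _ [d dD <-].
have DC : cstar_subalgebra (CK_diag SB) := CK_diag_cstar SB.
suff : CK_diag SA `<=` Phi @^-1` CK_diag SB by apply.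
apply: cstar_generated_sub; first exact: preimage_cstar_subalgebra.
move=> _ [mu _ <-] /=.
have [E|] := eqVneq (CK_word SA mu) 0.
  by rewrite /CK_proj E mul0r star_hom0//; exact: cstar_sub0.
move=> /eqP/(CK_word_realized SA_CK A01 A_irr N_gt0)[x <-].
rewrite -[CK_proj SA _]/(prefix_proj SA x (size mu)).
apply: (local_prop SB_CK B01 B_irr M_gt0) => [a b||y n dP|y].
- exact: (cstar_subD DC).
- exact: (cstar_sub0 DC).
- rewrite -(prefix_projM SB_CK y (leqnSn n)) mulrA; apply: (cstar_subM DC) => //.
  exact: CK_diag_prefix.
- have [K KP] := phi_prefix_proj B01 B_irr B_nperm M_gt0 SB_CK kl1 TP Phi_hom PhiS x (size mu) y.
  exists K; rewrite KP//; case: asboolP => _; last exact: (cstar_sub0 DC).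
  exact: CK_diag_prefix.
Qed.

Variables k2 l2 : shift_space B -> nat.
Hypothesis kl2 : orbit_cocycles (homeo_inv h) k2 l2.
Variable f : contZ (shift_space A).

(** By [PsiK] at [g z], the right-hand side is a value of the cocycle of
    [Psi kl2 f] on the pair formed by [z] and [y].  Near an aperiodic point that
    value does not depend on the exponents, so [m] and [n] may be used. *)
Lemma Psi_along_generator i m n y z :
    conj_rel h (prepend_rel i) y z ->
    local_form (conj_rel h (prepend_rel i)) y z m n ->
  birkhoff (Psi kl2 f) m z - birkhoff (Psi kl2 f) n y = f (g z).
Proof.
move=> Gyz yz.
have [L LP] := contZ_uniform (Psi kl2 f).
have [p pP] := contZP f (g z).
have [q qP] := continuous_agree (@homeo_inv_continuous _ _ h) z p.
pose K := (maxn L q).+1.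
have [y' [yy' ay']] := aperiodic_dense B01 B_irr B_nperm (n + K) y.
have [z' Gyz'] : exists z', conj_rel h (prepend_rel i) y' z'.
  apply: local_form_total Gyz yz _; apply: agree_le yy'; rewrite /K; lia.
have yz' := local_form_extend (k := K) Gyz yz.
have [zz' _] := (yz' _ yy' z').1 Gyz'.
have [_ t] := (yz _ (agree_le (leq_addr K n) yy') z').1 Gyz'.
rewrite (agree_birkhoff LP (agree_le (_ : (m + L <= m + K)%N) zz')); last by rewrite /K; lia.
rewrite (agree_birkhoff LP (agree_le (_ : (n + L <= n + K)%N) yy')); last by rewrite /K; lia.
rewrite -(pP (g z')); last first.
  apply: qP; apply: agree_le zz'; rewrite /K; lia.
apply: (cocyc_inj ay'); first by exists m, n; split; first exact: t.
exists (l1 (g z')), (k1 (g z')).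
have kl1' : orbit_cocycles (homeo_inv (homeomorphism_sym h)) k1 l1 := kl1.
have E := congr1 (fun F : contZ (shift_space A) => F (g z'))
  (PsiK A01 A_irr A_nperm kl1' kl2 f).
have [_ wy'] := Gyz'.
have hg w : h (g w) = w := homeo_invK h w.
split.
  have := orbit_cocyclesE kl1 (g z'); rewrite wy' !hg; exact/esym.
rewrite -[LHS]E /= {1}/Psi_fun /= wy' !hg //.
Qed.

Lemma Phi_gauge_unitary t z : exists J, forall j, (J <= j)%N ->
  Phi (gauge_unitary SA t f) * prefix_word SB z j =
  character t (f (g z)) *: prefix_word SB z j.
Proof.
have [p pP] := gauge_unitary_proj SA_CK A01 A_irr N_gt0 f t (g z).
have [J JP] := phi_prefix_proj B01 B_irr B_nperm M_gt0 SB_CK kl1 TP Phi_hom PhiS (g z) p z.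
have {}JP j : (J <= j)%N -> Phi (prefix_proj SA (g z) p) * prefix_proj SB z j = prefix_proj SB z j.
  by move=> /JP ->; rewrite asboolT.
exists J => j /JP E.
rewrite -{1}(prefix_proj_word SB_CK z (leqnn j)) -E mulrA mulrA.
rewrite -(star_homM Phi_hom) pP// (star_homZ Phi_hom) -!scalerAl E.
by rewrite (prefix_proj_word SB_CK).
Qed.

(** Near [y], both sides evaluated at [SA i] are the same prefix exchange
    multiplied by phases, which [Psi_along_generator] identifies. *)
Lemma Phi_intertwines t :
  Phi \o gauge_action SA f t = gauge_action SB (Psi kl2 f) t \o Phi.
Proof.
have [[rhoA_hom _] rhoAS] := gauge_actionP OA_CK A01 A_irr N_gt0 f t.
have [[rhoB_hom _] rhoBS] := gauge_actionP OB_CK B01 B_irr M_gt0 (Psi kl2 f) t.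
set rhoB := gauge_action SB _ _ in rhoB_hom rhoBS *.
apply: (star_hom_eq_on_generators (star_hom_comp Phi_hom rhoA_hom)
  (star_hom_comp rhoB_hom Phi_hom) (CK_algebra_generated OA_CK)) => i /=.
rewrite rhoAS (star_homM Phi_hom) PhiS.
apply: (local_eq SB_CK B01 B_irr M_gt0) => y.
have fixP := gauge_fix_proj SB_CK B01 B_irr M_gt0 rhoB_hom rhoBS.
have [n [[_ TP0]|[z [m [Gyz yz TPn]]]]] := TP i y.
  exists n; rewrite -mulrA TP0 mulr0.
  by rewrite -(fixP y n) -(star_homM rhoB_hom) TP0 star_hom0.
have tail := local_form_tail yz Gyz.
have [J JP] := Phi_gauge_unitary t z.
have [K1 K1P] := gauge_word SB_CK B01 B_irr M_gt0 rhoB_hom rhoBS z m.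
have [K2 K2P] := star_gauge_word SB_CK B01 B_irr M_gt0 rhoB_hom rhoBS y n.
pose k := maxn J (maxn K1 K2).
have Jk : (J <= m + k)%N by rewrite /k; lia.
have K1k : (K1 <= k)%N by rewrite /k; lia.
have K2k : (K2 <= k)%N by rewrite /k; lia.
exists (n + k)%N.
rewrite -mulrA (word_unit_extend SB_CK k tail TPn) mulrA JP//.
have -> : rhoB (T i) * prefix_proj SB y (n + k) =
    rhoB (T i * prefix_proj SB y n) * prefix_proj SB y (n + k).
  rewrite (star_homM rhoB_hom) fixP -[RHS]mulrA (prefix_projM SB_CK)//.
  exact: leq_addr.
rewrite TPn (star_homM rhoB_hom) (star_hom_star rhoB_hom) -mulrA.
rewrite [_ * prefix_proj _ _ _]mulrA K2P// -[in RHS]scalerAl -[in RHS]scalerAr.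
rewrite [in RHS]mulrA -tail K1P//.
rewrite -!scalerAl scalerA; congr (_ *: _).
by rewrite -characterD addrC (Psi_along_generator Gyz yz).
Qed.

End Intertwining.

(** The image of [T' j] implements the map [x |-> j x] conjugated twice, which is
    the map that [SB j] implements. *)
Lemma transported_inverse (R : realType) (N M : nat) (A : 'M[nat]_N) (B : 'M[nat]_M)
    (B01 : zero_one_mx B) (B_irr : irreducible_mx B) (B_nperm : ~~ is_perm_mx B)
    (M_gt0 : (0 < M)%N)
    (OA OB : cstarType R) (SA : 'I_N -> OA) (SB : 'I_M -> OB)
    (SA_CK : CK_family A SA) (OB_CK : CK_algebra B SB)
    (h : homeomorphism (shift_space A) (shift_space B)) k1 l1
    (kl1 : orbit_cocycles h k1 l1) (T : 'I_N -> OB) (T' : 'I_M -> OA)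
    (TP : forall i, implements SB (T i) (conj_rel h (prepend_rel i)))
    (T'P : forall j, implements SA (T' j) (conj_rel (homeomorphism_sym h) (prepend_rel j)))
    (Phi : OA -> OB) (Phi' : OB -> OA)
    (Phi_hom : star_hom Phi) (PhiS : forall i, Phi (SA i) = T i)
    (Phi'_hom : star_hom Phi') (Phi'S : forall j, Phi' (SB j) = T' j) :
  cancel Phi' Phi.
Proof.
have SB_CK := CK_algebra_family OB_CK.
suff E : Phi \o Phi' = idfun by move=> x; exact: (congr1 (@^~ x) E).
apply: (star_hom_eq_on_generators (star_hom_comp Phi_hom Phi'_hom) (star_hom_id OB)
    (CK_algebra_generated OB_CK)) => j /=.
rewrite Phi'S; apply: (implements_inj SB_CK B01 B_irr B_nperm M_gt0); last first.
  exact: implements_generator.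
apply: implements_ext (implements_transport B01 B_irr B_nperm M_gt0 SB_CK kl1 TP
  Phi_hom PhiS (T'P j)) => y z.
by rewrite /conj_rel /= !homeo_invK.
Qed.

Theorem theorem1p1 (R : realType) (N M : nat) (A : 'M[nat]_N) (B : 'M[nat]_M)
    (N_gt1 : (1 < N)%N) (M_gt1 : (1 < M)%N)
    (A01 : zero_one_mx A) (B01 : zero_one_mx B)
    (A_irr : irreducible_mx A) (B_irr : irreducible_mx B)
    (A_nperm : ~~ is_perm_mx A) (B_nperm : ~~ is_perm_mx B)
    (OA OB : cstarType R) (SA : 'I_N -> OA) (SB : 'I_M -> OB)
    (OA_CK : CK_algebra A SA) (OB_CK : CK_algebra B SB)
    (h : homeomorphism (shift_space A) (shift_space B)) (h_coe : coe_via h) :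
  exists Phi : OA -> OB,
    [/\ star_iso Phi,
        Phi @` CK_diag SA = CK_diag SB &
        forall (k2 l2 : shift_space B -> nat)
          (kl : orbit_cocycles (homeo_inv h) k2 l2),
          (forall (f : contZ (shift_space A)) (t : R),
             Phi \o gauge_action SA f t = gauge_action SB (Psi kl f) t \o Phi) /\
          induces_ordered_iso (Psi kl)].
Proof.
have N_gt0 := ltnW N_gt1; have M_gt0 := ltnW M_gt1.
have [[k1 [l1 kl1]] [k0 [l0 kl0]]] := h_coe.
pose h' := homeomorphism_sym h.
have SA_CK := CK_algebra_family OA_CK; have SB_CK := CK_algebra_family OB_CK.
have kl0' : orbit_cocycles h' k0 l0 by exact: kl0.
have [T TP] := transported_generators B01 B_irr M_gt0 SB_CK kl1.
have [T' T'P] := transported_generators A01 A_irr N_gt0 SA_CK kl0'.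
have T_CK := transported_CK_family A01 B01 B_irr B_nperm M_gt0 SB_CK kl1 TP.
have T'_CK := transported_CK_family B01 A01 A_irr A_nperm N_gt0 SA_CK kl0' T'P.
have [Phi [Phi_hom PhiS]] := CK_algebra_universal OA_CK T_CK.
have [Phi' [Phi'_hom Phi'S]] := CK_algebra_universal OB_CK T'_CK.
have PhiK' : cancel Phi' Phi by exact: (transported_inverse B01 B_irr B_nperm M_gt0 SA_CK
  OB_CK kl1 TP T'P Phi_hom PhiS Phi'_hom Phi'S).
have Phi'K : cancel Phi Phi'.
  apply: (transported_inverse A01 A_irr A_nperm N_gt0 SB_CK OA_CK kl0' T'P _
    Phi'_hom Phi'S Phi_hom PhiS).
  by move=> i; apply: implements_ext (TP i).
exists Phi; split.
- by split=> //; exists Phi'.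
- apply/seteqP; split.
    exact: (Phi_diag_sub A01 A_irr N_gt0 B01 B_irr B_nperm M_gt0 OA_CK OB_CK kl1 TP Phi_hom PhiS).
  move=> d dD; exists (Phi' d) => //.
  apply: (Phi_diag_sub B01 B_irr M_gt0 A01 A_irr A_nperm N_gt0 OB_CK OA_CK kl0' T'P Phi'_hom Phi'S).
  by exists d.
- move=> k2 l2 kl; split=> [f t|].
    exact: (Phi_intertwines A01 A_irr A_nperm N_gt0 B01 B_irr B_nperm M_gt0 OA_CK OB_CK kl1 TP).
  by apply: (Psi_induces_ordered_iso A01 A_irr A_nperm B01 B_irr B_nperm (k1 := k1) (l1 := l1)).
Qed.
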